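(* Let $w(x,y)=R(|x-y|)$ for all $x,y\in[0,1]$, where $R:[0,1]\to(0,1]$ is $\mathcal{C}^1$ with $R'(x)<0$ for all $x\in(0,1)$. For each $N$ let $G^{(N)}\sim w$ and let $\hat\sigma^{(N)}$ be the output of the spectral seriation algorithm with input $G^{(N)}$. (i) For every $\varepsilon\in(0,1)$ and $\eta\in(0,1/3)$ there exist $C=C(w)>0$ and $N_0=N_0(w,\varepsilon,\eta)$ such that for all $N\ge N_0$, $\mathbb{P}(\|\hat\sigma^{(N)}-\mathrm{id}_N\|_1\le CN^{2-\eta})>1-\varepsilon$. (ii) Let $\tilde\sigma^{(N)}$ be the output of the post-processing algorithm with input $G^{(N)}$ and parameters $\alpha=0.05$, $\beta=0.31$. Then for every $\gamma>1$ and $\epsilon>0$ there exist $\delta=\delta(w,\gamma,\epsilon)>0$ and $N_0=N_0(w,\gamma,\epsilon)$ such that for all $N\ge N_0$, $\mathbb{P}(\|\tilde\sigma^{(N)}-\mathrm{id}_N\|_\infty\le\epsilon\sqrt{N(\log N)^\gamma})>1-\varepsilon_\gamma(N)^\delta$.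
   Context: Random graph $G\sim w$ on $V=\{v_1,\dots,v_N\}$, $v_i=i/N$: edges $\{v_i,v_j\}$, $i<j$, present independently with probability $w(v_i,v_j)$. For a finite set $S$ and $f:S\to\mathbb{R}$, $\sigma_f(s)=|\{s'\in S: f(s')\le f(s)\}|$ (ties broken arbitrarily to get a bijection $S\to[|S|]$); for an ordering $\sigma:S\to[|S|]$, $\mathrm{rev}(\sigma)=|S|+1-\sigma$. Spectral seriation algorithm: given a graph with adjacency matrix $A$, take an eigenvector $\phi$ of its Laplacian $D-A$ ($D$ diagonal degree matrix) for the second-smallest eigenvalue and output $\sigma_\phi$. Subroutine (input $G$, disjoint $T,S\subset V$, $\alpha,\beta$): (1) $\hat\sigma_T$ = spectral seriation of the induced subgraph $G|_T$; (2) $R=\{u\in T:\hat\sigma_T(u)\ge(1-\alpha)|T|\}$, $L=\{u\in T:\hat\sigma_T(u)\le\alpha|T|\}$; (3) for $v\in S$, $\psi_R(v)=|T|^{-1}|\{u\in R:\{u,v\}\in E\}|$, $\psi_L(v)=|T|^{-1}|\{u\in L:\{u,v\}\in E\}|$; (4) $c_R=\inf\{c\ge0:|\{v\in S:\psi_R(v)\le c\}|\ge(1-\beta)|S|\}$, $c_L$ analogously with $\psi_L$; (5) define antisymmetric $\hat F:S^2\to\{-1,0,1\}$ ($\hat F(v,u)=-\hat F(u,v)$, $\hat F(u,u)=0$) by, for $u<v$: $\hat F(u,v)=1-2\cdot\mathbf{1}[\psi_R(u)>\psi_R(v)]$ if $\psi_R(u),\psi_R(v)<c_R$; otherwise $1-2\cdot\mathbf{1}[\psi_L(u)<\psi_L(v)]$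 if $\psi_L(u),\psi_L(v)<c_L$; otherwise $1$ if $\psi_R(u)<c_R$; otherwise $-1$; (6) $\hat f(v)=\sum_{u\in S}\hat F(u,v)$; (7) output $\sigma_{\hat f}:S\to[|S|]$. A partition $(S_1,S_2,S_3)$ of $V$ is good if $n\le|S_3|\le|S_2|\le|S_1|\le n+1$, $n=\lfloor N/3\rfloor$. Orderings $\sigma_1:S_1\to[|S_1|]$, $\sigma_2:S_2\to[|S_2|]$ are aligned if $\max_{i\in S_1\cap S_2}|\sigma_1(i)/|S_1|-\sigma_2(i)/|S_2||\le\max_{i\in S_1\cap S_2}|\mathrm{rev}(\sigma_1)(i)/|S_1|-\sigma_2(i)/|S_2||$ (aligned if $S_1\cap S_2=\emptyset$). The merged ordering of $(\sigma_1,\sigma_2,\sigma_3)$ on a good partition is $\sigma:[N]\to[N]$ with $\sigma^{-1}(3k+j)=N\sigma_j^{-1}(k+1)$ for $k\in\{0,\dots,n\}$, $j\in\{1,2,3\}$, $3k+j\le N$. Post-processing algorithm (input $G$, $\alpha,\beta$): choose uniformly at random a good partition $(S_1,S_2,S_3)$ and independently another $(S_1',S_2',S_3')$; run the subroutine on $(T,S)=(S_3,S_1),(S_1,S_2),(S_2,S_3)$ to get $\hat\sigma_1,\hat\sigma_2,\hat\sigma_3$, and on $(S_1',S_2')$ to get $\hat\sigma_{\mathrm{ref}}$; replace each $\hat\sigma_j$ by $\mathrm{rev}(\hat\sigma_j)$ if it is not aligned with $\hat\sigma_{\mathrm{ref}}$; output the merged ordering of $(\hat\sigma_1,\hat\sigma_2,\hat\sigma_3)$.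 Distances are symmetrized under reversal: for a permutation $\sigma$ of $[N]$, $\|\sigma-\mathrm{id}_N\|_p:=\min(\|\sigma-\mathrm{id}_N\|_p,\|\mathrm{rev}(\sigma)-\mathrm{id}_N\|_p)$ for $p\in\{1,\infty\}$, with $\mathrm{rev}(\sigma)(i)=N+1-\sigma(i)$. $\varepsilon_\gamma(N)=\exp(-(\log N)^\gamma)$. *)

(* Defs.v *)
From HB Require Import structures.
From mathcomp Require Import all_boot all_order all_algebra.
From mathcomp Require Import all_classical all_reals all_analysis.

Set Implicit Arguments.
Unset Strict Implicit.
Unset Printing Implicit Defensive.

Import Order.TTheory GRing.Theory Num.Theory.
Import numFieldNormedType.Exports.
Local Open Scope classical_set_scope.
Local Open Scope ring_scope.

Definition C1_on01 (R : realType) (rho : R -> R) : Prop :=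
  [/\ {within [set x : R | 0 <= x <= 1], continuous rho},
      (forall x : R, 0 < x < 1 -> derivable rho x 1)
    & exists g : R -> R, {within [set x : R | 0 <= x <= 1], continuous g} /\
        (forall x : R, 0 < x < 1 -> derive1 rho x = g x)].

Definition wfun (R : realType) (rho : R -> R) (x y : R) : R := rho `|x - y|.

(* Vertex v_{i+1} = (i+1)/N is represented by i : 'I_N (0-based).
   A graph is an edge indicator on ordered pairs; only pairs (i,j), i<j, are
   used (pairs with i >= j must be absent, they carry weight 0 otherwise). *)
Definition graph (N : nat) := {ffun 'I_N * 'I_N -> bool}.

Definition adj (N : nat) (e : graph N) (u v : 'I_N) : bool :=
  if (u < v)%N then e (u, v) else if (v < u)%N then e (v, u) else false.

Definition vpos (R : realType) (N : nat) (i : 'I_N) : R := (i.+1)%:R / N%:R.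

Definition edge_prob (R : realType) (N : nat) (w : R -> R -> R) (e : graph N) : R :=
  \prod_(p : 'I_N * 'I_N)
    (if (p.1 < p.2)%N then
       (if e p then w (vpos R p.1) (vpos R p.2) else 1 - w (vpos R p.1) (vpos R p.2))
     else (if e p then 0 else 1)).

(* An ordering sigma : S -> [|S|] is represented by a function 'I_N -> nat
   which is a bijection from S onto {0,...,|S|-1} (0-based ranks: the paper's
   value sigma(s) is our sigma s + 1); values outside S are irrelevant. *)
Definition is_ordering (N : nat) (S : {set 'I_N}) (sigma : 'I_N -> nat) : Prop :=
  {in S &, injective sigma} /\ {in S, forall s, (sigma s < #|S|)%N}.

(* sigma is a possible value of sigma_f (ties broken arbitrarily) *)
Definition ordered_by (R : realType) (N : nat) (f : 'I_N -> R)
    (S : {set 'I_N}) (sigma : 'I_N -> nat) : Prop :=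
  is_ordering S sigma /\
  {in S &, forall s s', f s < f s' -> (sigma s < sigma s')%N}.

Definition revo (N : nat) (S : {set 'I_N}) (sigma : 'I_N -> nat) : 'I_N -> nat :=
  fun i => (#|S| - (sigma i).+1)%N.

Definition lapT (R : realType) (N : nat) (e : graph N) (T : {set 'I_N}) : 'M[R]_#|T| :=
  \matrix_(i, j) ((i == j)%:R * (#|[set v in T | adj e (enum_val i) v]|)%:R
                   - (adj e (enum_val i) (enum_val j))%:R).

Definition second_smallest_eig (R : realType) (n : nat) (M : 'M[R]_n) (lam : R) : Prop :=
  exists s : seq R, [/\ sorted <=%R s, char_poly M = \prod_(x <- s) ('X - x%:P),
                        (1 < size s)%N & lam = s`_1].

Definition spec_ser (R : realType) (N : nat) (e : graph N) (T : {set 'I_N})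
    (sigma : 'I_N -> nat) : Prop :=
  exists (lam : R) (phi : 'rV[R]_#|T|),
    [/\ second_smallest_eig (lapT R e T) lam, phi != 0,
        phi *m lapT R e T = lam *: phi, is_ordering T sigma
      & forall i j : 'I_#|T|, phi 0 i < phi 0 j ->
          (sigma (enum_val i) < sigma (enum_val j))%N].

Definition psi (R : realType) (N : nat) (e : graph N) (T X : {set 'I_N}) (v : 'I_N) : R :=
  (#|[set u in X | adj e u v]|)%:R / (#|T|)%:R.

Definition thresh (R : realType) (N : nat) (S : {set 'I_N}) (beta : R) (f : 'I_N -> R) : R :=
  inf [set c : R | 0 <= c /\
         (1 - beta) * (#|S|)%:R <= (#|[set v in S | f v <= c]|)%:R].

Definition Fup (R : realType) (N : nat) (pR pL : 'I_N -> R) (cR cL : R) (u v : 'I_N) : R :=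
  if (pR u < cR) && (pR v < cR) then (if pR v < pR u then -1 else 1)
  else if (pL u < cL) && (pL v < cL) then (if pL u < pL v then -1 else 1)
  else if pR u < cR then 1 else -1.

Definition Fhat (R : realType) (N : nat) (pR pL : 'I_N -> R) (cR cL : R) (u v : 'I_N) : R :=
  if (u < v)%N then Fup pR pL cR cL u v
  else if (v < u)%N then - Fup pR pL cR cL v u else 0.

Definition subroutine (R : realType) (N : nat) (e : graph N) (T S : {set 'I_N})
    (alpha beta : R) (sigma : 'I_N -> nat) : Prop :=
  exists sigT : 'I_N -> nat, spec_ser R e T sigT /\
    let Rs := [set u in T | (1 - alpha) * (#|T|)%:R <= ((sigT u).+1)%:R] in
    let Ls := [set u in T | ((sigT u).+1)%:R <= alpha * (#|T|)%:R] in
    let pR := psi R e T Rs in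
    let pL := psi R e T Ls in
    let cR := thresh S beta pR in
    let cL := thresh S beta pL in
    ordered_by (fun v => \sum_(u in S) Fhat pR pL cR cL u v) S sigma.

Definition part3 (N : nat) := ({set 'I_N} * {set 'I_N} * {set 'I_N})%type.

Definition good (N : nat) (P : part3 N) : bool :=
  let S1 := P.1.1 in let S2 := P.1.2 in let S3 := P.2 in
  [&& S1 :|: S2 :|: S3 == [set: 'I_N]%SET, [disjoint S1 & S2], [disjoint S1 & S3],
      [disjoint S2 & S3], (N %/ 3 <= #|S3|)%N, (#|S3| <= #|S2|)%N,
      (#|S2| <= #|S1|)%N & (#|S1| <= (N %/ 3).+1)%N].

Definition aligned (R : realType) (N : nat) (A B : {set 'I_N}) (s1 s2 : 'I_N -> nat) : bool :=
  \big[Num.max/(0:R)]_(i in A :&: B)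
      `| ((s1 i).+1)%:R / (#|A|)%:R - ((s2 i).+1)%:R / (#|B|)%:R |
  <= \big[Num.max/(0:R)]_(i in A :&: B)
      `| ((#|A| - s1 i)%N)%:R / (#|A|)%:R - ((s2 i).+1)%:R / (#|B|)%:R |.

Definition merged (N : nat) (P : part3 N) (s1 s2 s3 : 'I_N -> nat) : 'I_N -> nat :=
  fun u => if u \in P.1.1 then (3 * s1 u)%N
           else if u \in P.1.2 then (3 * s2 u + 1)%N else (3 * s3 u + 2)%N.

(* sigma is a possible output of post-processing on G, given the two random
   good partitions P and P' *)
Definition postproc (R : realType) (N : nat) (e : graph N) (P P' : part3 N)
    (alpha beta : R) (sigma : 'I_N -> nat) : Prop :=
  exists s1 s2 s3 sref : 'I_N -> nat,
    [/\ subroutine e P.2 P.1.1 alpha beta s1,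
        subroutine e P.1.1 P.1.2 alpha beta s2,
        subroutine e P.1.2 P.2 alpha beta s3,
        subroutine e P'.1.1 P'.1.2 alpha beta sref
      & let fix_ (S : {set 'I_N}) (s : 'I_N -> nat) :=
            if aligned R S P'.1.2 s sref then s else revo S s in
        forall u, sigma u = merged P (fix_ P.1.1 s1) (fix_ P.1.2 s2) (fix_ P.2 s3) u].

Definition adist (m n : nat) : nat := (m - n + (n - m))%N.

Definition dist1 (N : nat) (sigma : 'I_N -> nat) : nat :=
  minn (\sum_(i : 'I_N) adist (sigma i) i)
       (\sum_(i : 'I_N) adist (N - (sigma i).+1) i).

Definition distinf (N : nat) (sigma : 'I_N -> nat) : nat :=
  minn (\max_(i : 'I_N) adist (sigma i) i)
       (\max_(i : 'I_N) adist (N - (sigma i).+1) i).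

Definition eps_gamma (R : realType) (gamma : R) (N : nat) : R :=
  expR (- ((ln (N%:R : R)) `^ gamma)).

Definition ngood (N : nat) : nat := #|[set P : part3 N | good P]|.

(* Main.v *)
(** In terms of the increments of a vector, the Laplacian of the noiseless weight matrix
    [rho (|i - j| / m)] is a positive kernel.  Hence the minimiser [f] of its quadratic form on
    the vectors of sum zero is monotone, with increments of order [1 / m], and bounding the
    oscillation of the ratio of the increments of two eigenvectors gives a spectral gap of
    order [m].  If [O(N^2)] linear statistics of the edges deviate from their means by at most
    [t], the second eigenvector of the random Laplacian is close to [f] in sup norm (the gap
    gives an [l^2] bound, which the eigenvector equation improves row by row), so that spectral
    seriation misplaces every vertex by [O(t)] only.  Part (i) is the case [t = N^(2/3)].

    On the same event the post-processing is deterministic up to [O(t)]: the counts [psi_R] and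
    [psi_L] are monotone in the position except near one end, [Fhat u v] is the correct sign
    whenever the positions of [u] and [v] differ by more than [O(t)], and the reference ordering
    separates the two orientations because the sets of the two partitions share a vertex in the
    first quarter.  In particular the dependence between the four runs plays no role.  The
    deviations have probability at most [poly(N) exp(- t^2 / (8 N))] by an exponential moment
    bound; a random good partition is compared with independent uniform labels, of which the
    good ones are a fraction at least [(N + 1)^(-2)].  Part (ii) takes
    [t] of order [sqrt (N (ln N)^gamma)]. *)
Require Import Defs.
From HB Require Import structures.
From mathcomp Require Import all_boot all_order all_algebra.
From mathcomp Require Import all_classical all_reals all_analysis.
From mathcomp Require Import ring lra zify.
Set Implicit Arguments.
Unset Strict Implicit.
Unset Printing Implicit Defensive.
Import Order.TTheory GRing.Theory Num.Theory.
Import numFieldNormedType.Exports.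
Local Open Scope ring_scope.

(** * Minimal eigenvectors and Laplacians *)

Lemma le_of_eq (R : realType) (x y : R) : x = y -> x <= y.
Proof. by move=> ->. Qed.

Definition dot (R : realType) (n : nat) (x y : 'rV[R]_n) : R :=
  \sum_i x 0 i * y 0 i.

Section Dot.
Variables (R : realType) (n : nat).
Implicit Types (x y z : 'rV[R]_n) (M : 'M[R]_n).

Lemma dotC x y : dot x y = dot y x.
Proof. by apply: eq_bigr => i _; rewrite mulrC. Qed.

Lemma dotDl x y z : dot (x + y) z = dot x z + dot y z.
Proof. by rewrite -big_split; apply: eq_bigr => i _; rewrite mxE mulrDl. Qed.

Lemma dotZl a x y : dot (a *: x) y = a * dot x y.
Proof. by rewrite mulr_sumr; apply: eq_bigr => i _; rewrite mxE mulrA. Qed.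

Lemma dotDr x y z : dot z (x + y) = dot z x + dot z y.
Proof. by rewrite dotC dotDl !(dotC z). Qed.

Lemma dotZr a x y : dot x (a *: y) = a * dot x y.
Proof. by rewrite dotC dotZl dotC. Qed.

Lemma dotNl x y : dot (- x) y = - dot x y.
Proof. by rewrite -scaleN1r dotZl mulN1r. Qed.

Lemma dotNr x y : dot x (- y) = - dot x y.
Proof. by rewrite dotC dotNl dotC. Qed.

Lemma dot_ge0 x : 0 <= dot x x.
Proof. by apply: sumr_ge0 => i _; rewrite -expr2 sqr_ge0. Qed.

Lemma dot_eq0 x : (dot x x == 0) = (x == 0).
Proof.
apply/eqP/eqP => [/eqP|->]; last by rewrite /dot big1 // => i _; rewrite mxE mul0r.
rewrite psumr_eq0 => [/allP h|i _]; last by rewrite -expr2 sqr_ge0.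
apply/rowP => i; rewrite mxE; have := h i (mem_index_enum _).
by rewrite /= mulf_eq0 orbb => /eqP.
Qed.

Lemma dot_gt0 x : x != 0 -> 0 < dot x x.
Proof. by rewrite lt_def dot_eq0 dot_ge0 andbT. Qed.

Lemma dot_mulmx M x y : M^T = M -> dot (x *m M) y = dot x (y *m M).
Proof.
move=> sM; rewrite /dot.
under eq_bigr do rewrite mxE mulr_suml.
under [RHS]eq_bigr do rewrite mxE mulr_sumr.
rewrite exchange_big; apply: eq_bigr => i _; apply: eq_bigr => j _.
by rewrite -[in M i j]sM mxE; ring.
Qed.

Lemma dot_CS x y : dot x y ^+ 2 <= dot x x * dot y y.
Proof.
have [->|/dot_gt0 y0] := eqVneq y 0.
  suff -> : dot x 0 = 0 by rewrite expr0n mulr_ge0 ?dot_ge0.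
  by rewrite /dot big1 // => i _; rewrite mxE mulr0.
have := dot_ge0 (dot y y *: x - dot x y *: y).
rewrite dotDl !dotDr !dotNl !dotNr !dotZl !dotZr (dotC y x) => h.
have : 0 <= dot y y * (dot x x * dot y y - dot x y ^+ 2) by lra.
by rewrite pmulr_rge0 // subr_ge0.
Qed.

Lemma dot_abs_le x y (a b : R) : 0 <= a -> 0 <= b ->
  dot x x <= a ^+ 2 -> dot y y <= b ^+ 2 -> `|dot x y| <= a * b.
Proof.
move=> a0 b0 hx hy; rewrite -(@ler_pXn2r _ 2) ?nnegrE ?mulr_ge0 //.
rewrite real_normK ?num_real // exprMn; apply: le_trans (dot_CS x y) _.
by apply: ler_pM => //; exact: dot_ge0.
Qed.

Lemma coord_le_dot x i : x 0 i ^+ 2 <= dot x x.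
Proof.
rewrite /dot (bigD1 i) //= -expr2 lerDl.
by apply: sumr_ge0 => j _; rewrite -expr2 sqr_ge0.
Qed.

End Dot.

(* The invariant subspace is encoded as the row kernel of [B]. *)
Lemma invariant_min_eigenvector (R : realType) (n k : nat) (M : 'M[R]_n)
    (B : 'M[R]_(n, k)) :
  M^T = M -> (forall x : 'rV_n, x *m B = 0 -> x *m M *m B = 0) ->
  (exists2 x : 'rV_n, x != 0 & x *m B = 0) ->
  exists (x : 'rV_n) (mu : R), [/\ x *m B = 0, dot x x = 1, x *m M = mu *: x &
    forall y : 'rV_n, y *m B = 0 -> mu * dot y y <= dot (y *m M) y].
Proof.
move=> sM inv [x0 x0n x0B].
pose A : set 'rV[R]_n := [set x | x *m B = 0 /\ dot x x = 1]%classic.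
have ccoord (i : 'I_n) : continuous (fun x : 'rV[R]_n => x 0 i : R).
  exact: coord_continuous.
have csum (m : nat) (F : 'I_m -> 'rV[R]_n -> R) :
    (forall i, continuous (F i)) -> continuous (fun x => \sum_i F i x).
  move=> cF; apply: (continuous_big (op := +%R)) => [|i _]; last exact: cF.
  exact: add_continuous.
have cM (k' : nat) (C : 'M[R]_(n, k')) i : continuous (fun x : 'rV[R]_n => (x *m C) 0 i).
  have -> : (fun x : 'rV[R]_n => (x *m C) 0 i) = (fun x => \sum_j x 0 j * C j i).
    by apply: funext => x; rewrite mxE.
  apply: csum => j x; apply: cvgM; [exact: nbhs_filter|exact: ccoord|exact: cst_continuous].
have cQ (C : 'M[R]_n) : continuous (fun x : 'rV[R]_n => dot (x *m C) x).
  apply: csum => i x; apply: cvgM; [exact: nbhs_filter|exact: cM|exact: ccoord].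
have Qid (x : 'rV[R]_n) : dot (x *m 1%:M) x = dot x x by rewrite mulmx1.
have A_compact : compact A.
  apply: bounded_closed_compact.
    exists 1; split; first exact: num_real.
    move=> b b1 x [_ x1]; rewrite /Num.norm /= mx_normrE.
    apply/bigmax_leP; split=> [|[i j] _ /=]; first lra.
    rewrite (ord1 i) -(@ler_pXn2r _ 2) ?nnegrE //; last lra.
    rewrite real_normK ?num_real //; apply: (le_trans (coord_le_dot x j)).
    by rewrite x1; nra.
  have -> : A = ([set x | dot x x = 1] `&` \bigcap_(i in setT) [set x | (x *m B) 0 i = 0])%classic.
    apply/seteqP; split=> x /=.
      by move=> [xB x1]; split => // i _ /=; rewrite xB mxE.
    by move=> [x1 xB]; split=> //; apply/rowP => i; rewrite xB // mxE.
  apply: closedI.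
    have -> : [set x : 'rV[R]_n | dot x x = 1]%classic =
        ((fun x => dot (x *m 1%:M) x) @^-1` [set y | y = 1])%classic.
      by apply/seteqP; split=> x /=; rewrite Qid.
    by apply: preimage_closed => [x _|]; [exact: cQ|exact: closed_eq].
  apply: closed_bigI => i _.
  have -> : [set x : 'rV[R]_n | (x *m B) 0 i = 0]%classic =
      ((fun x => (x *m B) 0 i) @^-1` [set y | y = 0])%classic by [].
  by apply: preimage_closed => [x _|]; [exact: cM|exact: closed_eq].
have A_nonempty : (A !=set0)%classic.
  have d0 := dot_gt0 x0n.
  exists ((Num.sqrt (dot x0 x0))^-1 *: x0); split.
    by rewrite -scalemxAl x0B scaler0.
  rewrite dotZl dotZr mulrA -invfM -expr2 sqr_sqrtr ?dot_ge0 //.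
  by rewrite mulVf // gt_eqF.
have [x xA xmin] : exists2 c, c \in A & forall t, t \in A -> dot (c *m M) c <= dot (t *m M) t.
  apply: EVT_min_rV => //; apply: continuous_subspaceT; exact: cQ.
move: xA; rewrite inE => -[xB x1].
set mu := dot (x *m M) x in xmin *.
have hmin (y : 'rV_n) : y *m B = 0 -> mu * dot y y <= dot (y *m M) y.
  move=> yB; have [->|y0] := eqVneq y 0.
    by rewrite mul0mx {1 2}/dot !big1 ?mulr0 // => i _; rewrite mxE mul0r.
  have d0 := dot_gt0 y0.
  have : (Num.sqrt (dot y y))^-1 *: y \in A.
    rewrite inE; split; first by rewrite -scalemxAl yB scaler0.
    rewrite dotZl dotZr mulrA -invfM -expr2 sqr_sqrtr ?dot_ge0 //.
    by rewrite mulVf // gt_eqF.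
  move=> /xmin; rewrite -scalemxAl dotZl dotZr mulrA -invfM -expr2 sqr_sqrtr ?dot_ge0 //.
  by rewrite mulrC ler_pdivlMr.
exists x, mu; split => //; apply/eqP; rewrite -subr_eq0 -dot_eq0; apply/eqP.
set z := x *m M - mu *: x.
have zB : z *m B = 0 by rewrite mulmxBl inv // -scalemxAl xB scaler0 subr0.
have xz : dot (x *m M) z = dot z z + mu * dot x z.
  by rewrite -dotZl -dotDl subrK.
clearbody z.
(* first variation of the quadratic form at the minimiser in the direction z *)
have var (s : R) : 0 <= 2 * s * dot z z + s ^+ 2 * (dot (z *m M) z - mu * dot z z).
  have := hmin (x + s *: z); rewrite !mulmxDl -!scalemxAl xB zB scaler0 addr0.
  move=> /(_ erefl); rewrite !dotDl !dotDr !dotZl !dotZr x1 -/mu !xz.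
  have -> : dot (z *m M) x = dot z z + mu * dot x z by rewrite dot_mulmx // dotC.
  rewrite (dotC z x); lra.
set a := dot z z in var *; set b := dot (z *m M) z - _ in var.
have a0 : 0 <= a by exact: dot_ge0.
apply/eqP; rewrite eq_le a0 andbT leNgt; apply/negP => apos.
have := var (- a / (`|b| + 1)).
rewrite leNgt => /negP; apply.
have s0 : 0 < a / (`|b| + 1) by rewrite divr_gt0.
have sE : a / (`|b| + 1) * (`|b| + 1) = a by rewrite divfK ?gt_eqF.
set s := a / (`|b| + 1) in s0 sE *.
rewrite mulNr -/s; have := ler_norm b; nra.
Qed.

Definition lap (R : realType) (n : nat) (W : 'M[R]_n) : 'M[R]_n :=
  \matrix_(i, j) ((i == j)%:R * (\sum_k W i k) - W i j).

Section Lap.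
Variables (R : realType) (n : nat).
Implicit Types (x y : 'rV[R]_n) (W : 'M[R]_n).

Lemma mulmx_lapE W x j :
  (x *m lap W) 0 j = x 0 j * (\sum_k W j k) - \sum_i x 0 i * W i j.
Proof.
rewrite mxE; under eq_bigr do rewrite mxE mulrBr.
rewrite big_split sumrN /= (bigD1 j) //= eqxx mul1r [X in _ + X - _]big1 ?addr0 // => i /negbTE ->.
by rewrite mul0r mulr0.
Qed.

Lemma lap_sym W : W^T = W -> (lap W)^T = lap W.
Proof.
move=> sW; apply/matrixP => i j; rewrite !mxE; have [->//|ij] := eqVneq i j.
by rewrite !mul0r -[in W j i]sW mxE.
Qed.

Lemma lap_const W : W^T = W -> const_mx 1 *m lap W = 0 :> 'rV_n.
Proof.
move=> sW; apply/rowP => j; rewrite mulmx_lapE !mxE mul1r.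
rewrite [X in _ - X](eq_bigr (fun i => W j i)) ?subrr // => i _.
by rewrite mxE mul1r -[in W i j]sW mxE.
Qed.

Lemma sum0_mulmx x : (x *m const_mx 1 = 0 :> 'M[R]_1) <-> \sum_i x 0 i = 0.
Proof.
have E : (x *m const_mx 1 : 'M[R]_1) 0 0 = \sum_i x 0 i.
  by rewrite mxE; apply: eq_bigr => i _; rewrite mxE mulr1.
split=> [h|h]; first by rewrite -E h mxE.
by apply/matrixP => i j; rewrite !ord1 E h mxE.
Qed.

Lemma dot_const x : dot x (const_mx 1) = \sum_i x 0 i.
Proof. by apply: eq_bigr => i _; rewrite mxE mulr1. Qed.

Lemma eigen_orthogonal (L : 'M[R]_n) x y (a b : R) : L^T = L ->
  x *m L = a *: x -> y *m L = b *: y -> a != b -> dot x y = 0.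
Proof.
move=> sL xa yb ab; apply/eqP.
have : a * dot x y = b * dot x y by rewrite -dotZl -xa dot_mulmx // yb dotZr.
by move/eqP; rewrite -subr_eq0 -mulrBl mulf_eq0 subr_eq0 (negbTE ab).
Qed.

End Lap.

(* Adding all columns of [X - L] to the first one extracts a factor [X] of the
   characteristic polynomial; the cofactor does not vanish at [0]. *)
Lemma char_poly_simple_zero (R : realType) (n : nat) (L : 'M[R]_n) :
  L^T = L -> const_mx 1 *m L = 0 :> 'rV_n ->
  (forall x : 'rV_n, \sum_i x 0 i = 0 -> x != 0 -> 0 < dot (x *m L) x) ->
  forall p : {poly R}, char_poly L != 'X * 'X * p.
Proof.
case: n L => [|n] L sL L1 Lpos p; apply/eqP => chi.
  have := congr1 (fun q : {poly R} => q.[0]) chi.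
  rewrite /char_poly det_mx00 !hornerE => /eqP.
  by rewrite oner_eq0.
pose P := char_poly_mx L.
pose E : 'M[{poly R}]_n.+1 := \matrix_(i, j) (if j == 0 then 1 else (i == j)%:R).
pose N : 'M[{poly R}]_n.+1 := \matrix_(i, j) (if j == 0 then 1 else P i j).
pose D : 'rV[{poly R}]_n.+1 := \row_j (if j == 0 then 'X else 1).
have colL (i : 'I_n.+1) : \sum_j L i j = 0.
  have := congr1 (fun v : 'rV_n.+1 => v 0 i) L1.
  rewrite mxE [RHS]mxE => h; rewrite -[RHS]h; apply: eq_bigr => j _.
  by rewrite mxE mul1r -[in L j i]sL mxE.
have PE : P *m E = N *m diag_mx D.
  apply/matrixP => i j; rewrite mul_mx_diag !mxE.
  case: (eqVneq j 0) => [->|j0].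
    under eq_bigr do rewrite [E _ _]mxE eqxx mulr1.
    under eq_bigr do rewrite !mxE.
    rewrite mul1r big_split /= sumrN (bigD1 i) //= eqxx mulr1n big1 => [|k].
      by rewrite addr0 -rmorph_sum /= colL !raddf0 addr0.
    by rewrite eq_sym => /negbTE ->.
  under eq_bigr do rewrite [E _ _]mxE (negbTE j0).
  rewrite (bigD1 j) //= eqxx mulr1 big1 ?addr0 => [|k /negbTE ->].
    by rewrite !mxE mulr1.
  by rewrite mulr0.
have detE : \det E = 1.
  rewrite det_trig.
    by apply: big1 => i _; rewrite mxE eqxx; case: ifP.
  apply/is_trig_mxP => i j ij; rewrite mxE.
  case: eqP => [j0|_]; first by move: ij; rewrite j0.
  by case: eqP => // ij'; move: ij; rewrite ij' ltnn.
have detD : \det (diag_mx D) = 'X.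
  rewrite det_diag (bigD1 0) //= mxE eqxx big1 ?mulr1 // => j /negbTE j0.
  by rewrite mxE j0.
have detN : \det N = 'X * p.
  have : \det (P *m E) = \det (N *m diag_mx D) by rewrite PE.
  rewrite !det_mulmx detE detD mulr1 -/(char_poly L) chi [RHS]mulrC -mulrA.
  by move/(mulfI (negbT (polyX_eq0 R))).
pose N0 : 'M[R]_n.+1 := map_mx (horner_eval 0) N.
have : \det N0 == 0.
  by rewrite det_map_mx detN rmorphM /= horner_evalE hornerX mul0r.
case/det0P => v v0 vN0.
have sv : \sum_i v 0 i = 0.
  have := congr1 (fun u : 'rV_n.+1 => u 0 0) vN0.
  rewrite mxE [RHS]mxE => h; rewrite -[RHS]h; apply: eq_bigr => j _.
  by rewrite !mxE eqxx /horner_eval hornerE mulr1.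
have vLj j : j != 0 -> (v *m L) 0 j = 0.
  move=> j0; have := congr1 (fun u : 'rV_n.+1 => - u 0 j) vN0.
  rewrite mxE [X in _ = - X]mxE oppr0 => h; rewrite -[RHS]h mxE -sumrN; apply: eq_bigr => k _.
  rewrite !mxE (negbTE j0) /horner_eval /= !hornerE hornerMn !hornerE.
  by rewrite mul0rn sub0r mulrN opprK.
have vL0 : (v *m L) 0 0 = 0.
  have : \sum_j (v *m L) 0 j = 0.
    rewrite -dot_const dot_mulmx // L1 /dot big1 // => i _.
    by rewrite mxE mulr0.
  by rewrite (bigD1 0) //= big1 ?addr0 // => j /vLj.
have vL : v *m L = 0.
  by apply/rowP => j; rewrite [RHS]mxE; case: (eqVneq j 0) => [->|/vLj].
by have := Lpos v sv v0; rewrite vL /dot big1 ?ltxx // => i _; rewrite mxE mul0r.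
Qed.

Lemma second_smallest_eig_spec (R : realType) (n : nat) (L : 'M[R]_n)
    (lam b : R) (phi f : 'rV[R]_n) :
  L^T = L -> const_mx 1 *m L = 0 :> 'rV_n ->
  (forall x : 'rV_n, \sum_i x 0 i = 0 -> x != 0 -> 0 < dot (x *m L) x) ->
  second_smallest_eig L lam -> phi != 0 -> phi *m L = lam *: phi ->
  \sum_i f 0 i = 0 -> f != 0 -> dot (f *m L) f <= b * dot f f ->
  lam <= b /\ \sum_i phi 0 i = 0.
Proof.
move=> sL L1 Lpos [s [s_sorted chi s_gt1 ->]] phi0 phiL sf f0 fb.
have inv (x : 'rV[R]_n) : x *m const_mx 1 = 0 :> 'M[R]_1 -> x *m L *m const_mx 1 = 0 :> 'M[R]_1.
  move=> _; apply/sum0_mulmx; rewrite -dot_const dot_mulmx // L1 /dot big1 // => i _.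
  by rewrite mxE mulr0.
have [] := invariant_min_eigenvector sL inv.
  by exists f => //; apply/sum0_mulmx.
move=> e [nu [eB e1 eL emin]].
have {}eB : \sum_i e 0 i = 0 by apply/sum0_mulmx.
have e0 : e != 0 by rewrite -dot_eq0 e1 oner_eq0.
have nu_gt0 : 0 < nu by have := Lpos e eB e0; rewrite eL dotZl e1 mulr1.
have nu_le : nu <= b.
  rewrite -(ler_pM2r (dot_gt0 f0)); apply: le_trans fb; apply: emin.
  exact/sum0_mulmx.
have c0 : const_mx 1 != 0 :> 'rV[R]_n.
  by apply: contra f0 => /eqP h; rewrite -(dot_eq0 f) -[f]mulmx1; 
     apply/eqP; rewrite /dot big1 // => i _;
     have := congr1 (fun v : 'rV[R]_n => v 0 i) h; rewrite !mxE => /eqP; rewrite oner_eq0.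
have root_s (a : R) (v : 'rV[R]_n) : v != 0 -> v *m L = a *: v -> a \in s.
  move=> v0 va; have : eigenvalue L a by apply/eigenvalueP; exists v.
  by rewrite eigenvalue_root_char chi root_prod_XsubC.
have ge0_s (a : R) : a \in s -> 0 <= a.
  rewrite -root_prod_XsubC -chi -eigenvalue_root_char => /eigenvalueP [v va v0].
  have [->//|a0] := eqVneq a 0.
  have vc : dot v (const_mx 1) = 0.
    by apply: (eigen_orthogonal sL va _ a0); rewrite L1 scale0r.
  rewrite -(pmulr_lge0 _ (dot_gt0 v0)) -dotZl -va ltW //; apply: Lpos => //.
  by rewrite -dot_const.
have s0 : 0 \in s by apply: (root_s _ (const_mx 1) c0); rewrite L1 scale0r.
have snu : nu \in s by apply: (root_s _ e e0).
case: s s_sorted chi s_gt1 phiL root_s ge0_s s0 snu => [|a0 [|a1 s]] //=.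
move=> /andP[a01 s_sorted] chi _ phiL root_s ge0_s s0 snu.
have le_s x : x \in a1 :: s -> a1 <= x.
  rewrite inE => /predU1P [->//|]; move: x; apply/allP.
  by apply: order_path_min => //; exact: le_trans.
have a1_nu : a1 <= nu.
  move: snu; rewrite inE => /predU1P [nu_a0|/le_s//].
  move: s0; rewrite inE => /predU1P [E|/le_s h]; last by lra.
  by move: nu_gt0; rewrite nu_a0 E ltxx.
split; first exact: le_trans a1_nu nu_le.
have [a1_0|a1_n0] := eqVneq a1 0.
  have a0_0 : a0 = 0.
    by apply/eqP; rewrite eq_le ge0_s ?inE ?eqxx // andbT -a1_0.
  have := char_poly_simple_zero sL L1 Lpos (\prod_(x <- s) ('X - x%:P)).
  by rewrite chi !big_cons a1_0 a0_0 subr0 mulrA eqxx.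
rewrite -dot_const; apply: (eigen_orthogonal sL phiL _ a1_n0).
by rewrite L1 scale0r.
Qed.

Section Perturbation.
Variables (R : realType) (m : nat) (A W : 'M[R]_m) (c t mu : R) (f : 'rV[R]_m).

Let deg (B : 'M[R]_m) i := \sum_k B i k.

Hypotheses (m_gt0 : (0 < m)%N) (c_gt0 : 0 < c) (c_le1 : c <= 1) (t_ge0 : 0 <= t)
  (t_le : t <= c ^+ 2 * m%:R / 8) (symA : A^T = A) (symW : W^T = W)
  (A01 : forall i j, 0 <= A i j <= 1)
  (f_sum : \sum_i f 0 i = 0) (f_eig : f *m lap W = mu *: f)
  (f_le1 : forall i, `|f 0 i| <= 1) (f_norm : c * m%:R <= dot f f)
  (deg_mu : forall i, c * m%:R <= deg W i - mu)
  (gap1 : forall y : 'rV_m, \sum_i y 0 i = 0 ->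
     c * m%:R * dot y y <= dot (y *m lap W) y)
  (gap2 : forall y : 'rV_m, \sum_i y 0 i = 0 -> dot y f = 0 ->
     (mu + c * m%:R) * dot y y <= dot (y *m lap W) y)
  (deg_near : forall i, `|deg A i - deg W i| <= t)
  (f_near : forall i, `|\sum_j (A i j - W i j) * f 0 j| <= t)
  (form_near : forall x : 'rV_m,
     `|\sum_i \sum_j x 0 i * (A i j - W i j) * x 0 j| <= c / 8 * m%:R * dot x x).

Let M : R := m%:R.
Let M_gt0 : 0 < M. Proof. by rewrite ltr0n. Qed.
Let t_leM : t <= c ^+ 2 * M / 8. Proof. exact: t_le. Qed.
Let t_lecM : t <= c / 8 * M.
Proof.
apply: le_trans t_leM _; rewrite mulrAC ler_wpM2r ?(ltW M_gt0) //.
by rewrite ler_wpM2r // expr2 ger_pMr.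
Qed.

Lemma lap_form_near (y : 'rV_m) :
  dot (y *m lap W) y - c / 4 * M * dot y y <= dot (y *m lap A) y.
Proof.
have E : dot (y *m lap A) y = dot (y *m lap W) y
   + \sum_i (deg A i - deg W i) * y 0 i ^+ 2
   - \sum_i \sum_j y 0 i * (A i j - W i j) * y 0 j.
  rewrite exchange_big /= /dot -big_split -sumrB; apply: eq_bigr => i _ /=.
  rewrite !mulmx_lapE -/(deg A i) -/(deg W i).
  have -> : \sum_j y 0 j * (A j i - W j i) * y 0 i =
     (\sum_j y 0 j * A j i) * y 0 i - (\sum_j y 0 j * W j i) * y 0 i.
    rewrite !mulr_suml -sumrB; apply: eq_bigr => j _; ring.
  ring.
have h1 : `|\sum_i (deg A i - deg W i) * y 0 i ^+ 2| <= t * dot y y.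
  apply: le_trans (ler_norm_sum _ _ _) _; rewrite mulr_sumr; apply: ler_sum => i _.
  rewrite normrM -expr2 [X in _ * X]ger0_norm ?sqr_ge0 //.
  by rewrite ler_wpM2r ?sqr_ge0.
have := form_near y; rewrite E; move: h1; rewrite !ler_norml => /andP[h1 _] /andP[_ h2].
have y0 := dot_ge0 y.
have : t * dot y y <= c / 8 * M * dot y y.
  by rewrite ler_wpM2r.
rewrite -/M in h2; lra.
Qed.

Let r : 'rV[R]_m := f *m lap A - mu *: f.

Lemma residual_le i : `|r 0 i| <= 2 * t.
Proof.
have -> : r 0 i = (deg A i - deg W i) * f 0 i - \sum_j (A i j - W i j) * f 0 j.
  rewrite /r -f_eig mxE [X in _ + X]mxE !mulmx_lapE -/(deg A i) -/(deg W i).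
  have -> : \sum_j (A i j - W i j) * f 0 j =
     (\sum_j f 0 j * A j i)  - (\sum_j f 0 j * W j i).
    rewrite -sumrB; apply: eq_bigr => j _.
    by rewrite -[in A i j]symA -[in W i j]symW !mxE; ring.
  ring.
apply: le_trans (ler_normB _ _) _.
have := f_near i; rewrite normrM.
have : `|deg A i - deg W i| * `|f 0 i| <= t * 1 by apply: ler_pM.
lra.
Qed.

Let sM : R := Num.sqrt M.
Let sM_gt0 : 0 < sM. Proof. by rewrite sqrtr_gt0. Qed.
Let sM2 : sM ^+ 2 = M. Proof. by rewrite sqr_sqrtr // ltW. Qed.

Lemma bounded_dot_le (x : 'rV[R]_m) (b : R) : 0 <= b ->
  (forall i, `|x 0 i| <= b) -> dot x x <= (b * sM) ^+ 2.
Proof.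
move=> b0 xb; rewrite exprMn sM2.
apply: le_trans (_ : \sum_(i < m) b ^+ 2 <= _); last first.
  by rewrite sumr_const card_ord -[_ *+ m]mulr_natr.
apply: ler_sum => i _; rewrite -expr2 -(real_normK (num_real (x 0 i))).
by rewrite ler_pXn2r ?nnegrE.
Qed.

Let f_dot_le : dot f f <= sM ^+ 2.
Proof. by rewrite -[sM]mul1r; apply: bounded_dot_le. Qed.

Let r_dot_le : dot r r <= (2 * t * sM) ^+ 2.
Proof. by apply: bounded_dot_le; [rewrite mulr_ge0|exact: residual_le]. Qed.

Let f_dot_gt0 : 0 < dot f f.
Proof. by apply: lt_le_trans f_norm; rewrite mulr_gt0. Qed.

Let fL : f *m lap A = mu *: f + r. Proof. by rewrite addrC subrK. Qed.

Let fr_le : `|dot f r| <= 2 * t * M.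
Proof.
have := @dot_abs_le _ _ f r sM (2 * t * sM) (ltW sM_gt0).
rewrite f_dot_le r_dot_le -sM2 => h.
have -> : 2 * t * sM ^+ 2 = sM * (2 * t * sM) by ring.
by apply: h => //; rewrite !mulr_ge0 ?(ltW sM_gt0).
Qed.

Theorem perturbed_fiedler (lam : R) (phi : 'rV[R]_m) :
  second_smallest_eig (lap A) lam -> phi != 0 -> phi *m lap A = lam *: phi ->
  exists2 a : R, a != 0 &
    forall i, `|phi 0 i - a * f 0 i| <= `|a| * (18 * t / (c ^+ 2 * M)).
Proof.
move=> lam2 phi0 phiL.
have symLA := lap_sym symA.
have Lpos (x : 'rV_m) : \sum_i x 0 i = 0 -> x != 0 -> 0 < dot (x *m lap A) x.
  move=> xs x0; apply: lt_le_trans (lap_form_near x).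
  have := gap1 xs; have := dot_gt0 x0; rewrite -/M => h1 h2.
  have : 0 < c * M * dot x x by rewrite !mulr_gt0.
  lra.
have f0 : f != 0 by rewrite -dot_eq0 gt_eqF.
have tc : 8 * (t / c) <= c * M.
  by rewrite mulrA ler_pdivrMr //; move: t_leM; rewrite expr2; lra.
have tc0 : 0 <= t / c by rewrite divr_ge0 // ltW.
have fQ : dot (f *m lap A) f <= (mu + 2 * (t / c)) * dot f f.
  rewrite fL dotDl dotZl mulrDl lerD2l (dotC r).
  apply: le_trans (ler_norm _) _; apply: le_trans fr_le _.
  have -> : 2 * t * M = 2 * (t / c) * (c * M) by field; rewrite gt_eqF.
  by rewrite ler_wpM2l ?f_norm // mulr_ge0.
have [lam_le phi_sum] := second_smallest_eig_spec symLA (lap_const symA) Lpos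
   lam2 phi0 phiL f_sum f0 fQ.
pose a := dot phi f / dot f f.
pose z := phi - a *: f.
have phiE : phi = a *: f + z by rewrite /z addrC subrK.
have zf : dot z f = 0.
  by rewrite /z dotDl dotNl dotZl divfK ?gt_eqF // subrr.
have z_sum : \sum_i z 0 i = 0.
  rewrite -dot_const /z dotDl dotNl dotZl !dot_const f_sum phi_sum; ring.
clearbody z.
have na0 := normr_ge0 a.
have dz0 := dot_ge0 z.
set nz := Num.sqrt (dot z z).
have nz0 : 0 <= nz by exact: sqrtr_ge0.
have nz2 : nz ^+ 2 = dot z z by rewrite sqr_sqrtr.
have zr_le : `|dot z r| <= nz * (2 * t * sM).
  by apply: dot_abs_le; rewrite ?nz2 // !mulr_ge0 ?(ltW sM_gt0).
have nz_le : c * M * nz <= `|a| * (4 * t * sM).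
  have E : lam * dot z z = a * dot r z + dot (z *m lap A) z.
    have : dot (phi *m lap A) z = lam * dot phi z by rewrite phiL dotZl.
    rewrite [in X in X = _]phiE [in X in _ = X]phiE mulmxDl -scalemxAl fL !dotDl !dotZl.
    rewrite !dotDl !dotZl (dotC f) zf; lra.
  have h1 := gap2 z_sum zf; have h2 := lap_form_near z; rewrite -/M in h1.
  have h3 : - (a * dot r z) <= `|a| * (nz * (2 * t * sM)).
    rewrite dotC; apply: le_trans (ler_norm _) _.
    by rewrite normrN normrM ler_wpM2l.
  have h4 : (2 * (t / c)) * dot z z <= c * M / 4 * dot z z by rewrite ler_wpM2r //; lra.
  have h5 : lam * dot z z <= (mu + 2 * (t / c)) * dot z z by rewrite ler_wpM2r.
  have h6 : c * M / 2 * dot z z <= `|a| * (nz * (2 * t * sM)) by lra.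
  rewrite -nz2 in h6.
  have [->|nzn] := eqVneq nz 0.
    by rewrite mulr0 !mulr_ge0 ?(ltW sM_gt0).
  have nzp : 0 < nz by rewrite lt_def nzn.
  rewrite -(ler_pM2r nzp); nra.
have a_gt0 : 0 < `|a|.
  rewrite lt_def na0 andbT normr_eq0; apply/eqP => a0.
  move: nz_le; rewrite a0 normr0 mul0r => h.
  have : nz <= 0 by rewrite -(pmulr_rle0 _ (mulr_gt0 c_gt0 M_gt0)).
  move=> hn; have nzE : nz = 0 by apply/eqP; rewrite eq_le hn nz0.
  have : dot z z == 0 by rewrite -nz2 nzE expr0n.
  rewrite dot_eq0 => /eqP z0; move: phi0.
  by rewrite phiE z0 a0 scale0r addr0 eqxx.
have a_n0 : a != 0 by rewrite -normr_gt0.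
have lam_mu : `|lam - mu| <= 3 * (t / c).
  have E : (lam - mu) * (a * dot f f) = dot phi r.
    have : dot (phi *m lap A) f = dot phi (f *m lap A) by exact: dot_mulmx.
    rewrite phiL fL dotDr dotZl dotZr.
    have -> : dot phi f = a * dot f f by rewrite /a divfK ?gt_eqF.
    lra.
  have h1 : `|dot phi r| <= `|a| * (3 * t * M).
    rewrite phiE dotDl dotZl; apply: le_trans (ler_normD _ _) _.
    rewrite normrM.
    have : `|a| * `|dot f r| <= `|a| * (2 * t * M) by rewrite ler_wpM2l.
    have : `|dot z r| <= `|a| * (t * M).
      apply: le_trans zr_le _; rewrite -(ler_pM2l (mulr_gt0 c_gt0 M_gt0)).
      apply: le_trans (_ : `|a| * (4 * t * sM) * (2 * t * sM) <= _).
        by rewrite mulrA ler_wpM2r // !mulr_ge0 ?(ltW sM_gt0).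
      have -> : `|a| * (4 * t * sM) * (2 * t * sM) = `|a| * t * M * (8 * t).
        by rewrite -sM2; ring.
      have -> : c * M * (`|a| * (t * M)) = `|a| * t * M * (c * M) by ring.
      rewrite ler_wpM2l //; first by rewrite !mulr_ge0 // ltW.
      by move: t_lecM; lra.
    lra.
  rewrite -E 2!normrM (gtr0_norm f_dot_gt0) mulrCA ler_pM2l // in h1.
  have h2 : `|lam - mu| * (c * M) <= 3 * t * M.
    by apply: le_trans h1; rewrite ler_wpM2l ?f_norm.
  rewrite -(ler_pM2r (mulr_gt0 c_gt0 M_gt0)); apply: le_trans h2 _.
  by apply: le_of_eq; field; rewrite gt_eqF.
exists a => // i.
have -> : phi 0 i - a * f 0 i = z 0 i by rewrite phiE !mxE; ring.
have Az : `|\sum_j z 0 j * A j i| <= `|a| * (4 * (t / c)).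
  pose col : 'rV[R]_m := \row_j A j i.
  have -> : \sum_j z 0 j * A j i = dot z col by apply: eq_bigr => j _; rewrite mxE.
  have h : `|dot z col| <= nz * sM.
    apply: dot_abs_le; rewrite ?nz2 ?(ltW sM_gt0) // -[sM]mul1r.
    apply: bounded_dot_le => // j; rewrite mxE.
    by have /andP[h1 h2] := A01 j i; rewrite ger0_norm.
  apply: le_trans h _; rewrite -(ler_pM2l (mulr_gt0 c_gt0 M_gt0)) (mulrA _ nz).
  apply: le_trans (_ : `|a| * (4 * t * sM) * sM <= _).
    by rewrite ler_wpM2r // ltW.
  by apply: le_of_eq; rewrite -sM2; field; rewrite gt_eqF.
have zE : (deg A i - lam) * z 0 i = \sum_j z 0 j * A j i + a * ((lam - mu) * f 0 i - r 0 i).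
  have h1 := congr1 (fun v : 'rV_m => v 0 i) phiL.
  have h2 := congr1 (fun v : 'rV_m => v 0 i) fL.
  move: h1 h2; rewrite /= phiE mulmxDl -scalemxAl.
  rewrite mxE [X in X + _ = _]mxE => h1 h2; rewrite h2 in h1; move: h1.
  rewrite mulmx_lapE !mxE -/(deg A i); lra.
have dl : c * M / 2 <= deg A i - lam.
  have := deg_mu i; have := deg_near i; move: lam_mu; rewrite -/M !ler_norml.
  move=> /andP[h1 h2] /andP[h3 h4] h5.
  have : t <= t / c by rewrite ler_peMr // invf_ge1.
  lra.
have h1 : `|a * ((lam - mu) * f 0 i - r 0 i)| <= `|a| * (5 * (t / c)).
  rewrite normrM ler_wpM2l //; apply: le_trans (ler_normB _ _) _.
  rewrite normrM; have := residual_le i.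
  have : `|lam - mu| * `|f 0 i| <= 3 * (t / c).
    rewrite -[leRHS]mulr1; apply: ler_pM => //.
  have : t <= t / c by rewrite ler_peMr // invf_ge1.
  lra.
have h2 : `|(deg A i - lam) * z 0 i| <= `|a| * (9 * (t / c)).
  rewrite zE; apply: le_trans (ler_normD _ _) _; lra.
have h3 : c * M / 2 * `|z 0 i| <= `|a| * (9 * (t / c)).
  apply: le_trans h2; rewrite normrM ler_wpM2r //.
  by apply: le_trans dl (ler_norm _).
rewrite -(ler_pM2l (_ : 0 < c * M / 2)); last by rewrite divr_gt0 // mulr_gt0.
apply: le_trans h3 _; apply: le_of_eq; field.
by rewrite !gt_eqF.
Qed.

End Perturbation.

(** * Spectrum of the noiseless Laplacian *)

Lemma chebyshev_sum (R : realType) (m : nat) (x y : 'I_m -> R) :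
  \sum_i \sum_j (x i - x j) * (y i - y j) =
  2 * (m%:R * (\sum_i x i * y i) - (\sum_i x i) * (\sum_i y i)).
Proof.
have E i : \sum_j (x i - x j) * (y i - y j) =
    m%:R * (x i * y i) - x i * (\sum_j y j) - (\sum_j x j) * y i + \sum_j x j * y j.
  rewrite (eq_bigr (fun j => x i * y i - x i * y j - x j * y i + x j * y j)); last first.
    by move=> j _; ring.
  by rewrite big_split /= !sumrB sumr_const card_ord -mulr_sumr -mulr_suml mulr_natl.
under eq_bigr do rewrite E.
rewrite big_split /= !sumrB -!mulr_sumr -!mulr_suml sumr_const card_ord.
rewrite -[in X in _ + X]mulr_natr; ring.
Qed.

Lemma chebyshev_sum_gt0 (R : realType) (n : nat) (x y : 'I_n.+1 -> R) :
  \sum_i x i = 0 -> (forall i j : 'I_n.+1, (i <= j)%N -> x i <= x j) ->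
  (forall i j : 'I_n.+1, (i < j)%N -> y i < y j) -> x ord0 < x ord_max ->
  0 < \sum_i x i * y i.
Proof.
move=> xs xmono ymono x0n.
have /(congr1 (fun z => z / (2 * n.+1%:R))) := chebyshev_sum x y.
rewrite xs mul0r subr0 mulrA mulrAC divff ?mul1r; last by rewrite gt_eqF // mulr_gt0.
move=> <-; rewrite divr_gt0 ?mulr_gt0 //.
have ge0 i j : 0 <= (x i - x j) * (y i - y j).
  case: (ltngtP i j) => [ij|ji|/ord_inj ->]; last by rewrite subrr mul0r.
    by rewrite mulr_le0 // subr_le0; [apply: xmono; apply: ltnW|apply/ltW/ymono].
  by rewrite mulr_ge0 // subr_ge0; [apply: xmono; apply: ltnW|apply/ltW/ymono].
have n_gt0 : (@ord0 n < @ord_max n)%N.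
  rewrite lt0n; apply/negP => /eqP h; move: x0n.
  by rewrite (_ : ord_max = ord0) ?ltxx //; apply: val_inj.
apply: lt_le_trans (_ : \sum_j (x ord_max - x j) * (y ord_max - y j) <= _).
  apply: lt_le_trans (_ : (x ord_max - x ord0) * (y ord_max - y ord0) <= _).
    by rewrite mulr_gt0 // subr_gt0 // ymono.
  by rewrite [leRHS](bigD1 ord0) //= lerDl sumr_ge0.
rewrite [leRHS](bigD1 ord_max) //= lerDl sumr_ge0 // => i _.
by rewrite sumr_ge0.
Qed.

Section Grid.
Variables (R : realType) (n : nat) (r : nat -> R).
Implicit Types (F : nat -> R).

Definition gridL F (i : nat) : R := \sum_(j < n.+1) r (adist i j) * (F i - F j).
Definition gridD (i : nat) : R := \sum_(j < n.+1) r (adist i j).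
Definition gridK (i l : nat) : R :=
  if (i <= l)%N then r (l - i)%N - r (n - i)%N else r (i - l)%N - r i.+1.

Lemma gridKE i l : (i < n)%N -> (l < n)%N ->
  \sum_(j < n.+1) (r (adist i.+1 j) - r (adist i j)) * ((l < j)%N%:R - (l < i)%N%:R)
  = gridK i l.
Proof.
move=> i_lt l_lt; rewrite /gridK; case: leqP => il.
  rewrite -(big_mkord xpredT (fun j => (r (adist i.+1 j) - r (adist i j)) * ((l < j)%N%:R - 0))).
  rewrite (@big_cat_nat _ _ _ l.+1) //=; last by lia.
  rewrite big_nat_cond big1 ?add0r; last first.
    by move=> j; rewrite andbT => /andP[_ h]; rewrite ltnNge -ltnS h subrr mulr0.
  rewrite big_nat_cond.
  rewrite (eq_bigr (fun j => - (r (j.+1 - i.+1)%N - r (j - i.+1)%N))); last first.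
    move=> j; rewrite andbT => /andP[lj _]; rewrite lj subr0 mulr1 /adist.
    have -> : (i.+1 - j + (j - i.+1) = j - i.+1)%N by lia.
    have -> : (i - j + (j - i) = j.+1 - i.+1)%N by lia.
    by rewrite opprB.
  rewrite -big_nat_cond sumrN telescope_sumr; last by lia.
  by rewrite opprB !subSS.
rewrite -(big_mkord xpredT (fun j => (r (adist i.+1 j) - r (adist i j)) * ((l < j)%N%:R - 1))).
rewrite (@big_cat_nat _ _ _ l.+1) //=; last by lia.
rewrite [X in _ + X]big_nat_cond [X in _ + X]big1 ?addr0; last first.
  by move=> j; rewrite andbT => /andP[h _]; rewrite h subrr mulr0.
rewrite big_nat_cond.
rewrite (eq_bigr (fun j => r (i.+1 - j.+1)%N - r (i.+1 - j)%N)); last first.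
  move=> j; rewrite andbT => /andP[_ lj]; rewrite ltnNge -ltnS lj sub0r mulrN1 /adist.
  have -> : (i.+1 - j + (j - i.+1) = i.+1 - j)%N by lia.
  have -> : (i - j + (j - i) = i.+1 - j.+1)%N by lia.
  by rewrite opprB.
by rewrite -big_nat_cond (telescope_sumr (fun j => r (i.+1 - j)%N)) // subn0 subSS.
Qed.

Lemma telescope_from0 F j : (j <= n)%N ->
  F j = F 0 + \sum_(l < n) (l < j)%N%:R * (F l.+1 - F l).
Proof.
move=> jn.
rewrite -(big_mkord xpredT (fun l => (l < j)%N%:R * (F l.+1 - F l))).
rewrite (@big_cat_nat _ _ _ j) //=.
rewrite [X in _ + (_ + X)]big_nat_cond [X in _ + (_ + X)]big1 ?addr0; last first.
  by move=> l; rewrite andbT => /andP[h _]; rewrite ltnNge h mul0r.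
rewrite big_nat_cond (eq_bigr (fun l => F l.+1 - F l)); last first.
  by move=> l; rewrite andbT => /andP[_ h]; rewrite h mul1r.
by rewrite -big_nat_cond telescope_sumr // addrC subrK.
Qed.

Lemma gridL_diff F i : (i < n)%N ->
  gridL F i.+1 - gridL F i =
  gridD i.+1 * (F i.+1 - F i) - \sum_(l < n) gridK i l * (F l.+1 - F l).
Proof.
move=> i_lt.
have Fd (j : 'I_n.+1) : F j - F i =
    \sum_(l < n) ((l < j)%N%:R - (l < i)%N%:R) * (F l.+1 - F l).
  rewrite (telescope_from0 F (_ : j <= n)%N) ?(telescope_from0 F (ltnW i_lt)); last first.
    by rewrite -ltnS.
  rewrite opprD addrACA subrr add0r -sumrB; apply: eq_bigr => l _; ring.
have E : \sum_(l < n) gridK i l * (F l.+1 - F l) =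
    \sum_(j < n.+1) (r (adist i.+1 j) - r (adist i j)) * (F j - F i).
  under [RHS]eq_bigr do rewrite Fd mulr_sumr.
  rewrite exchange_big; apply: eq_bigr => l _ /=.
  rewrite -gridKE // mulr_suml; apply: eq_bigr => j _; ring.
rewrite E /gridD /gridL mulr_suml -!sumrB; apply: eq_bigr => j _; ring.
Qed.

Hypotheses (r_dec : forall s s', (s < s')%N -> (s' <= n)%N -> r s' < r s)
  (r_gt0 : 0 < r n) (r_le1 : r 0 <= 1).

Lemma grid_mono s s' : (s <= s')%N -> (s' <= n)%N -> r s' <= r s.
Proof.
rewrite leq_eqVlt => /predU1P [->//|ss' s'n]; apply: ltW; exact: r_dec.
Qed.

Lemma gridK_gt0 i l : (i < n)%N -> (l < n)%N -> 0 < gridK i l.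
Proof.
by move=> i_lt l_lt; rewrite /gridK; case: leqP => il; rewrite subr_gt0 r_dec //; lia.
Qed.

Lemma gridK_le1 i l : (i < n)%N -> (l < n)%N -> gridK i l <= 1.
Proof.
have pos s : (s <= n)%N -> 0 < r s by move=> sn; apply: lt_le_trans r_gt0 (grid_mono sn _).
have le1 s : (s <= n)%N -> r s <= 1 by move=> sn; apply: le_trans (grid_mono _ sn) r_le1.
move=> i_lt l_lt; rewrite /gridK; case: leqP => il.
  by have := pos (n - i)%N (leq_subr _ _); have := le1 (l - i)%N; rewrite leq_subLR ltnW ?ltn_addl //; lra.
have := pos i.+1 i_lt; have := le1 (i - l)%N; rewrite leq_subLR ltnW ?ltn_addl //; lra.
Qed.

End Grid.

Lemma sum_indicator_lt (R : realType) (G : nat -> R) (k m : nat) : (k <= m)%N ->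
  \sum_(i < m) (i < k)%N%:R * G i = \sum_(i < k) G i.
Proof.
move=> km; rewrite (big_ord_widen m G km) [RHS]big_mkcond.
by apply: eq_bigr => i _; case: ifP; rewrite ?mul1r ?mul0r.
Qed.

Lemma sum_split_ord (R : realType) (G : nat -> R) (a m : nat) : (a <= m)%N ->
  \sum_(i < m) G i = \sum_(i < a) G i + \sum_(i < (m - a)%N) G (a + i)%N.
Proof.
move/subnKC => E; pose k := (m - a)%N.
by rewrite -/k -[in LHS](_ : (a + k = m)%N) ?big_split_ord.
Qed.

Lemma sum_ord_le (R : realType) (k : nat) :
  \sum_(i < k) i%:R <= k%:R ^+ 2 / 2 :> R.
Proof.
elim: k => [|k IH]; first by rewrite big_ord0 expr0n /= mul0r.
by rewrite big_ord_recr /= -natr1; nra.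
Qed.

Section GridDegree.
Variables (R : realType) (n : nat) (r : nat -> R).

Definition gridW : 'M[R]_n.+1 := \matrix_(i, j) r (adist i j).
Definition vec (F : nat -> R) : 'rV[R]_n.+1 := \row_i F i.

Lemma gridW_sym : gridW^T = gridW.
Proof. by apply/matrixP => i j; rewrite !mxE /adist addnC. Qed.

Lemma vecK (f : 'rV[R]_n.+1) : vec (fun k => f 0 (inord k)) = f.
Proof. by apply/rowP => i; rewrite mxE inord_val. Qed.

Lemma gridW_deg i : \sum_k gridW i k = gridD n r i.
Proof. by apply: eq_bigr => k _; rewrite mxE. Qed.

Lemma vec_lap F (i : 'I_n.+1) : (vec F *m lap gridW) 0 i = gridL n r F i.
Proof.
rewrite mulmx_lapE mxE mulr_sumr -sumrB; apply: eq_bigr => j _.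
by rewrite !mxE /adist (addnC (j - i)%N); ring.
Qed.

Lemma gridDE i : (i <= n)%N ->
  gridD n r i = r 0 + \sum_(s < i) r s.+1 + \sum_(s < (n - i)%N) r s.+1.
Proof.
move=> i_le; rewrite /gridD -(big_mkord xpredT (fun j => r (adist i j))).
rewrite (@big_cat_nat _ _ _ i) //=; last by lia.
rewrite big_nat_rev big_nat_cond /=.
rewrite (eq_bigr (fun j => r j.+1)); last first.
  by move=> j; rewrite andbT => ji; congr r; rewrite /adist; lia.
rewrite -big_nat_cond big_mkord.
have -> : \sum_(i <= j < n.+1) r (adist i j) = \sum_(0 <= j < (n - i).+1) r j.
  rewrite -{1}[i]add0n big_addn subSn //; apply: eq_bigr => j _.
  by congr r; rewrite /adist; lia.
rewrite big_nat_recl // big_mkord; ring.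
Qed.

Lemma gridD_rev i : (i <= n)%N -> gridD n r (n - i)%N = gridD n r i.
Proof.
by move=> i_le; rewrite !gridDE ?leq_subr // subKn // -!addrA [X in _ + X]addrC.
Qed.

Hypotheses (r_dec : forall s s', (s < s')%N -> (s' <= n)%N -> r s' < r s).

Lemma gridD_min i : (i <= n)%N -> gridD n r 0 <= gridD n r i.
Proof.
move=> i_le; rewrite !gridDE // subn0 big_ord0 addr0 -addrA lerD2l.
rewrite (sum_split_ord (fun s => r s.+1) i_le) lerD2l.
by apply: ler_sum => s _; apply: grid_mono r_dec _ _ _ _; have := ltn_ord s; lia.
Qed.

Lemma gridD_le i : (i <= n)%N -> gridD n r i <= gridD n r 0 + i%:R * (r 0 - r n).
Proof.
move=> i_le; rewrite !gridDE // subn0 big_ord0 addr0.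
rewrite (sum_split_ord (fun s => r s.+1) (leq_subr i n)) subKn //.
have h1 : \sum_(s < i) r s.+1 <= i%:R * r 0.
  rewrite mulr_natl -[X in _ *+ X]card_ord -sumr_const; apply: ler_sum => s _.
  by apply: grid_mono r_dec _ _ _ _; have := ltn_ord s; lia.
have h2 : i%:R * r n <= \sum_(s < i) r ((n - i) + s).+1.
  rewrite mulr_natl -[X in _ *+ X]card_ord -sumr_const; apply: ler_sum => s _.
  by apply: grid_mono r_dec _ _ _ _; have := ltn_ord s; lia.
rewrite mulrBr; lra.
Qed.

Lemma grid_test_vector k : (0 < k)%N -> (2 * k <= n.+1)%N ->
  3 / 4 * (r 0 - r n) <= r k - r (n - 2 * k)%N ->
  exists v : 'rV[R]_n.+1, [/\ v != 0, \sum_i v 0 i = 0 &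
    dot (v *m lap gridW) v <= (gridD n r 0 - k%:R / 4 * (r 0 - r n)) * dot v v].
Proof.
move=> k_gt0 k_le hr.
pose V i : R := (i < k)%N%:R - (n < i + k)%N%:R.
have half (G : nat -> R) : \sum_(i < n.+1) (n < i + k)%N%:R * G i
    = \sum_(i < k) G (n - i)%N.
  rewrite (reindex_inj rev_ord_inj) /=.
  rewrite -(@sum_indicator_lt R (fun i => G (n - i)%N) k n.+1); last by lia.
  apply: eq_bigr => i _; rewrite subSS; congr (_ %:R * _); congr nat_of_bool.
  by apply/idP/idP; have := ltn_ord i; lia.
have half1 : \sum_(i < n.+1) (n < i + k)%N%:R = k%:R :> R.
  under eq_bigr do rewrite -[_%:R]mulr1.
  by rewrite (half (fun=> 1)) sumr_const card_ord.
have half2 : \sum_(i < n.+1) (i < k)%N%:R = k%:R :> R.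
  under eq_bigr do rewrite -[_%:R]mulr1.
  by rewrite (sum_indicator_lt (fun=> 1)) ?sumr_const ?card_ord //; lia.
have V2 i : V i * V i = (i < k)%N%:R + (n < i + k)%N%:R.
  rewrite /V; case: (ltnP i k) => h1; case: (ltnP n (i + k)) => h2 /=; try ring.
  lia.
have dotV : dot (vec V) (vec V) = 2 * k%:R.
  rewrite /dot; under eq_bigr do rewrite !mxE V2.
  by rewrite big_split /= half1 half2; ring.
exists (vec V); split.
- by rewrite -dot_eq0 dotV mulf_neq0 // pnatr_eq0 -?lt0n // lt0n.
- under eq_bigr do rewrite mxE.
  by rewrite sumrB half1 half2 subrr.
set b := r k - r (n - 2 * k)%N.
have key (i : 'I_n.+1) : (vec V *m lap gridW) 0 i * vec V 0 i <=
   (i < k)%N%:R * (gridD n r 0 + i%:R * (r 0 - r n) - k%:R * b) +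
   (n < i + k)%N%:R * (gridD n r 0 + (n - i)%N%:R * (r 0 - r n) - k%:R * b).
  rewrite vec_lap mxE.
  have i_le : (i <= n)%N by rewrite -ltnS.
  have LE : gridL n r V i * V i = V i * V i * gridD n r i - V i * \sum_(j < n.+1) r (adist i j) * V j.
    rewrite /gridL /gridD mulr_suml [V i * V i * _]mulr_sumr [X in _ - X]mulr_sumr -sumrB.
    by apply: eq_bigr => j _; ring.
  rewrite LE V2.
  case: (ltnP i k) => h1; case: (ltnP n (i + k)) => h2; try lia.
  - have : k%:R * b <= \sum_(j < n.+1) r (adist i j) * V j.
      rewrite mulrBr -{1}half2 -{1}half1 !mulr_suml -sumrB; apply: ler_sum => j _.
      have jn := ltn_ord j.
      rewrite /V; case: (ltnP j k) => h3; case: (ltnP n (j + k)) => h4; try lia.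
      + rewrite mul1r mul0r !subr0 mulr1; apply: grid_mono r_dec _ _ _ _; rewrite /adist; lia.
      + rewrite mul1r mul0r !sub0r mulrN1 lerN2; apply: grid_mono r_dec _ _ _ _; rewrite /adist; lia.
      + by rewrite !mul0r subrr mulr0.
    have := gridD_le i_le; rewrite /V h1 ltnNge h2 /=; lra.
  - have : \sum_(j < n.+1) r (adist i j) * V j <= - (k%:R * b).
      rewrite mulrBr opprB -{1}half2 -{1}half1 !mulr_suml -sumrB; apply: ler_sum => j _.
      have jn := ltn_ord j.
      rewrite /V; case: (ltnP j k) => h3; case: (ltnP n (j + k)) => h4; try lia.
      + rewrite mul1r mul0r !subr0 mulr1; apply: grid_mono r_dec _ _ _ _; rewrite /adist; lia.
      + rewrite mul1r mul0r !sub0r mulrN1 lerN2; apply: grid_mono r_dec _ _ _ _; rewrite /adist; lia.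
      + by rewrite !mul0r subrr mulr0.
    have := gridD_le (leq_subr i n); rewrite gridD_rev // /V h2 ltnNge h1 /=; lra.
  - by rewrite /V [(i < k)%N]ltnNge h1 [(n < _)%N]ltnNge h2 /= subrr !mul0r addr0 mul0r subrr.
rewrite /dot; apply: le_trans (ler_sum _ (fun i _ => key i)) _.
rewrite big_split /= (half (fun i => gridD n r 0 + (n - i)%N%:R * (r 0 - r n) - k%:R * b)).
rewrite (sum_indicator_lt (fun i => gridD n r 0 + i%:R * (r 0 - r n) - k%:R * b)); last by lia.
have -> : \sum_(i < k) (gridD n r 0 + (n - (n - i))%N%:R * (r 0 - r n) - k%:R * b) =
   \sum_(i < k) (gridD n r 0 + i%:R * (r 0 - r n) - k%:R * b).
  by apply: eq_bigr => i _; rewrite subKn //; have := ltn_ord i; lia.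
rewrite -/(dot (vec V) (vec V)) dotV !sumrB big_split /= -mulr_suml !sumr_const card_ord.
rewrite -(mulr_natr (gridD n r 0) k) -(mulr_natr (k%:R * b) k).
have r0n : 0 <= r 0 - r n by rewrite subr_ge0; apply: grid_mono r_dec _ _ _ _.
have := ler_wpM2r r0n (sum_ord_le R k); rewrite -/b in hr.
have := ler_wpM2l (sqr_ge0 (k%:R : R)) hr.
clear; move: (\sum_(i < k) i%:R) (k%:R : R) (gridD n r 0) (r 0 - r n) b => S a d e b.
lra.
Qed.

End GridDegree.

Section Vec.
Variables (R : realType) (n : nat).

Lemma vec_sum (F : nat -> R) : \sum_i vec n F 0 i = \sum_(i < n.+1) F i.
Proof. by apply: eq_bigr => i _; rewrite mxE. Qed.

Lemma dot_vec (F G : nat -> R) : dot (vec n F) (vec n G) = \sum_(i < n.+1) F i * G i.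
Proof. by apply: eq_bigr => i _; rewrite !mxE. Qed.

Lemma step_mono (F : nat -> R) : (forall l, (l < n)%N -> 0 <= F l.+1 - F l) ->
  forall i j, (i <= j)%N -> (j <= n)%N -> F i <= F j.
Proof.
move=> g0 i j /subnKC <-; elim: (j - i)%N => [|k IH] kn; first by rewrite addn0.
rewrite addnS in kn *; apply: le_trans (IH (ltnW kn)) _.
by rewrite -subr_ge0 g0.
Qed.

Lemma step_mono_lt (F : nat -> R) : (forall l, (l < n)%N -> 0 < F l.+1 - F l) ->
  forall i j, (i < j)%N -> (j <= n)%N -> F i < F j.
Proof.
move=> g0 i j ij jn; apply: lt_le_trans (_ : F i.+1 <= _).
  by rewrite -subr_gt0 g0 //; lia.
by apply: step_mono => // l /g0/ltW.
Qed.

Lemma weighted_abs_lt (m : nat) (k g : 'I_m -> R) : (forall l, 0 < k l) ->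
  (exists a, 0 < g a) -> (exists b, g b < 0) ->
  `|\sum_l k l * g l| < \sum_l k l * `|g l|.
Proof.
move=> k0 [a ga] [b gb]; rewrite ltr_norml -subr_gt0 opprK -big_split /= -[in X in _ && X]subr_gt0 -sumrB.
apply/andP; split.
  rewrite (bigD1 a) //= ltr_pwDl ?sumr_ge0 // => [|i _].
    by rewrite -mulrDr mulr_gt0 // (gtr0_norm ga) addr_gt0.
  by rewrite -mulrDr mulr_ge0 // ?(ltW (k0 _)) //; have := ler_norm (- g i); rewrite normrN; lra.
rewrite (bigD1 b) //= ltr_pwDl ?sumr_ge0 // => [|i _].
  by rewrite -mulrBr mulr_gt0 // (ltr0_norm gb); lra.
by rewrite -mulrBr mulr_ge0 ?subr_ge0 ?ler_norm // ltW.
Qed.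

End Vec.

Section GridSpectrum.
Variables (R : realType) (n : nat) (r : nat -> R).
Hypotheses (r_dec : forall s s', (s < s')%N -> (s' <= n)%N -> r s' < r s)
  (r_gt0 : 0 < r n) (r_le1 : r 0 <= 1).

Let W := gridW n r.
Let K := gridK n r.
Let D := gridD n r.

Lemma gridL_eigen_diff (mu : R) (F : nat -> R) i :
  vec n F *m lap W = mu *: vec n F -> (i < n)%N ->
  (D i.+1 - mu) * (F i.+1 - F i) = \sum_(l < n) K i l * (F l.+1 - F l).
Proof.
move=> eF i_lt; have := gridL_diff r F i_lt.
have LE j : (j <= n)%N -> gridL n r F j = mu * F j.
  rewrite -ltnS => jn; have := congr1 (fun v : 'rV_n.+1 => v 0 (Ordinal jn)) eF.
  by rewrite vec_lap !mxE.
rewrite !LE //; last exact: ltnW.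
rewrite -/D -/K; lra.
Qed.

Lemma minimal_eigenvector_monotone (mu : R) (F : nat -> R) :
  (forall i, (i <= n)%N -> mu < D i) ->
  (forall y : 'rV_n.+1, \sum_i y 0 i = 0 -> mu * dot y y <= dot (y *m lap W) y) ->
  \sum_(i < n.+1) F i = 0 -> vec n F != 0 -> vec n F *m lap W = mu *: vec n F ->
  (forall l, (l < n)%N -> 0 < F l.+1 - F l) \/
  (forall l, (l < n)%N -> F l.+1 - F l < 0).
Proof.
move=> mu_lt mu_min sF F0 eF.
pose g (l : nat) := F l.+1 - F l.
have eg i : (i < n)%N -> (D i.+1 - mu) * g i = \sum_(l < n) K i l * g l.
  exact: gridL_eigen_diff.
have Dpos i : (i < n)%N -> 0 < D i.+1 - mu by move=> i_lt; rewrite subr_gt0 mu_lt.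
have Kpos i l : (i < n)%N -> (l < n)%N -> 0 < K i l by exact: gridK_gt0.
have g_n0 : exists a : 'I_n, g a != 0.
  apply/existsP; apply: contraNT F0; rewrite negb_exists => /forallP h.
  have Fc i : (i <= n)%N -> F i = F 0.
    elim: i => // i IH i_lt; have := h (Ordinal i_lt).
    by rewrite negbK /g /= subr_eq0 => /eqP ->; apply: IH; apply: ltnW.
  have F00 : F 0 = 0.
    move: sF; rewrite (eq_bigr (fun=> F 0)) => [|i _]; last by rewrite Fc // -ltnS.
    by rewrite sumr_const card_ord => /eqP; rewrite mulrn_eq0 /= => /eqP.
  by apply/eqP/rowP => i; rewrite !mxE Fc // -ltnS.
have [/existsP pos|/existsPn npos] := boolP [exists a : 'I_n, 0 < g a];
  have [/existsP neg|/existsPn nneg] := boolP [exists b : 'I_n, g b < 0].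
- exfalso; pose h l := `|g l|.
  pose G (j : nat) : R := \sum_(l < j) h l.
  pose mean := (\sum_(i < n.+1) G i) / n.+1%:R.
  pose H j := G j - mean.
  have HS l : H l.+1 - H l = h l.
    by rewrite /H /G big_ord_recr /=; ring.
  have sH : \sum_(i < n.+1) H i = 0.
    by rewrite sumrB sumr_const card_ord -mulr_natr divfK ?subrr ?pnatr_eq0.
  pose u j := mu * H j - gridL n r H j.
  have u_inc l : (l < n)%N -> 0 < u l.+1 - u l.
    move=> l_lt; have := gridL_diff r H l_lt.
    rewrite (eq_bigr (fun j : 'I_n => K l j * h j)) => [|j _]; last by rewrite HS.
    rewrite HS => e1.
    have := weighted_abs_lt (fun j : 'I_n => Kpos l j l_lt (ltn_ord j)) pos neg.
    rewrite -eg // normrM (gtr0_norm (Dpos _ l_lt)) -/(h l) -/D in e1 *.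
    have -> : u l.+1 - u l = mu * (H l.+1 - H l) - (gridL n r H l.+1 - gridL n r H l).
      by rewrite /u; ring.
    rewrite e1 HS; lra.
  have : 0 < \sum_(i < n.+1) H i * u i.
    apply: chebyshev_sum_gt0 => //.
    - move=> i j ij; apply: step_mono ij _; last by rewrite -ltnS.
      by move=> l _; rewrite HS normr_ge0.
    - by move=> i j ij; apply: step_mono_lt ij _; last by rewrite -ltnS.
    case: pos => a ga; rewrite /=; apply: lt_le_trans (_ : H a.+1 <= _).
      have h1 : H 0 <= H a.
        apply: (@step_mono _ n) => // [l _|]; first by rewrite HS normr_ge0.
        exact: ltnW.
      apply: le_lt_trans h1 _; rewrite -subr_gt0 HS normr_gt0 gt_eqF //.
    by apply: (@step_mono _ n) => // l _; rewrite HS normr_ge0.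
  have := mu_min (vec n H); rewrite vec_sum sH => /(_ erefl).
  rewrite dot_vec /dot mulr_sumr -subr_ge0 -sumrB => h1 h2.
  have : 0 <= - \sum_(i < n.+1) H i * u i.
    apply: le_trans h1 _; rewrite -sumrN; apply: ler_sum => i _.
    by rewrite vec_lap mxE /u; apply: le_of_eq; ring.
  lra.
- left => l l_lt; have ge0 (a : 'I_n) : 0 <= g a by rewrite leNgt nneg.
  have : 0 < (D l.+1 - mu) * g l.
    rewrite eg //; case: pos => a ga; rewrite (bigD1 a) //=.
    rewrite ltr_pwDl ?mulr_gt0 ?Kpos // sumr_ge0 // => i _.
    by rewrite mulr_ge0 // ltW // Kpos.
  by rewrite pmulr_rgt0 // Dpos.
- right => l l_lt; have le0 (a : 'I_n) : g a <= 0 by rewrite leNgt npos.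
  have : (D l.+1 - mu) * g l < 0.
    rewrite eg // -oppr_gt0 -sumrN; case: neg => a ga; rewrite (bigD1 a) //=.
    rewrite ltr_pwDl ?oppr_gt0 ?pmulr_rlt0 ?Kpos // sumr_ge0 // => i _.
    by rewrite oppr_ge0 pmulr_rle0 ?Kpos.
  by rewrite pmulr_rlt0 // Dpos.
- case: g_n0 => a /eqP ga; exfalso; apply: ga; apply/eqP.
  by rewrite eq_le !leNgt npos nneg.
Qed.

End GridSpectrum.

Lemma lap_form_double (R : realType) (m : nat) (W : 'M[R]_m) (y : 'rV[R]_m) :
  W^T = W ->
  2 * dot (y *m lap W) y = \sum_i \sum_j W i j * (y 0 i - y 0 j) ^+ 2.
Proof.
move=> sW.
have E : dot (y *m lap W) y =
    \sum_i \sum_j W i j * y 0 i ^+ 2 - \sum_i \sum_j W i j * (y 0 i * y 0 j).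
  rewrite -sumrB; apply: eq_bigr => i _; rewrite mulmx_lapE mulrBl; congr (_ - _).
    by rewrite -mulr_suml; ring.
  by rewrite mulr_suml; apply: eq_bigr => j _; rewrite -[in W j i]sW mxE; ring.
have E2 : \sum_i \sum_j W i j * y 0 j ^+ 2 = \sum_i \sum_j W i j * y 0 i ^+ 2.
  rewrite exchange_big; apply: eq_bigr => i _; apply: eq_bigr => j _.
  by rewrite -[in W j i]sW mxE.
transitivity (\sum_i \sum_j W i j * y 0 i ^+ 2 + \sum_i \sum_j W i j * y 0 j ^+ 2
   - 2 * \sum_i \sum_j W i j * (y 0 i * y 0 j)).
  by rewrite E E2; ring.
rewrite mulr_sumr -big_split -sumrB; apply: eq_bigr => i _ /=.
rewrite mulr_sumr -big_split -sumrB; apply: eq_bigr => j _ /=; ring.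
Qed.

Lemma lap_form_ge (R : realType) (m : nat) (W : 'M[R]_m) (w0 : R) (y : 'rV[R]_m) :
  W^T = W -> (forall i j, w0 <= W i j) -> \sum_i y 0 i = 0 ->
  w0 * m%:R * dot y y <= dot (y *m lap W) y.
Proof.
move=> sW W_ge ys; rewrite -(ler_pM2l (_ : 0 < 2)) // lap_form_double //.
have := chebyshev_sum (fun i => y 0 i) (fun i => y 0 i).
rewrite ys mul0r subr0 => E.
have -> : 2 * (w0 * m%:R * dot y y) = w0 * (2 * (m%:R * dot y y)) by ring.
rewrite -E mulr_sumr; apply: ler_sum => i _; rewrite mulr_sumr; apply: ler_sum => j _.
by rewrite -expr2 ler_wpM2r ?sqr_ge0.
Qed.

Lemma fin_max_exists (R : realType) (T : finType) (i0 : T) (h : T -> R) :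
  exists i, forall j, h j <= h i.
Proof.
exists [arg max_(i > i0) h i]%O.
by case: arg_maxP => // i _ hi j; apply: hi.
Qed.

Section GridGap.
Variables (R : realType) (n : nat) (r : nat -> R).
Hypotheses (r_dec : forall s s', (s < s')%N -> (s' <= n)%N -> r s' < r s)
  (r_gt0 : 0 < r n) (r_le1 : r 0 <= 1).

Let W := gridW n r.
Let K := gridK n r.
Let D := gridD n r.
Variables (e kappa mu : R) (mid : pred nat) (F : nat -> R).
Let g l := F l.+1 - F l.

Hypotheses (e_gt0 : 0 < e) (kappa_gt0 : 0 < kappa)
  (eF : vec n F *m lap W = mu *: vec n F)
  (mu_min : forall y : 'rV_n.+1, \sum_i y 0 i = 0 -> mu * dot y y <= dot (y *m lap W) y)
  (g_gt0 : forall l, (l < n)%N -> 0 < g l)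
  (g_le : forall l, (l < n)%N -> g l <= e^-1)
  (K_mid : forall i l, (i < n)%N -> (l < n)%N -> mid l -> kappa <= K i l)
  (g_mid : 2^-1 <= \sum_(l < n | mid l) g l).

(* The ratio [h] of the increments of a competing eigenvector to those of [F]
   changes sign.  Reading the eigenvector equation where [h] is maximal and where it
   is minimal bounds the oscillation of [h] from both sides. *)
Lemma grid_gap (y : 'rV[R]_n.+1) : \sum_i y 0 i = 0 -> dot y (vec n F) = 0 ->
  (mu + kappa * e / 2) * dot y y <= dot (y *m lap W) y.
Proof.
move=> ys yF.
have [->|y0] := eqVneq y 0.
  by rewrite mul0mx {1 2}/dot !big1 ?mulr0 // => i _; rewrite mxE mul0r.
pose B : 'M[R]_(n.+1, 2) := \matrix_(i, j) (if j == 0 then 1 else F i).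
have BP (x : 'rV[R]_n.+1) : x *m B = 0 <-> \sum_i x 0 i = 0 /\ dot x (vec n F) = 0.
  have e0 : (x *m B) 0 0 = \sum_i x 0 i.
    by rewrite mxE; apply: eq_bigr => i _; rewrite mxE mulr1.
  have e1 : (x *m B) 0 1 = dot x (vec n F).
    by rewrite mxE; apply: eq_bigr => i _; rewrite !mxE.
  split=> [h|[h1 h2]]; first by rewrite -e0 -e1 h !mxE.
  apply/rowP => j; rewrite [RHS]mxE; case: j => [[|[|//]] jlt].
    by rewrite (_ : Ordinal jlt = 0) ?e0 //; apply: val_inj.
  by rewrite (_ : Ordinal jlt = 1) ?e1 //; apply: val_inj.
have sL : (lap W)^T = lap W by apply/lap_sym/gridW_sym.
have L1 : const_mx 1 *m lap W = 0 :> 'rV_n.+1 by apply/lap_const/gridW_sym.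
have [||f' [mu' [/BP [f's f'F] f'1 f'L f'min]]] := invariant_min_eigenvector sL (B := B).
- move=> x /BP [xs xF]; apply/BP; split.
    by rewrite -dot_const dot_mulmx // L1 /dot big1 // => i _; rewrite mxE mulr0.
  by rewrite dot_mulmx // eF dotZr xF mulr0.
- by exists y => //; apply/BP.
suff gap : mu + kappa * e / 2 <= mu'.
  apply: le_trans (f'min y _); last exact/BP.
  by rewrite ler_wpM2r ?dot_ge0.
have theta_ge0 : mu <= mu'.
  by have := mu_min f's; rewrite f'L dotZl f'1 !mulr1.
pose F' (k : nat) : R := f' 0 (inord k).
have F'E : vec n F' = f' by exact: vecK.
have f'0 : f' != 0 by rewrite -dot_eq0 f'1 oner_eq0.
rewrite -F'E in f's f'F f'1 f'L f'0.
rewrite vec_sum in f's; rewrite dot_vec in f'F.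
have n_gt0 : (0 < n)%N.
  rewrite lt0n; apply/negP => /eqP n0; move: g_mid; rewrite big1 ?lt_geF ?invr_gt0 //.
  by case=> i ilt; move: ilt; rewrite n0.
have Finc := @step_mono_lt R n F g_gt0.
(* a monotone competitor would be positively correlated with [F] *)
have sign (G : nat -> R) : \sum_(i < n.+1) G i = 0 -> vec n G != 0 ->
    \sum_(i < n.+1) G i * F i = 0 -> exists l : 'I_n, 0 < G l.+1 - G l.
  move=> sG G0 GF; apply/existsP; apply: contraNT G0; rewrite negb_exists => /forallP h.
  have Gdec := @step_mono R n (fun i => - G i).
  have {}Gdec i j : (i <= j)%N -> (j <= n)%N -> - G i <= - G j.
    apply: Gdec => l l_lt; have := h (Ordinal l_lt); rewrite /= -leNgt; lra.
  have [lt0n'|ge0n] := ltP (- G 0) (- G n).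
    have : 0 < \sum_(i < n.+1) - G i * F i.
      apply: (@chebyshev_sum_gt0 R n (fun i => - G i) F) => //.
      - by rewrite sumrN sG oppr0.
      - by move=> i j ij; apply: Gdec; rewrite -1?ltnS.
      - by move=> i j ij; apply: Finc; rewrite -1?ltnS.
    under eq_bigr do rewrite mulNr.
    by rewrite sumrN GF oppr0 ltxx.
  have Gc i : (i <= n)%N -> G i = G 0.
    move=> i_le; have := Gdec 0%N i (leq0n _) i_le; have := Gdec i n i_le (leqnn _); lra.
  have G00 : G 0 = 0.
    move: sG; rewrite (eq_bigr (fun=> G 0)) => [|i _]; last by rewrite Gc // -ltnS.
    by rewrite sumr_const card_ord => /eqP; rewrite mulrn_eq0 /= => /eqP.
  by apply/eqP/rowP => i; rewrite !mxE Gc // -ltnS.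
pose h l := (F' l.+1 - F' l) / g l.
have hg l : (l < n)%N -> h l * g l = F' l.+1 - F' l.
  by move=> l_lt; rewrite /h divfK // gt_eqF // g_gt0.
have [lp lp_gt0] : exists l : 'I_n, 0 < h l.
  have [l hl] := sign F' f's f'0 f'F; exists l.
  by rewrite divr_gt0 // g_gt0.
have [ln ln_lt0] : exists l : 'I_n, h l < 0.
  have [|||l hl] := sign (fun i => - F' i).
  - by rewrite sumrN f's oppr0.
  - apply: contra f'0 => /eqP E; apply/eqP/rowP => i.
    have := congr1 (fun v : 'rV[R]_n.+1 => - v 0 i) E; rewrite !mxE opprK.
    by rewrite oppr0.
  - by under eq_bigr do rewrite mulNr; rewrite sumrN f'F oppr0.
  exists l; rewrite /h ltr_pdivrMr ?g_gt0 // mul0r; lra.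
have [ip hip] := fin_max_exists lp (fun i : 'I_n => h i).
have [im him] := fin_max_exists ln (fun i : 'I_n => - h i).
have hle l : (l < n)%N -> h l <= h ip by move=> l_lt; exact: (hip (Ordinal l_lt)).
have hge l : (l < n)%N -> h im <= h l.
  by move=> l_lt; rewrite -lerN2; exact: (him (Ordinal l_lt)).
have hp_gt0 : 0 < h ip by apply: lt_le_trans lp_gt0 (hip lp).
have hm_lt0 : h im < 0.
  by rewrite -oppr_gt0; apply: lt_le_trans (him ln); rewrite oppr_gt0.
have eqF i : (i < n)%N -> (D i.+1 - mu) * g i = \sum_(l < n) K i l * g l.
  exact: gridL_eigen_diff.
have eqF' i : (i < n)%N -> (D i.+1 - mu') * (h i * g i) = \sum_(l < n) K i l * (h l * g l).
  move=> i_lt; rewrite hg // (gridL_eigen_diff f'L) //.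
  by apply: eq_bigr => l _; rewrite hg.
have key i : (i < n)%N ->
    (mu' - mu) * g i * h i = \sum_(l < n) K i l * g l * (h i - h l).
  move=> i_lt; have := eqF i i_lt; have := eqF' i i_lt => e1 e2.
  under eq_bigr do rewrite mulrBr.
  rewrite sumrB -mulr_suml -e2.
  have -> : \sum_(l < n) K i l * g l * h l = (D i.+1 - mu') * (h i * g i).
    by rewrite e1; apply: eq_bigr => l _; ring.
  ring.
have restrict (i : nat) (d : nat -> R) : (i < n)%N ->
    (forall l, (l < n)%N -> 0 <= d l) ->
    kappa * \sum_(l < n | mid l) g l * d l <= \sum_(l < n) K i l * g l * d l.
  move=> i_lt d0; rewrite [leRHS](bigID (fun l : 'I_n => mid l)) /= mulr_sumr.
  rewrite -[leLHS]addr0 lerD //.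
    apply: ler_sum => l ml; rewrite -mulrA ler_wpM2r ?mulr_ge0 ?d0 ?K_mid //.
    by rewrite ltW // g_gt0.
  apply: sumr_ge0 => l _; rewrite !mulr_ge0 ?d0 // ltW ?g_gt0 //.
  exact: (gridK_gt0 r_dec).
have e1 : kappa * \sum_(l < n | mid l) g l * (h ip - h l) <= (mu' - mu) * g ip * h ip.
  by rewrite key //; apply: (restrict ip (fun l => h ip - h l)) => // l /hle; rewrite subr_ge0.
have e2 : kappa * \sum_(l < n | mid l) g l * (h l - h im) <= - ((mu' - mu) * g im * h im).
  rewrite key // -sumrN.
  apply: le_trans (_ : \sum_(l < n) K im l * g l * (h l - h im) <= _).
    by apply: (restrict im (fun l => h l - h im)) => // l /hge; rewrite subr_ge0.
  by apply: ler_sum => l _; apply: le_of_eq; ring.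
have e3 : kappa * ((h ip - h im) * \sum_(l < n | mid l) g l) <=
   (mu' - mu) * g ip * h ip - (mu' - mu) * g im * h im.
  have -> : (h ip - h im) * \sum_(l < n | mid l) g l =
      \sum_(l < n | mid l) g l * (h ip - h l) + \sum_(l < n | mid l) g l * (h l - h im).
    by rewrite mulr_sumr -big_split; apply: eq_bigr => l _ /=; ring.
  rewrite mulrDr; lra.
have th0 : 0 <= mu' - mu by rewrite subr_ge0.
have e4 : (mu' - mu) * g ip * h ip <= (mu' - mu) * e^-1 * h ip.
  by rewrite ler_wpM2r ?(ltW hp_gt0) // ler_wpM2l // g_le.
have e5 : - ((mu' - mu) * g im * h im) <= - ((mu' - mu) * e^-1 * h im).
  by rewrite lerN2 ler_wnM2r ?(ltW hm_lt0) // ler_wpM2l // g_le.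
have osc : 0 < h ip - h im by lra.
have e6 : kappa * ((h ip - h im) * 2^-1) <= kappa * ((h ip - h im) * \sum_(l < n | mid l) g l).
  by rewrite ler_wpM2l ?(ltW kappa_gt0) // ler_wpM2l ?(ltW osc).
have : (h ip - h im) * (kappa / 2) <= (h ip - h im) * ((mu' - mu) * e^-1) by lra.
rewrite ler_pM2l // ler_pdivlMr //; lra.
Qed.

End GridGap.

Lemma sum_lt_indicator (R : realType) (a n : nat) :
  \sum_(l < n) (l < a)%N%:R = (minn n a)%:R :> R.
Proof.
elim: n => [|n IH]; first by rewrite big_ord0 min0n.
by rewrite big_ord_recr /= IH -natrD; congr _%:R; case: ltnP; lia.
Qed.

Lemma sum_tail_indicator (R : realType) (a n : nat) :
  \sum_(l < n) (n <= l + a)%N%:R = (minn n a)%:R :> R.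
Proof.
rewrite -sum_lt_indicator (reindex_inj rev_ord_inj) /=; apply: eq_bigr => l _.
by have h := ltn_ord l; congr (nat_of_bool _)%:R; apply/idP/idP; lia.
Qed.

Lemma vecZ (R : realType) (n : nat) (s : R) (F : nat -> R) :
  vec n (fun k => s * F k) = s *: vec n F.
Proof. by apply/rowP => i; rewrite !mxE. Qed.

Section GridFiedler.
Variables (R : realType) (n : nat) (r : nat -> R).
Hypotheses (r_dec : forall s s', (s < s')%N -> (s' <= n)%N -> r s' < r s)
  (r_gt0 : 0 < r n) (r_le1 : r 0 <= 1).
Variables (k a : nat) (e kappa : R).
Hypotheses (k_gt0 : (0 < k)%N) (k_le : (2 * k <= n.+1)%N)
  (rk : 3 / 4 * (r 0 - r n) <= r k - r (n - 2 * k)%N)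
  (e_le : e <= k%:R / 4 * (r 0 - r n)) (e_gt0 : 0 < e) (kappa_gt0 : 0 < kappa)
  (drop : forall s s', (s + a < s')%N -> (s' <= n)%N -> kappa <= r s - r s')
  (a_le : 4 * a%:R <= e).

Lemma grid_fiedler : exists (mu : R) (F : nat -> R),
  [/\ \sum_(i < n.+1) F i = 0,
      vec n F *m lap (gridW n r) = mu *: vec n F,
      (forall i, (i <= n)%N -> mu + e <= gridD n r i),
      (forall l, (l < n)%N -> kappa / (2 * n.+1%:R) <= F l.+1 - F l) &
      F n - F 0%N = 1 /\
      forall y : 'rV_n.+1, \sum_i y 0 i = 0 -> dot y (vec n F) = 0 ->
        (mu + kappa * e / 2) * dot y y <= dot (y *m lap (gridW n r)) y].
Proof.
have sL : (lap (gridW n r))^T = lap (gridW n r) by apply/lap_sym/gridW_sym.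
have L1 : const_mx 1 *m lap (gridW n r) = 0 :> 'rV_n.+1 by apply/lap_const/gridW_sym.
have [v [v0 sv vQ]] := grid_test_vector r_dec k_gt0 k_le rk.
have inv (x : 'rV[R]_n.+1) : x *m const_mx 1 = 0 :> 'M[R]_1 ->
    x *m lap (gridW n r) *m const_mx 1 = 0 :> 'M[R]_1.
  move=> _; apply/sum0_mulmx; rewrite -dot_const dot_mulmx // L1 /dot big1 // => i _.
  by rewrite mxE mulr0.
have [|f [mu [/sum0_mulmx sf f1 fL fmin']]] := invariant_min_eigenvector sL inv.
  by exists v => //; apply/sum0_mulmx.
have mu_min (y : 'rV[R]_n.+1) : \sum_i y 0 i = 0 ->
    mu * dot y y <= dot (y *m lap (gridW n r)) y.
  by move=> sy; apply: fmin'; apply/sum0_mulmx.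
have mu_D i : (i <= n)%N -> mu + e <= gridD n r i.
  move=> i_le; apply: le_trans (gridD_min r_dec i_le).
  have := le_trans (mu_min v sv) vQ; rewrite ler_pM2r ?dot_gt0 //; have := e_le; lra.
have mu_ge0 : 0 <= mu.
  have := @lap_form_ge R n.+1 (gridW n r) 0 f (gridW_sym n r).
  rewrite fL dotZl f1 !mul0r mulr1; apply => // i j; rewrite mxE ltW //.
  apply: lt_le_trans r_gt0 _; apply: (grid_mono r_dec) => //.
  by rewrite /adist; move: (ltn_ord i) (ltn_ord j); clear; lia.
have f0 : f != 0 by rewrite -dot_eq0 f1 oner_eq0.
have [F [sF FL F0 Finc]] : exists F : nat -> R, [/\ \sum_(i < n.+1) F i = 0,
    vec n F *m lap (gridW n r) = mu *: vec n F, vec n F != 0 &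
    forall l, (l < n)%N -> 0 < F l.+1 - F l].
  pose F (l : nat) : R := f 0 (inord l).
  have FE : vec n F = f by exact: vecK.
  have sF : \sum_(i < n.+1) F i = 0 by rewrite -vec_sum FE.
  have [| | |h|h] := @minimal_eigenvector_monotone R n r r_dec r_gt0 r_le1 mu F _ mu_min sF.
  - by move=> i /mu_D; have := e_gt0; lra.
  - by rewrite FE.
  - by rewrite FE.
  - by exists F; rewrite FE.
  exists (fun l => -1 * F l); split.
  - by rewrite -mulr_sumr sF mulr0.
  - by rewrite vecZ FE -scalemxAl fL !scalerA mulrC.
  - by rewrite vecZ FE scaler_eq0 oppr_eq0 oner_eq0.
  - by move=> l /h; lra.
have n_gt0 : (0 < n)%N by move: k_gt0 k_le; clear; lia.
have S_gt0 : 0 < F n - F 0 by rewrite subr_gt0; apply: step_mono_lt Finc _ _ _ _.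
pose s := (F n - F 0)^-1.
have s_gt0 : 0 < s by rewrite invr_gt0.
pose G l := s * F l.
have GL : vec n G *m lap (gridW n r) = mu *: vec n G.
  by rewrite vecZ -scalemxAl FL !scalerA mulrC.
have g_gt0 l : (l < n)%N -> 0 < G l.+1 - G l by move=> /Finc h; rewrite -mulrBr mulr_gt0.
have G1 : G n - G 0 = 1 by rewrite -mulrBr mulVf // gt_eqF.
have sG : \sum_(i < n.+1) G i = 0 by rewrite -mulr_sumr sF mulr0.
have sg : \sum_(l < n) (G l.+1 - G l) = 1.
  by rewrite -(big_mkord xpredT (fun l => G l.+1 - G l)) telescope_sumr.
have eqG i := gridL_eigen_diff (i := i) GL.
have Dpos i : (i < n)%N -> e <= gridD n r i.+1 - mu by move=> /mu_D; lra.
have g_le l : (l < n)%N -> G l.+1 - G l <= e^-1.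
  move=> l_lt; rewrite -[e^-1]mul1r ler_pdivlMr //.
  apply: le_trans (_ : (gridD n r l.+1 - mu) * (G l.+1 - G l) <= _).
    by rewrite mulrC ler_wpM2r ?Dpos // ltW ?g_gt0.
  rewrite eqG // -sg; apply: ler_sum => j _.
  rewrite -[leRHS]mul1r ler_wpM2r ?(gridK_le1 r_dec r_gt0 r_le1) //.
  by rewrite ltW ?g_gt0.
pose mid (l : nat) := (a <= l)%N && (l + a < n)%N.
have K_mid i l : (i < n)%N -> (l < n)%N -> mid l -> kappa <= gridK n r i l.
  by move=> i_lt l_lt /andP[al la]; rewrite /gridK; case: leqP => il; apply: drop; move: i_lt l_lt al la il; clear; lia.
have g_mid : 2^-1 <= \sum_(l < n | mid l) (G l.+1 - G l).
  have : \sum_(l < n | ~~ mid l) (G l.+1 - G l) <= 2 * a%:R / e.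
    apply: le_trans (_ : \sum_(l < n) ((l < a)%N%:R + (n <= l + a)%N%:R) * e^-1 <= _).
      rewrite [leRHS](bigID (fun l : 'I_n => ~~ mid l)) /= -[leLHS]addr0 lerD //; last first.
        by apply: sumr_ge0 => l _; rewrite mulr_ge0 ?invr_ge0 ?addr_ge0 ?(ltW e_gt0).
      apply: ler_sum => l; rewrite /mid negb_and -ltnNge -leqNgt => ml.
      apply: le_trans (g_le l (ltn_ord l)) _.
      rewrite -[leLHS]mul1r ler_wpM2r ?invr_ge0 ?(ltW e_gt0) //.
      by case/orP: ml => ->; rewrite ?lerDl ?lerDr.
    rewrite -mulr_suml big_split /= sum_lt_indicator sum_tail_indicator.
    rewrite ler_wpM2r ?invr_ge0 ?(ltW e_gt0) //.
    by rewrite -natrD -natrM ler_nat; clear; lia.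
  have : 2 * a%:R / e <= 2^-1 by rewrite ler_pdivrMr //; have := a_le; lra.
  move: sg; rewrite (bigID (fun l : 'I_n => mid l)) /=; lra.
exists mu, G; split => //; last first.
  split=> // y sy yG.
  exact: (grid_gap r_dec r_gt0 r_le1 e_gt0 kappa_gt0 GL mu_min g_gt0 g_le K_mid g_mid).
move=> l l_lt; rewrite ler_pdivrMr; last by rewrite mulr_gt0 // ltr0n.
  have h1 : kappa / 2 <= (gridD n r l.+1 - mu) * (G l.+1 - G l).
    rewrite eqG // (bigID (fun l : 'I_n => mid l)) /= -[leLHS]addr0 lerD //.
      apply: le_trans (_ : kappa * \sum_(l < n | mid l) (G l.+1 - G l) <= _).
        by rewrite ler_wpM2l ?(ltW kappa_gt0).
      rewrite mulr_sumr; apply: ler_sum => j mj.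
      by rewrite ler_wpM2r ?K_mid // ltW ?g_gt0.
    apply: sumr_ge0 => j _; rewrite mulr_ge0 // ltW ?g_gt0 //.
    exact: (gridK_gt0 r_dec).
  have h2 : gridD n r l.+1 - mu <= n.+1%:R.
    have : gridD n r l.+1 <= n.+1%:R.
      rewrite /gridD -[n.+1 in leRHS]card_ord -sumr_const; apply: ler_sum => j _.
      apply: le_trans r_le1; apply: (grid_mono r_dec) => //.
      by rewrite /adist; move: (ltn_ord j) l_lt; clear; lia.
    lra.
  have := ler_wpM2r (ltW (g_gt0 _ l_lt)) h2; lra.
Qed.

End GridFiedler.

Record profile (R : realType) (rho : R -> R) (Lam : R) : Prop := Profile {
  profile_pos : forall x, 0 <= x <= 1 -> 0 < rho x <= 1;
  profile_lip : forall x y, 0 <= x <= 1 -> 0 <= y <= 1 ->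
    `|rho x - rho y| <= Lam * `|x - y|;
  profile_mono : forall x y, 0 <= x -> x <= y -> y <= 1 -> rho y <= rho x;
  profile_slope : forall d, 0 < d -> exists2 c, 0 < c &
    forall x y, d <= x -> x <= y -> y <= 1 - d -> c * (y - x) <= rho x - rho y }.

Section C1Profile.
Variables (R : realType) (rho : R -> R).
Hypotheses (rho_pos : forall x, 0 <= x <= 1 -> 0 < rho x <= 1)
  (rho_C1 : C1_on01 rho) (rho_dec : forall x : R, 0 < x < 1 -> derive1 rho x < 0).

Lemma C1_mean_value (x y : R) : 0 <= x -> x < y -> y <= 1 ->
  exists2 z, x < z < y & rho y - rho x = derive1 rho z * (y - x).
Proof.
case: rho_C1 => rc rd _ x0 xy y1.
have [||z] := @MVT R rho (derive1 rho) x y xy.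
- move=> z; rewrite in_itv /= => /andP[xz zy].
  have zd : derivable rho z 1 by apply: rd; lra.
  by rewrite derive1E; exact: derivableP.
- apply: continuous_subspaceW rc => z /=; rewrite in_itv /=; lra.
by rewrite in_itv /= => h e; exists z.
Qed.

Lemma C1_profile : exists2 Lam, 0 < Lam & profile rho Lam.
Proof.
have [rc rd [g [gc gE]]] := rho_C1.
have gc' (a b : R) : 0 <= a -> b <= 1 -> ({within `[a, b], continuous g})%classic.
  by move=> a0 b1; apply: continuous_subspaceW gc => z /=; rewrite in_itv /=; lra.
have [cM _ hM] := EVT_max ler01 (gc' _ _ (lexx _) (lexx _)).
have [cm _ hm] := EVT_min ler01 (gc' _ _ (lexx _) (lexx _)).
exists (`|g cM| + `|g cm| + 1); first by have := normr_ge0 (g cM); have := normr_ge0 (g cm); lra.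
split => //.
- have lip x y : 0 <= x -> x < y -> y <= 1 ->
     `|rho x - rho y| <= (`|g cM| + `|g cm| + 1) * `|x - y|.
    move=> x0 xy y1; have [z /andP[xz zy]] := C1_mean_value x0 xy y1.
    rewrite distrC (distrC x) => ->; rewrite normrM ler_wpM2r //.
    rewrite gE; last by lra.
    have z01 : z \in `[0, 1] by rewrite in_itv /=; lra.
    have := hM z z01; have := hm z z01.
    have := ler_norm (g cM); have := ler_norm (- g cm); rewrite normrN.
    have := normr_ge0 (g cM); have := normr_ge0 (g cm).
    rewrite ler_norml; lra.
  move=> x y /andP[x0 x1] /andP[y0 y1]; have [xy|yx|->] := ltgtP x y.
  + exact: lip.
  + by rewrite distrC (distrC x); apply: lip.
  + by rewrite !subrr normr0 mulr0.
- move=> x y x0; rewrite le_eqVlt => /predU1P [->//|xy] y1.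
  have [z /andP[xz zy] E] := C1_mean_value x0 xy y1.
  rewrite -subr_le0 E mulr_le0_ge0 ?subr_ge0 ?(ltW xy) // ltW // rho_dec //; lra.
move=> d d0; have [d1|d1] := leP d (1 - d); last first.
  by exists 1 => // x y; lra.
have d1' : 1 - d <= 1 by lra.
have [c cI hc] := EVT_max d1 (gc' _ _ (ltW d0) d1').
rewrite in_itv /= in cI.
have gneg : g c < 0 by rewrite -gE ?rho_dec //; lra.
exists (- g c); first by rewrite oppr_gt0.
move=> x y dx; rewrite le_eqVlt => /predU1P [->|xy] yd.
  by rewrite !subrr mulr0.
have [|||z /andP[xz zy] E] := @C1_mean_value x y; try lra.
have -> : rho x - rho y = - derive1 rho z * (y - x) by rewrite mulNr -E opprB.
rewrite ler_wpM2r ?subr_ge0 ?(ltW xy) // lerN2 gE; last by lra.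
by apply: hc; rewrite in_itv /=; lra.
Qed.

End C1Profile.

Section Profile.
Variables (R : realType) (rho : R -> R) (Lam : R).
Hypothesis rhoP : profile rho Lam.

Lemma profile_drop (d : R) : 0 < d -> exists2 c, 0 < c &
  forall x y, 0 <= x -> x + d <= y -> y <= 1 -> c <= rho x - rho y.
Proof.
move=> d0; pose d' := Num.min d 1 / 4.
have d'd : d' <= d / 4 by rewrite ler_pM2r ?invr_gt0 // ge_min lexx.
have d'0 : 0 < d' by rewrite divr_gt0 // lt_min d0 ltr01.
have [c c0 hc] := profile_slope rhoP d'0.
exists (c * d') => [|x y x0 xy y1]; first by rewrite mulr_gt0.
have h1 := profile_mono rhoP (_ : 0 <= x) (_ : x <= x + d') (_ : x + d' <= 1).
have h2 := profile_mono rhoP (_ : 0 <= y - d') (_ : y - d' <= y) y1.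
have h3 := hc (x + d') (y - d').
have {}h1 : rho (x + d') <= rho x by apply: h1; lra.
have {}h2 : rho y <= rho (y - d') by apply: h2; lra.
have {}h3 : c * (y - d' - (x + d')) <= rho (x + d') - rho (y - d') by apply: h3; lra.
have : c * d' <= c * (y - d' - (x + d')) by rewrite ler_wpM2l ?(ltW c0) //; lra.
lra.
Qed.

End Profile.

Record fiedler_data (R : realType) (m : nat) (c : R) (W : 'M[R]_m) (mu : R)
    (f : 'rV[R]_m) : Prop := FiedlerData {
  fiedler_sum : \sum_i f 0 i = 0;
  fiedler_eig : f *m lap W = mu *: f;
  fiedler_le1 : forall i, `|f 0 i| <= 1;
  fiedler_norm : c * m%:R <= dot f f;
  fiedler_deg : forall i, c * m%:R <= \sum_k W i k - mu;
  fiedler_gap1 : forall y : 'rV_m, \sum_i y 0 i = 0 ->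
     c * m%:R * dot y y <= dot (y *m lap W) y;
  fiedler_gap2 : forall y : 'rV_m, \sum_i y 0 i = 0 -> dot y f = 0 ->
     (mu + c * m%:R) * dot y y <= dot (y *m lap W) y;
  fiedler_inc : forall i j : 'I_m, (i <= j)%N ->
     c * (j%:R - i%:R) / m%:R <= f 0 j - f 0 i }.

Definition profile_grid (R : realType) (rho : R -> R) (m : nat) : 'M[R]_m :=
  \matrix_(i, j) rho (`|i%:R - j%:R| / m%:R).

Lemma adistE (R : realType) (i j : nat) : (adist i j)%:R = `|i%:R - j%:R| :> R.
Proof.
rewrite /adist; case: (leqP i j) => ij.
  by rewrite (eqP ij) add0n natrB // distrC ger0_norm // subr_ge0 ler_nat.
have ji := ltnW ij.
by rewrite (eqP ji) addn0 natrB // ger0_norm // subr_ge0 ler_nat.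
Qed.

Lemma step_slope (R : realType) (n : nat) (F : nat -> R) (s : R) :
  (forall l, (l < n)%N -> s <= F l.+1 - F l) ->
  forall i j, (i <= j)%N -> (j <= n)%N -> s * (j%:R - i%:R) <= F j - F i.
Proof.
move=> hs i j /subnKC <-; elim: (j - i)%N => [|k IH] kn.
  by rewrite addn0 !subrr mulr0.
rewrite addnS in kn *; have := IH (ltnW kn); have := hs _ kn.
rewrite -natr1; lra.
Qed.

Lemma grid_norm_ge (R : realType) (n : nat) (F : nat -> R) (s : R) : (2 <= n)%N ->
  0 <= s -> (forall l, (l < n)%N -> s / n.+1%:R <= F l.+1 - F l) ->
  s ^+ 2 / 54 * n.+1%:R <= \sum_(i < n.+1) F i * F i.
Proof.
move=> n2 s0 hs.
pose h := (n.+1 %/ 2)%N.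
have hn : (h <= n.+1)%N by rewrite /h; lia.
have hn' : (h <= n.+1 - h)%N by rewrite /h; lia.
have hm : n.+1%:R / 3 <= h%:R :> R.
  have : (n.+1 <= 3 * h)%N by rewrite /h; lia.
  by rewrite -(ler_nat R) natrM; lra.
rewrite (sum_split_ord (fun i => F i * F i) hn).
rewrite (sum_split_ord (fun i => F (h + i)%N * F (h + i)%N) hn').
apply: le_trans (_ : \sum_(i < h) (F i * F i + F (h + i)%N * F (h + i)%N) <= _); last first.
  rewrite big_split /= addrA lerDl; apply: sumr_ge0 => i _.
  by rewrite -expr2 sqr_ge0.
apply: le_trans (_ : \sum_(i < h) s ^+ 2 / 18 <= _); last first.
  apply: ler_sum => i _.
  have := @step_slope R n F _ hs i (h + i)%N.
  rewrite leq_addl; have -> : (h + i <= n)%N by rewrite /h; have := ltn_ord i; rewrite /h; clear; lia.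
  move=> /(_ isT isT); rewrite natrD addrK => h1.
  have h2 : s / 3 <= s / n.+1%:R * h%:R.
    by rewrite mulrAC -mulrA ler_wpM2l // ler_pdivlMr //; lra.
  have h3 : 0 <= s / 3 by rewrite divr_ge0.
  have h4 : s / 3 <= F (h + i)%N - F i by apply: le_trans h1.
  have : (s / 3) ^+ 2 <= (F (h + i)%N - F i) ^+ 2 by rewrite ler_pXn2r // nnegrE ?(le_trans h3 h4).
  have := sqr_ge0 (F (h + i)%N + F i).
  clear; move: (F (h + i)%N) (F i) => x y; rewrite !expr2; lra.
rewrite sumr_const card_ord -mulr_natr.
have : s ^+ 2 / 18 * (n.+1%:R / 3) <= s ^+ 2 / 18 * h%:R.
  by rewrite ler_wpM2l // divr_ge0 ?sqr_ge0.
clear; lra.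
Qed.

Lemma centered_unit_range (R : realType) (n : nat) (F : nat -> R) :
  (forall l, (l < n)%N -> 0 <= F l.+1 - F l) -> \sum_(i < n.+1) F i = 0 ->
  F n - F 0%N = 1 -> forall i, (i <= n)%N -> `|F i| <= 1.
Proof.
move=> inc sF F1 i i_le.
have mono := step_mono inc.
have n0 : 0 < n.+1%:R :> R by rewrite ltr0n.
have h0 : F 0%N <= 0.
  rewrite -(pmulr_rle0 _ n0) -sF mulr_natl -[in X in _ *+ X](card_ord n.+1) -sumr_const.
  by apply: ler_sum => j _; apply: mono; rewrite -1?ltnS.
have hn : 0 <= F n.
  rewrite -(pmulr_rge0 _ n0) -sF mulr_natl -[in X in _ *+ X](card_ord n.+1) -sumr_const.
  by apply: ler_sum => j _; apply: mono; rewrite -1?ltnS.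
have := mono _ _ (leq0n i) i_le; have := mono _ _ i_le (leqnn n).
rewrite ler_norml; lra.
Qed.

Theorem grid_fiedler_data (R : realType) (rho : R -> R) (Lam : R) :
  0 < Lam -> profile rho Lam ->
  exists2 c, 0 < c <= 1 & exists m0 : nat, forall m, (m0 <= m)%N ->
    exists mu f, fiedler_data c (profile_grid rho m) mu f.
Proof.
move=> Lam0 rhoP.
have half0 : 0 < 2^-1 :> R by rewrite invr_gt0.
have [b b0 hb] := profile_drop rhoP half0.
have p0 := profile_pos rhoP (_ : 0 <= 0 <= 1).
have p1 := profile_pos rhoP (_ : 0 <= 1 <= 1).
have {p0} /andP[p0 p0'] : 0 < rho 0 <= 1 by apply: p0; rewrite lexx ler01.
have {p1} /andP[p1 p1'] : 0 < rho 1 <= 1 by apply: p1; rewrite lexx ler01.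
have b1 : b <= 1.
  by have := hb 0 1 (lexx _); rewrite add0r invf_le1 ?ler1n // => /(_ isT (lexx _)); lra.
pose d0 := b / (16 * (Lam + 1)).
have L16 : 0 < 16 * (Lam + 1) by lra.
have d0_gt0 : 0 < d0 by rewrite divr_gt0.
have d0E : d0 * (16 * (Lam + 1)) = b by rewrite divfK // gt_eqF.
have d0_le : d0 <= 16^-1.
  rewrite /d0 ler_pdivrMr // mulrA mulVf ?mul1r; lra.
have near x y : 0 <= x -> x <= d0 -> 1 - 3 * d0 <= y -> y <= 1 ->
    3 / 4 * (rho 0 - rho 1) <= rho x - rho y.
  move=> x0 xd yd y1.
  have h0 : rho 0 - rho 1 >= b by apply: hb; lra.
  have hx : rho 0 - Lam * d0 <= rho x.
    have := profile_lip rhoP (_ : 0 <= 0 <= 1) (_ : 0 <= x <= 1).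
    rewrite sub0r normrN (ger0_norm x0) lexx ler01 => /(_ isT); rewrite x0 /=.
    have -> : x <= 1 by lra.
    move=> /(_ isT) /ler_normlW h; have : Lam * x <= Lam * d0 by rewrite ler_wpM2l // ltW.
    lra.
  have hy : rho y <= rho 1 + Lam * (3 * d0).
    have := profile_lip rhoP (_ : 0 <= y <= 1) (_ : 0 <= 1 <= 1).
    rewrite lexx ler01 y1 andbT; have -> : 0 <= y by lra.
    move=> /(_ isT isT) /ler_normlW h.
    have : Lam * `|y - 1| <= Lam * (3 * d0).
      by rewrite ler_wpM2l ?(ltW Lam0) // ler_norml; lra.
    lra.
  lra.
pose d1 := d0 * b / 32.
have d1_gt0 : 0 < d1 by rewrite divr_gt0 // mulr_gt0.
have [kap kap0 hkap] := profile_drop rhoP d1_gt0.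
have d1_le1 : d1 <= 1.
  have : d0 * b <= 1 * 1 by apply: ler_pM; lra.
  rewrite /d1; lra.
have kap1 : kap <= 1.
  have := hkap 0 1 (lexx _); rewrite add0r d1_le1 => /(_ isT (lexx _)); lra.
have [w w0 w216] : exists2 w : R, 0 < w & 216 * w = 1.
  by exists 216^-1; [rewrite invr_gt0 ltr0n|rewrite divff // pnatr_eq0].
pose c := kap ^+ 2 * (d0 * b) * rho 1 * w.
have X0 : 0 < d0 * b by rewrite mulr_gt0.
have X1 : d0 * b <= 1 by rewrite -[leRHS]mulr1; apply: ler_pM; lra.
have kap2 : kap ^+ 2 <= kap by rewrite expr2 ger_pMr.
have kap20 : 0 < kap ^+ 2 by rewrite exprn_gt0.
have c_kX : c <= kap ^+ 2 * (d0 * b) * w.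
  by rewrite /c ler_pM2r // ger_pMr // mulr_gt0.
have c_k : c <= kap ^+ 2 * w.
  by apply: le_trans c_kX _; rewrite ler_pM2r // ger_pMr.
have c_X : c <= kap * (d0 * b) * w.
  by apply: le_trans c_kX _; rewrite ler_pM2r // ler_pM2r.
have c_X' : c <= (d0 * b) * w.
  by apply: le_trans c_X _; rewrite ler_pM2r // ger_pMl.
have w1 : w <= 1 by move: w0 w216; clear; lra.
have c_r : c <= rho 1.
  rewrite /c mulrAC ger_pMl //; apply: le_trans (_ : kap ^+ 2 * w <= _).
    by rewrite ler_pM2r // ger_pMr.
  apply: le_trans (_ : 1 * 1 <= _); last by rewrite mulr1.
  by apply: ler_pM; rewrite ?(ltW kap20) ?(ltW w0) // (le_trans kap2).
have c0 : 0 < c by rewrite /c; do 2 (apply: mulr_gt0 => //); exact: mulr_gt0.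
exists c; first by apply/andP; split => //; apply: le_trans p1'.
exists (Num.bound (2 / d0)).+3 => -[//|n] hm.
have M0 : 0 < n.+1%:R :> R by rewrite ltr0n.
have hM : 2 <= d0 * n.+1%:R.
  rewrite mulrC -ler_pdivrMr //; have := archi_boundP (_ : 0 <= 2 / d0).
  rewrite divr_ge0 ?(ltW d0_gt0) // => /(_ isT) /ltW h; apply: le_trans h _.
  by rewrite ler_nat; move: hm; clear; lia.
have n2 : (2 <= n)%N by move: hm; clear; lia.
pose r (s : nat) := rho (s%:R / n.+1%:R).
have pos_le1 (s : nat) : (s <= n)%N -> s%:R / n.+1%:R <= 1 :> R.
  by move=> sn; rewrite ler_pdivrMr // mul1r ler_nat ltnW.
have pos_ge0 (s : nat) : 0 <= s%:R / n.+1%:R :> R by rewrite divr_ge0 // ltW.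
have r_dec s s' : (s < s')%N -> (s' <= n)%N -> r s' < r s.
  move=> ss' s'n.
  have [|kk kk0 hkk] := profile_drop rhoP (d := n.+1%:R^-1); first by rewrite invr_gt0.
  have := hkk (s%:R / n.+1%:R) (s'%:R / n.+1%:R) (pos_ge0 _) _ (pos_le1 _ s'n).
  rewrite -[X in _ + X]mul1r -mulrDl ler_pM2r ?invr_gt0 // natr1 ler_nat ss'.
  move=> /(_ isT); rewrite -/(r s) -/(r s'); lra.
have r_gt0 : 0 < r n.
  suff /andP[] : 0 < r n <= 1 by [].
  by apply: (profile_pos rhoP); rewrite pos_ge0 pos_le1.
have r_le1 : r 0 <= 1 by rewrite /r mul0r.
have r0 : r 0 = rho 0 by rewrite /r mul0r.
have rn1 : rho 1 <= r n by apply: (profile_mono rhoP); rewrite ?pos_ge0 ?pos_le1.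
have rn2 : b <= r 0 - r n.
  rewrite r0; apply: hb; rewrite ?lexx ?pos_le1 // add0r ler_pdivlMr //.
  have : (1 <= n)%N by move: n2; clear; lia.
  rewrite -(ler_nat R) -natr1; lra.
have dM0 : 0 <= d0 * n.+1%:R by rewrite mulr_ge0 // ltW.
pose k := Num.truncn (d0 * n.+1%:R).
have /andP[k_le k_gt] := truncn_itv dM0; rewrite -/k -[k.+1%:R]natr1 in k_le k_gt.
have k_gt0 : (0 < k)%N by rewrite -(ltr_nat R); lra.
have d0M : d0 * n.+1%:R <= 16^-1 * n.+1%:R by rewrite ler_pM2r.
have k_le' : (2 * k <= n.+1)%N by rewrite -(ler_nat R) natrM; lra.
have rk : 3 / 4 * (r 0 - r n) <= r k - r (n - 2 * k)%N.
  apply: le_trans (_ : 3 / 4 * (rho 0 - rho 1) <= _); first by rewrite r0; lra.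
  apply: near; rewrite ?pos_ge0 ?ler_pdivrMr ?ler_pdivlMr ?mul1r //.
  - have k_len : (2 * k <= n)%N.
      rewrite -(ler_nat R) natrM; move: (M0) hM d0M k_le; rewrite -natr1; lra.
    rewrite natrB // natrM; move: k_le hM; rewrite -[n.+1%:R]natr1; lra.
  - by rewrite ler_nat; move: n2; clear; lia.
pose e := d0 * b * n.+1%:R / 8.
have e_gt0 : 0 < e by rewrite divr_gt0 // mulr_gt0.
have e_le : e <= k%:R / 4 * (r 0 - r n).
  have : d0 * n.+1%:R / 2 <= k%:R by lra.
  move=> h; apply: le_trans (_ : (d0 * n.+1%:R / 2) / 4 * b <= _).
    by rewrite /e; apply: le_of_eq; field.
  by apply: ler_pM; rewrite ?(ltW b0) //; lra.
pose a := Num.truncn (e / 4).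
have e40 : 0 <= e / 4 by rewrite divr_ge0 // ltW.
have /andP[a_le a_gt] := truncn_itv e40; rewrite -/a in a_le a_gt.
have {}a_le : 4 * a%:R <= e by lra.
have drop s s' : (s + a < s')%N -> (s' <= n)%N -> kap <= r s - r s'.
  move=> ss' s'n; apply: hkap; rewrite ?pos_ge0 ?pos_le1 //.
  rewrite -lerBrDl -mulrBl ler_pdivlMr // -natrB; last by move: ss'; clear; lia.
  apply: le_trans (_ : a.+1%:R <= _); last by rewrite ler_nat; move: ss'; clear; lia.
  by apply: le_trans (ltW a_gt); rewrite /d1 /e; apply: le_of_eq; field.
have [mu [F [sF FL FD Fs [F1 Fgap]]]] := grid_fiedler r_dec r_gt0 r_le1 k_gt0 k_le' rk
  e_le e_gt0 kap0 drop a_le.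
have WE : profile_grid rho n.+1 = gridW n r.
  by apply/matrixP => i j; rewrite !mxE /r adistE.
have Fs' l : (l < n)%N -> kap / 2 / n.+1%:R <= F l.+1 - F l.
  by move=> /Fs; apply: le_trans; apply: le_of_eq; field; rewrite gt_eqF.
have inc l : (l < n)%N -> 0 <= F l.+1 - F l.
  by move=> /Fs; apply: le_trans; rewrite divr_ge0 ?mulr_ge0 ?(ltW M0) ?(ltW kap0).
exists mu, (vec n F); rewrite WE; split.
- by rewrite vec_sum.
- exact: FL.
- by move=> i; rewrite mxE (centered_unit_range inc) // -ltnS.
- rewrite dot_vec; apply: le_trans (grid_norm_ge n2 _ Fs'); last by rewrite divr_ge0 // ltW.
  rewrite ler_pM2r //; apply: le_trans c_k _; have -> : (kap / 2) ^+ 2 / 54 = kap ^+ 2 * (216 * w) / 216 by rewrite w216; field.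
  by move: (kap ^+ 2) => K; apply: le_of_eq; field.
- move=> i; rewrite gridW_deg lerBrDl; apply: le_trans (FD i _); last by rewrite -ltnS.
  rewrite lerD2l (_ : e = d0 * b / 8 * n.+1%:R); last by rewrite /e; field.
  rewrite ler_pM2r //; apply: le_trans c_X' _; move: (d0 * b) X0 w216 w0; clear => X; nra.
- move=> y sy; apply: le_trans (lap_form_ge (w0 := rho 1) (gridW_sym n r) _ sy).
    by rewrite ler_wpM2r ?dot_ge0 // ler_pM2r.
  move=> i j; rewrite mxE; apply: le_trans rn1 _; apply: (grid_mono r_dec) => //.
  by rewrite /adist; move: (ltn_ord i) (ltn_ord j); clear; lia.
- move=> y sy yF; apply: le_trans (Fgap y sy yF); rewrite ler_wpM2r ?dot_ge0 // lerD2l.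
  have -> : kap * e / 2 = kap * (d0 * b) / 16 * n.+1%:R by rewrite /e; field.
  rewrite ler_pM2r //; apply: le_trans c_X _.
  have : 0 < kap * (d0 * b) by rewrite mulr_gt0.
  by move: (kap * (d0 * b)) w216 w0; clear => X; nra.
- move=> i j ij; rewrite !mxE.
  have := @step_slope R n F _ Fs' i j ij; rewrite -ltnS ltn_ord => /(_ isT).
  apply: le_trans; rewrite mulrAC -mulrA -[X in _ <= X]mulrA [_^-1 * _]mulrC mulrA.
  rewrite [X in _ <= X]mulrA; apply: ler_wpM2r; first by rewrite invr_ge0 ltW.
  rewrite ler_wpM2r // ?subr_ge0 ?ler_nat //.
  apply: le_trans c_k _; move: (kap ^+ 2) kap2 kap20 kap0 kap1 w0 w216; clear => K; nra.
Qed.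

(** * Orderings and spectral seriation *)

Definition rk (N : nat) (T : {set 'I_N}) (u : 'I_N) : nat :=
  #|[set v in T | (v < u)%N]|.

Section Orderings.
Variable N : nat.
Implicit Types (S T : {set 'I_N}) (s p : 'I_N -> nat) (u v : 'I_N).

Lemma card_inj_nat_le S s x : {in S &, injective s} ->
  {in S, forall v, (s v < x)%N} -> (#|S| <= x)%N.
Proof.
move=> s_inj s_lt; rewrite cardE -(size_map s) -[leqRHS](size_iota 0).
apply: uniq_leq_size.
  rewrite map_inj_in_uniq ?enum_uniq // => u v.
  by rewrite !mem_enum; apply: s_inj.
by move=> y /mapP[v]; rewrite mem_enum => /s_lt vx ->; rewrite mem_iota.
Qed.

Lemma card_below S s x : is_ordering S s -> (x <= #|S|)%N ->
  #|[set v in S | (s v < x)%N]| = x.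
Proof.
move=> [s_inj s_lt] x_le; apply/eqP; rewrite eqn_leq; apply/andP; split.
  apply: (@card_inj_nat_le _ s) => [u v|v]; rewrite !inE => /andP[uS _] //.
  by move=> /andP[vS _]; apply: s_inj.
have : (#|[set v in S | (x <= s v)%N]| <= #|S| - x)%N.
  apply: (@card_inj_nat_le _ (fun v => s v - x)%N) => [u v|v]; rewrite !inE => /andP[uS ux].
    by move=> /andP[vS vx] /eqP; rewrite eqn_sub2rE // => /eqP; apply: s_inj.
  by have := s_lt _ uS; move: ux x_le; clear; lia.
have -> : #|[set v in S | (x <= s v)%N]| = (#|S| - #|[set v in S | (s v < x)%N]|)%N.
  rewrite -[in RHS](cardsID [set v | (s v < x)%N] S) [X in (_ - X)%N](_ : _ = #|S :&: [set v | (s v < x)%N]|).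
    rewrite addKn; congr #|pred_of_set _|; apply/setP => v.
    by rewrite !inE -leqNgt andbC.
  by congr #|pred_of_set _|; apply/setP => v; rewrite !inE.
have h1 : (#|[set v in S | (s v < x)%N]| <= #|S|)%N.
  by apply: subset_leq_card; apply/fintype.subsetP => v; rewrite inE => /andP[].
move=> h2; move: h1 h2 x_le; clear; lia.
Qed.

Lemma ordering_close S s p (D : nat) : is_ordering S s -> is_ordering S p ->
  {in S &, forall u v, (p u + D < p v)%N -> (s u < s v)%N} ->
  {in S, forall u, (p u <= s u + D)%N && (s u <= p u + D)%N}.
Proof.
move=> sO pO h u uS; have [_ s_lt] := sO; have [_ p_lt] := pO.
have su := s_lt _ uS; have pu := p_lt _ uS.
apply/andP; split.
  rewrite addnC -leq_subLR -[leqRHS](card_below sO (ltnW su)).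
  rewrite -[leqLHS](card_below pO (_ : p u - D <= #|S|)%N); last by move: pu; clear; lia.
  apply: subset_leq_card; apply/fintype.subsetP => v; rewrite !inE => /andP[vS vp]; rewrite vS /=.
  by apply: h => //; move: vp; clear; lia.
have [big|small] := leqP #|S| (p u + D); first by move: su big; clear; lia.
rewrite -ltnS -[leqLHS](card_below sO su) -[leqRHS](card_below pO small).
apply: subset_leq_card; apply/fintype.subsetP => v; rewrite !inE !ltnS => /andP[vS vs]; rewrite vS /=.
by rewrite leqNgt; apply/negP => /(h _ _ uS vS); rewrite ltnNge vs.
Qed.

Lemma revo_ordering S s : is_ordering S s -> is_ordering S (revo S s).
Proof.
move=> [s_inj s_lt]; split=> [u v uS vS|u uS]; rewrite /revo.
  move=> E; apply: s_inj => //.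
  by have := s_lt _ uS; have := s_lt _ vS; move: E; clear; lia.
by have := s_lt _ uS; clear; lia.
Qed.

Lemma revoK S s u : is_ordering S s -> u \in S -> revo S (revo S s) u = s u.
Proof. by move=> [_ s_lt] /s_lt; rewrite /revo; clear; lia. Qed.

Lemma rk_lt T u v : u \in T -> (u < v)%N -> (rk T u < rk T v)%N.
Proof.
move=> uT uv; apply: proper_card; apply/properP; split.
  by apply/fintype.subsetP => x; rewrite !inE => /andP[-> /ltn_trans]; apply.
by exists u; rewrite !inE ?uT ?uv ?ltnn ?andbF.
Qed.

Lemma rk_le T u v : (u <= v)%N -> (rk T u <= rk T v)%N.
Proof.
move=> uv; apply: subset_leq_card; apply/fintype.subsetP => x; rewrite !inE => /andP[-> xu] /=.
exact: leq_trans uv.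
Qed.

Lemma rk_ordering T : is_ordering T (rk T).
Proof.
split=> [u v uT vT E|u uT].
  case: (ltngtP u v) => [/(rk_lt uT)|/(rk_lt vT)|/ord_inj //]; by rewrite E ltnn.
apply: proper_card; apply/properP; split.
  by apply/fintype.subsetP => x; rewrite inE => /andP[].
by exists u; rewrite ?inE ?ltnn ?andbF.
Qed.

Lemma lt_of_rk_lt T u v : (rk T u < rk T v)%N -> (u < v)%N.
Proof. by apply: contraTltn => /(rk_le T); rewrite leqNgt. Qed.

Lemma enum_val_mono T (i j : 'I_#|T|) : (i < j)%N -> (enum_val i < enum_val j)%N.
Proof.
move=> ij; have x0 : 'I_N by exact: (enum_val i).
rewrite !(enum_val_nth x0).
have srt : sorted (fun u v : 'I_N => (u < v)%N) (enum T).
  rewrite /enum_mem -enumT; apply: sorted_filter.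
    by move=> y x z; apply: ltn_trans.
  by rewrite -(sorted_map (f := val) (e' := ltn)) val_enum_ord iota_ltn_sorted.
apply: (sorted_ltn_nth _ x0 srt) => //; rewrite ?inE -?cardE //.
by move=> y x z; apply: ltn_trans.
Qed.

Lemma rk_enum_val T (k : 'I_#|T|) : rk T (enum_val k) = k.
Proof.
have mono (i j : 'I_#|T|) : (enum_val i < enum_val j)%N = (i < j)%N.
  apply/idP/idP; last exact: enum_val_mono.
  apply: contraTT; rewrite -!leqNgt leq_eqVlt => /predU1P [/ord_inj -> //|].
  by move/enum_val_mono/ltnW.
have -> : rk T (enum_val k) = #|[set j : 'I_#|T| | (j < k)%N]|.
  rewrite /rk -[RHS](card_imset _ (@enum_val_inj _ (mem T))).
  congr #|pred_of_set _|; apply/setP => v; rewrite inE.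
  apply/andP/imsetP => [[vT vk]|[j]]; last first.
    by rewrite inE => jk ->; rewrite enum_valP mono.
  by exists (enum_rank_in vT v); rewrite ?inE -?mono enum_rankK_in.
rewrite -sum1_card (eq_bigl (fun j : 'I_#|T| => (j < k)%N)); last by move=> j; rewrite inE.
by rewrite -(big_ord_widen _ (fun=> 1%N) (ltnW (ltn_ord k))) sum1_card card_ord.
Qed.

End Orderings.

Definition wgt (R : realType) (rho : R -> R) (N : nat) (u v : 'I_N) : R :=
  if u == v then 0 else rho (`|u%:R - v%:R| / N%:R).

Definition dev (R : realType) (rho : R -> R) (N : nat) (e : graph N) (u v : 'I_N) : R :=
  (adj e u v)%:R - wgt rho u v.

Lemma adjC (N : nat) (e : graph N) (u v : 'I_N) : adj e u v = adj e v u.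
Proof. by rewrite /adj; case: ltngtP. Qed.

Lemma adj_refl (N : nat) (e : graph N) (u : 'I_N) : adj e u u = false.
Proof. by rewrite /adj ltnn. Qed.

Lemma wgtC (R : realType) (rho : R -> R) (N : nat) (u v : 'I_N) :
  wgt rho u v = wgt rho v u.
Proof. by rewrite /wgt eq_sym distrC. Qed.

Lemma devC (R : realType) (rho : R -> R) (N : nat) (e : graph N) (u v : 'I_N) :
  dev rho e u v = dev rho e v u.
Proof. by rewrite /dev adjC wgtC. Qed.

Lemma ord_dist_le1 (R : realType) (N : nat) (u v : 'I_N) :
  0 <= (`|u%:R - v%:R| / N%:R : R) <= 1.
Proof.
rewrite divr_ge0 //= ler_pdivrMr ?ltr0n ?(leq_trans _ (ltn_ord u)) // mul1r.
rewrite -adistE ler_nat /adist; have := ltn_ord u; have := ltn_ord v; clear; lia.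
Qed.

Section Deviation.
Variables (R : realType) (rho : R -> R) (Lam : R).
Hypothesis rhoP : profile rho Lam.

Lemma wgt01 (N : nat) (u v : 'I_N) : 0 <= wgt rho u v <= 1.
Proof.
rewrite /wgt; case: eqP => _; first by rewrite lexx ler01.
by have /andP[h1 h2] := profile_pos rhoP (ord_dist_le1 R u v); rewrite ltW.
Qed.

Lemma dev_le1 (N : nat) (e : graph N) (u v : 'I_N) : `|dev rho e u v| <= 1.
Proof.
by have /andP[h1 h2] := wgt01 u v; rewrite /dev ler_norml; case: adj => /=; lra.
Qed.

(* [x M x = <x, x M>] and [|x M|^2 = x M^2 x] is controlled by the entries of [M^2]. *)
Lemma form_le_of_square (m : nat) (M : 'M[R]_m) (t eta : R) (x : 'rV[R]_m) :
  M^T = M -> (forall i j, `|M i j| <= 1) ->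
  (forall i j, i != j -> `|\sum_k M i k * M k j| <= t) ->
  0 < eta -> 0 <= t -> 1 + t <= eta ^+ 2 * m%:R ->
  `|\sum_i \sum_j x 0 i * M i j * x 0 j| <= eta * m%:R * dot x x.
Proof.
move=> sM M1 M2 eta0 t0 te.
have [->|x0] := eqVneq x 0.
  rewrite big1 ?normr0 => [|i _]; first by rewrite !mulr_ge0 ?dot_ge0 ?(ltW eta0).
  by rewrite big1 // => j _; rewrite mxE !mul0r.
have d0 := dot_gt0 x0.
pose y : 'rV_m := x *m M.
have E1 : \sum_i \sum_j x 0 i * M i j * x 0 j = dot y x.
  rewrite exchange_big; apply: eq_bigr => j _; rewrite mxE mulr_suml.
  by apply: eq_bigr => i _.
have E2 : dot y y = \sum_i \sum_j x 0 i * (\sum_k M i k * M k j) * x 0 j.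
  rewrite /y dot_mulmx // -mulmxA dotC.
  rewrite exchange_big; apply: eq_bigr => j _; rewrite mxE mulr_suml.
  by apply: eq_bigr => i _; rewrite mxE.
have diag i : `|\sum_k M i k * M k i| <= m%:R.
  apply: le_trans (ler_norm_sum _ _ _) _.
  rewrite -[m in leRHS]card_ord -sumr_const; apply: ler_sum => k _.
  by rewrite normrM -[leRHS]mulr1 ler_pM.
have amgm i j : `|x 0 i| * `|x 0 j| <= (x 0 i ^+ 2 + x 0 j ^+ 2) / 2.
  have := sqr_ge0 (`|x 0 i| - `|x 0 j|).
  rewrite -(real_normK (num_real (x 0 i))) -(real_normK (num_real (x 0 j))).
  rewrite !expr2; lra.
have yy : dot y y <= (1 + t) * m%:R * dot x x.
  rewrite E2; apply: le_trans (ler_norm _) _.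
  apply: le_trans (ler_norm_sum _ _ _) _.
  apply: le_trans (_ : \sum_i (m%:R * x 0 i ^+ 2 +
     \sum_j t * ((x 0 i ^+ 2 + x 0 j ^+ 2) / 2)) <= _).
    apply: ler_sum => i _; apply: le_trans (ler_norm_sum _ _ _) _.
    rewrite (bigD1 i) //= lerD //.
      rewrite !normrM mulrAC mulrC -expr2 real_normK ?num_real //.
      by rewrite ler_wpM2r ?sqr_ge0.
    rewrite [leRHS](bigD1 i) //= -[leLHS]add0r lerD //.
      by rewrite mulr_ge0 // divr_ge0 // addr_ge0 ?sqr_ge0.
    apply: ler_sum => j; rewrite eq_sym => ij; rewrite !normrM mulrAC mulrC.
    by apply: ler_pM; rewrite ?mulr_ge0 ?M2.
  rewrite big_split /= -mulr_sumr.
  have dE : \sum_i x 0 i ^+ 2 = dot x x by apply: eq_bigr => i _; rewrite expr2.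
  rewrite dE.
  have -> : \sum_(i < m) \sum_(j < m) t * ((x 0 i ^+ 2 + x 0 j ^+ 2) / 2) = t * m%:R * dot x x.
    transitivity (\sum_(i < m) t / 2 * (m%:R * x 0 i ^+ 2 + dot x x)).
      apply: eq_bigr => i _; rewrite -mulr_sumr -mulr_suml big_split /= dE.
      by rewrite sumr_const card_ord -mulr_natl; ring.
    rewrite -mulr_sumr big_split /= -mulr_sumr dE sumr_const card_ord -mulr_natl; by field.
  by apply: le_of_eq; ring.
have {}yy : dot y y <= (eta * m%:R) ^+ 2 * dot x x.
  apply: le_trans yy _; rewrite ler_wpM2r ?(ltW d0) // exprMn [_ ^+ 2 * _ ^+ 2]mulrC expr2.
  by rewrite -mulrA mulrC ler_wpM2r // mulrC.
rewrite E1.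
have s0 : 0 <= Num.sqrt (dot x x) by exact: sqrtr_ge0.
have s2 : Num.sqrt (dot x x) ^+ 2 = dot x x by rewrite sqr_sqrtr ?dot_ge0.
have em : 0 <= eta * m%:R by rewrite mulr_ge0 // ltW.
have := @dot_abs_le _ _ y x (eta * m%:R * Num.sqrt (dot x x)) (Num.sqrt (dot x x)).
rewrite mulr_ge0 // s0 exprMn s2 lexx => /(_ isT isT yy isT).
by rewrite -[X in _ <= X -> _]mulrA -expr2 s2.
Qed.

Record sample_ok (N : nat) (e : graph N) (T : {set 'I_N}) (f : 'rV[R]_#|T|) (t : R) : Prop :=
  SampleOk {
  ok_deg : forall u : 'I_N, `|\sum_(j < #|T|) dev rho e u (enum_val j)| <= t;
  ok_fiedler : forall u : 'I_N, `|\sum_(j < #|T|) dev rho e u (enum_val j) * f 0 j| <= t;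
  ok_square : forall u v : 'I_N, u != v ->
    `|\sum_(j < #|T|) dev rho e u (enum_val j) * dev rho e (enum_val j) v| <= t }.

Definition equidistributed (N : nat) (T : {set 'I_N}) (t : R) : Prop :=
  forall u : 'I_N, `|(rk T u)%:R - #|T|%:R * (u%:R / N%:R)| <= t.

Lemma lapT_lap (N : nat) (e : graph N) (T : {set 'I_N}) :
  lapT R e T = lap (\matrix_(i, j) (adj e (enum_val i) (enum_val j))%:R).
Proof.
apply/matrixP => i j; rewrite !mxE; congr (_ * _ - _).
under eq_bigr do rewrite mxE.
rewrite -(big_enum_val (fun v => (adj e (enum_val i) v)%:R : R)) /= -natr_sum.
rewrite -sum1_card; congr _%:R; rewrite [RHS]big_mkcond [LHS]big_mkcond /=.
by apply: eq_bigr => v _; rewrite inE; case: (v \in T); case: adj.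
Qed.

Theorem spec_ser_close (N : nat) (e : graph N) (T : {set 'I_N}) (c mu t : R)
    (f : 'rV[R]_#|T|) (sig : 'I_N -> nat) :
  0 < Lam -> 0 < c <= 1 -> fiedler_data c (profile_grid rho #|T|) mu f ->
  1 <= t -> t <= c ^+ 2 / (512 * (2 * Lam + 2)) * #|T|%:R ->
  equidistributed T t -> sample_ok e f t -> spec_ser R e T sig ->
  let D := 36 * ((2 * Lam + 2) * t) / c ^+ 3 in
  {in T, forall u, `|(sig u)%:R - (rk T u)%:R| <= D} \/
  {in T, forall u, `|(revo T sig u)%:R - (rk T u)%:R| <= D}.
Proof.
move=> Lam0 /andP[c0 c1] fd t1 t_le eqd ok [lam [phi [lam2 phi0 phiL sigO phisig]]] D.
set m := #|T| in f fd t_le ok phi phi0 phiL phisig *.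
set M : R := m%:R in t_le.
pose t' := (2 * Lam + 2) * t.
have t'_le : t' * 512 <= c ^+ 2 * M.
  have : t * (512 * (2 * Lam + 2)) <= c ^+ 2 * M.
    have L512 : 0 < 512 * (2 * Lam + 2) by lra.
    by rewrite -(ler_pdivlMr _ _ L512) mulrAC.
  by rewrite /t'; lra.
have Lt0 : 0 <= Lam * t by rewrite mulr_ge0 ?(ltW Lam0) //; lra.
have M0 : 0 < M.
  have : 0 < c ^+ 2 * M by apply: lt_le_trans t'_le; rewrite /t'; lra.
  by rewrite pmulr_rgt0 // exprn_gt0.
have m_gt0 : (0 < m)%N by rewrite -(ltr_nat R).
pose A : 'M[R]_m := \matrix_(i, j) (adj e (enum_val i) (enum_val j))%:R.
pose X : 'M[R]_m := \matrix_(i, j) dev rho e (enum_val i) (enum_val j).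
pose W := profile_grid rho m.
have symA : A^T = A by apply/matrixP => i j; rewrite !mxE adjC.
have symX : X^T = X by apply/matrixP => i j; rewrite !mxE devC.
have symW : W^T = W by apply/matrixP => i j; rewrite !mxE distrC.
have W01 i j : 0 <= W i j <= 1.
  rewrite mxE; have /andP[h1 h2] := profile_pos rhoP (ord_dist_le1 R i j).
  by rewrite ltW.
have diff i j : `|A i j - W i j - X i j| <= 2 * Lam * t / M + (i == j)%:R.
  have -> : A i j - W i j - X i j = wgt rho (enum_val i) (enum_val j) - W i j.
    by rewrite !mxE /dev; ring.
  rewrite /wgt; have [ij|ij] := eqVneq i j.
    rewrite ij eqxx sub0r normrN; have /andP[h1 h2] := W01 j j.
    rewrite ger0_norm //; apply: le_trans h2 _; rewrite lerDr.
    by rewrite divr_ge0 ?(ltW M0) // -mulrA mulr_ge0.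
  rewrite addr0 (inj_eq enum_val_inj) (negbTE ij) mxE.
  have N0 : 0 < N%:R :> R.
    by rewrite ltr0n; apply: leq_ltn_trans (ltn_ord (enum_val i)).
  apply: le_trans (profile_lip rhoP (ord_dist_le1 R _ _) (ord_dist_le1 R _ _)) _.
  rewrite -!mulrA mulrCA ler_pM2l //.
  have hi := eqd (enum_val i); have hj := eqd (enum_val j).
  rewrite !rk_enum_val in hi hj.
  apply: le_trans (_ : `|((enum_val i)%:R - (enum_val j)%:R) / N%:R - (i%:R - j%:R) / M| <= _).
    rewrite -[X in _ / X]ger0_norm ?(ltW N0) // -normf_div.
    rewrite -[X in _ - _ / X]ger0_norm ?(ltW M0) // -[X in _ - X]normf_div.
    exact: ler_dist_dist.
  rewrite -(ler_pM2l M0) -{1}[M]ger0_norm ?(ltW M0) // -normrM.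
  have -> : M * (2 * (t / M)) = t + t by field; rewrite gt_eqF.
  have -> : M * (((enum_val i)%:R - (enum_val j)%:R) / N%:R - (i%:R - j%:R) / M) =
     (j%:R - M * ((enum_val j)%:R / N%:R)) - (i%:R - M * ((enum_val i)%:R / N%:R)).
    by field; rewrite !gt_eqF.
  by apply: le_trans (ler_normB _ _) _; rewrite lerD.
have row_diff (h : 'I_m -> R) i : (forall j, `|h j| <= 1) ->
    `|\sum_j (A i j - W i j - X i j) * h j| <= 2 * Lam * t + 1.
  move=> h1; apply: le_trans (ler_norm_sum _ _ _) _.
  apply: le_trans (_ : \sum_j (2 * Lam * t / M + (i == j)%:R) <= _).
    by apply: ler_sum => j _; rewrite normrM -[leRHS]mulr1 ler_pM.
  rewrite big_split /= sumr_const card_ord -[_ *+ m]mulr_natr divfK ?gt_eqF // lerD2l.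
  rewrite (bigD1 i) //= eqxx big1 ?addr0 // => j; rewrite eq_sym => /negbTE ->.
  by [].
have X1 i j : `|X i j| <= 1 by rewrite mxE; exact: dev_le1.
have X2 i j : i != j -> `|\sum_k X i k * X k j| <= t.
  move=> ij; under eq_bigr do rewrite !mxE.
  by apply: (ok_square ok); rewrite (inj_eq enum_val_inj).
have c2 : c ^+ 2 <= c by rewrite expr2 ger_pMr.
have c2M : c ^+ 2 * M <= c * M by rewrite ler_wpM2r ?(ltW M0).
have split_sum (h : 'I_m -> R) i : \sum_j (A i j - W i j) * h j =
    \sum_j X i j * h j + \sum_j (A i j - W i j - X i j) * h j.
  by rewrite -big_split; apply: eq_bigr => j _ /=; ring.
have t'0 : 0 <= t' by rewrite /t'; lra.
have := @perturbed_fiedler R m A W c t' mu f m_gt0 c0 c1 t'0.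
rewrite -/M; have -> : t' <= c ^+ 2 * M / 8 by lra.
move=> /(_ isT symA symW _ (fiedler_sum fd) (fiedler_eig fd) (fiedler_le1 fd)
  (fiedler_norm fd) (fiedler_deg fd) (fiedler_gap1 fd) (fiedler_gap2 fd)).
case/(_ _ _ _ _ lam phi).
- by move=> i j; rewrite mxE; case: adj; rewrite /= ?lexx ?ler01.
- move=> i; rewrite -sumrB; under eq_bigr do rewrite -[_ - _]mulr1.
  rewrite split_sum; apply: le_trans (ler_normD _ _) _.
  have := row_diff (fun=> 1) i; rewrite normr1 lexx => /(_ (fun=> isT)).
  have := ok_deg ok (enum_val i); under eq_bigr do rewrite -[dev _ _ _ _]mulr1.
  under [in X in _ -> _ -> X]eq_bigr do rewrite mxE.
  rewrite /t'; lra.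
- move=> i; rewrite split_sum; apply: le_trans (ler_normD _ _) _.
  have := row_diff (fun j => f 0 j) i (fiedler_le1 fd).
  have := ok_fiedler ok (enum_val i).
  under [in X in _ -> _ -> X]eq_bigr do rewrite mxE.
  rewrite /t'; lra.
- move=> x.
  have -> : \sum_i \sum_j x 0 i * (A i j - W i j) * x 0 j =
     \sum_i \sum_j x 0 i * X i j * x 0 j + \sum_i \sum_j x 0 i * (A i j - W i j - X i j) * x 0 j.
    rewrite -big_split; apply: eq_bigr => i _; rewrite -big_split; apply: eq_bigr => j _ /=; ring.
  apply: le_trans (ler_normD _ _) _.
  have := @form_le_of_square m X t (c / 16) x symX X1 X2.
  rewrite divr_gt0 //; have -> : 0 <= t by lra.
  rewrite -/M; have -> : 1 + t <= (c / 16) ^+ 2 * M.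
    by rewrite exprMn; move: t'_le Lt0 t1; rewrite /t'; clear; lra.
  move=> /(_ isT isT isT) h1.
  have h2 : `|\sum_i \sum_j x 0 i * (A i j - W i j - X i j) * x 0 j| <= (2 * Lam * t + 1) * dot x x.
    apply: le_trans (ler_norm_sum _ _ _) _.
    apply: le_trans (_ : \sum_i (2 * Lam * t / M * \sum_j ((x 0 i ^+ 2 + x 0 j ^+ 2) / 2) + x 0 i ^+ 2) <= _).
      apply: ler_sum => i _; apply: le_trans (ler_norm_sum _ _ _) _.
      apply: le_trans (_ : \sum_j (2 * Lam * t / M * ((x 0 i ^+ 2 + x 0 j ^+ 2) / 2) +
           (i == j)%:R * x 0 i ^+ 2) <= _).
        apply: ler_sum => j _; rewrite !normrM mulrAC.
        apply: le_trans (_ : `|x 0 i| * `|x 0 j| * (2 * Lam * t / M + (i == j)%:R) <= _).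
          by rewrite ler_wpM2l ?mulr_ge0.
        rewrite mulrDr lerD //.
          rewrite mulrC ler_wpM2l //; first by rewrite divr_ge0 ?(ltW M0) // -mulrA mulr_ge0.
          have := sqr_ge0 (`|x 0 i| - `|x 0 j|).
          rewrite -(real_normK (num_real (x 0 i))) -(real_normK (num_real (x 0 j))).
          rewrite !expr2; lra.
        case: eqVneq => [->|_]; last by rewrite mulr0 mul0r.
        by rewrite mulr1 mul1r -expr2 real_normK ?num_real.
      rewrite big_split /= -mulr_sumr lerD2l (bigD1 i) //= eqxx mul1r big1 ?addr0 // => j.
      by rewrite eq_sym => /negbTE ->; rewrite mul0r.
    have dE : \sum_i x 0 i ^+ 2 = dot x x by apply: eq_bigr => i _; rewrite expr2.
    rewrite big_split /= dE -mulr_sumr [leRHS]mulrDl mul1r lerD2r.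
    have -> : \sum_(i < m) \sum_(j < m) ((x 0 i ^+ 2 + x 0 j ^+ 2) / 2) = M * dot x x.
      transitivity (\sum_(i < m) 2^-1 * (M * x 0 i ^+ 2 + dot x x)).
        apply: eq_bigr => i _; rewrite -mulr_suml big_split /= dE.
        by rewrite sumr_const card_ord -mulr_natl; ring.
      rewrite -mulr_sumr big_split /= -mulr_sumr dE sumr_const card_ord -mulr_natl -/M; by field.
    by rewrite mulrA divfK // gt_eqF.
  have d0 := dot_ge0 x.
  have : (2 * Lam * t + 1) * dot x x <= c / 16 * M * dot x x.
    rewrite ler_wpM2r //; move: t'_le c2M t1 Lt0; rewrite /t'; clear; lra.
  lra.
- by rewrite -lapT_lap.
- exact: phi0.
- by rewrite -lapT_lap.
move=> a a0 close.
have step (i j : 'I_m) : (i%:R + D < j%:R :> R) ->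
    0 < a * (phi 0 j - phi 0 i).
  move=> hij; have ij : (i <= j)%N.
    rewrite -(ler_nat R); apply: ltW; apply: le_lt_trans hij; rewrite lerDl.
    by rewrite divr_ge0 ?exprn_ge0 ?(ltW c0) // mulr_ge0.
  have := fiedler_inc fd ij; rewrite -/M => inc.
  have := close i; have := close j; rewrite -/M !ler_norml.
  set q := 18 * t' / _ => /andP[hj1 hj2] /andP[hi1 hi2].
  have qE : 2 * q < f 0 j - f 0 i.
    apply: lt_le_trans inc; rewrite ltr_pdivlMr // mulrC -ltr_pdivrMl //.
    have -> : c^-1 * (M * (2 * q)) = D.
      by rewrite /q /D /t'; field; rewrite !gt_eqF.
    by rewrite ltrBrDl.
  have [ap|an] := ltP 0 a.
    rewrite mulr_gt0 //; rewrite gtr0_norm // in hj1 hj2 hi1 hi2.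
    have : a * (2 * q) < a * (f 0 j - f 0 i) by rewrite ltr_pM2l.
    lra.
  have {}an : a < 0 by rewrite lt_def eq_sym a0.
  rewrite nmulr_rgt0 //; rewrite ltr0_norm // in hj1 hj2 hi1 hi2.
  have : a * (f 0 j - f 0 i) < a * (2 * q) by rewrite ltr_nM2l.
  lra.
have D0 : 0 <= D by rewrite divr_ge0 ?exprn_ge0 ?(ltW c0) // mulr_ge0.
pose Dn := Num.truncn D.
have /andP[Dn_le Dn_gt] := truncn_itv D0; rewrite -/Dn in Dn_le Dn_gt.
have stepn u v (uT : u \in T) (vT : v \in T) : (rk T u + Dn < rk T v)%N ->
    0 < a * (phi 0 (enum_rank_in vT v) - phi 0 (enum_rank_in uT u)).
  move=> h; apply: step.
  rewrite -(rk_enum_val (enum_rank_in uT u)) -(rk_enum_val (enum_rank_in vT v)).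
  rewrite !enum_rankK_in //; apply: lt_le_trans (_ : (rk T u)%:R + Dn.+1%:R <= _).
    by rewrite ltrD2l.
  by rewrite -natrD ler_nat addnS.
have real_close s : is_ordering T s ->
    {in T &, forall u v, (rk T u + Dn < rk T v)%N -> (s u < s v)%N} ->
    {in T, forall u, `|(s u)%:R - (rk T u)%:R| <= D}.
  move=> sO h u uT; have /andP[h1 h2] := ordering_close sO (rk_ordering T) h uT.
  move: h1 h2; rewrite -!(ler_nat R) !natrD ler_norml => h1 h2; lra.
have [ap|an] := ltP 0 a; [left|right].
  apply: real_close => // u v uT vT /(stepn _ _ uT vT).
  rewrite pmulr_rgt0 // subr_gt0 => /phisig.
  by rewrite !enum_rankK_in.
have {}an : a < 0 by rewrite lt_def eq_sym a0.
apply: real_close; first exact: revo_ordering.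
move=> u v uT vT /(stepn _ _ uT vT).
rewrite nmulr_rgt0 // subr_lt0 => /phisig.
rewrite !enum_rankK_in // /revo; case: sigO => _ /(_ _ uT); rewrite -/m.
clear; lia.
Qed.

End Deviation.

(** * The subroutine *)

Definition incr_on (R : realType) (N : nat) (S : {set 'I_N}) (pos : 'I_N -> nat) (D : R)
    (p : 'I_N -> R) : Prop :=
  {in S &, forall u v, (pos u)%:R <= 4 / 5 * #|S|%:R :> R ->
     (pos u)%:R + D <= (pos v)%:R -> p u < p v}.

Section CountPositions.
Variables (R : realType) (N : nat) (S : {set 'I_N}) (pos : 'I_N -> nat).
Hypothesis posO : is_ordering S pos.

Lemma card_pos_between_le (a b : R) : 0 <= b -> a <= b ->
  (#|[set u in S | (a <= (pos u)%:R) && ((pos u)%:R <= b)]|)%:R <= b - a + 2.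
Proof.
move=> b0 ab.
have /andP[hb1 hb2] := truncn_itv b0.
pose k := Num.truncn a.
have ka : k%:R <= Num.max a 0 /\ a < k%:R + 1.
  have [a0|/negP a0] := boolP (0 <= a).
    by have /andP[h1 h2] := truncn_itv a0; rewrite natr1 le_max h1.
  have {}a0 : a < 0 by rewrite ltNge; apply/negP.
  have k0 : k = 0%N by apply/truncn0Pn; rewrite -ltNge; apply: lt_trans a0 _.
  by split; [rewrite k0 le_max lexx orbT|rewrite k0 add0r; apply: lt_trans a0 _].
have kb : (k <= Num.truncn b)%N by apply: le_truncn.
set A := [set u in S | _].
have : (#|A| <= (Num.truncn b).+1 - k)%N.
  have kle u : a <= (pos u)%:R -> (k <= pos u)%N.
    by move=> h; rewrite -(ler_nat R); case: ka => h1 _; apply: le_trans h1 _; rewrite ge_max h ler0n.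
  apply: (@card_inj_nat_le _ _ (fun u => pos u - k)%N) => [u v|u]; rewrite !inE.
    move=> /and3P[uS /kle ku _] /and3P[vS /kle kv _] E.
    apply: (proj1 posO) => //; move: ku kv E; clear; lia.
  move=> /and3P[uS /kle ku ub].
  have : (pos u <= Num.truncn b)%N.
    by rewrite -ltnS -(ltr_nat R); apply: le_lt_trans hb2.
  by move: ku; clear; lia.
rewrite -(ler_nat R) natrB; last by move: kb; clear; lia.
rewrite -natr1; case: ka => _; lra.
Qed.

Lemma card_pos_between_ge (a b : R) : 0 <= a -> a <= b -> b <= #|S|%:R ->
  b - a - 2 <= (#|[set u in S | (a <= (pos u)%:R) && ((pos u)%:R <= b)]|)%:R.
Proof.
move=> a0 ab bS; have b0 := le_trans a0 ab.
have /andP[ha1 ha2] := truncn_itv a0.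
have /andP[hb1 hb2] := truncn_itv b0.
set A := [set u in S | _].
have bn : (Num.truncn b <= #|S|)%N by rewrite -(ler_nat R); apply: le_trans hb1 bS.
have [an|an] := leqP (Num.truncn a).+1 #|S|; last first.
  have : #|S|%:R <= (Num.truncn a)%:R :> R by rewrite ler_nat.
  have : 0 <= #|A|%:R :> R by [].
  lra.
have sub : [set u in S | (pos u < Num.truncn b)%N] \subset
    A :|: [set u in S | (pos u < (Num.truncn a).+1)%N].
  apply/fintype.subsetP => u; rewrite !inE => /andP[uS ub]; rewrite uS /=.
  have [ua|ua] := ltnP (pos u) (Num.truncn a).+1; rewrite ?orbT // orbF.
  rewrite (le_trans (ltW ha2)) ?ler_nat //= (le_trans _ hb1) // ler_nat ltnW //.
have := leq_trans (subset_leq_card sub) (leq_card_setU _ _).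
rewrite !(card_below posO) // -(ler_nat R) natrD -!natr1 => h.
move: ha2 hb2; rewrite -!natr1; lra.
Qed.

End CountPositions.

Section TopSet.
Variables (R : realType) (rho : R -> R) (Lam : R).
Hypothesis rhoP : profile rho Lam.

Lemma top_gap : exists2 c, 0 < c &
  forall x a b : R, 94 / 100 <= x -> x <= 1 -> 0 <= a -> a <= 81 / 100 -> a <= b -> b <= 1 ->
    0 <= rho `|x - b| - rho `|x - a| /\
    (x <= 98 / 100 -> c * (b - a) <= rho `|x - b| - rho `|x - a|).
Proof.
have e1 : 0 < 2 / 100 :> R by lra.
have [c1 c10 h1] := profile_slope rhoP e1.
have [c2 c20 h2] := profile_drop rhoP e1.
exists (Num.min c1 c2); first by rewrite lt_min c10.
move=> x a b x1 x2 a0 a1 ab b1.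
have ax : `|x - a| = x - a by rewrite ger0_norm //; lra.
rewrite ax; have ba0 : 0 <= b - a by lra.
have m1 : Num.min c1 c2 * (b - a) <= c1 * (b - a) by rewrite ler_wpM2r // ge_min lexx.
have m2 : Num.min c1 c2 * (b - a) <= c2.
  apply: le_trans (_ : c2 * (b - a) <= _); first by rewrite ler_wpM2r // ge_min lexx orbT.
  by rewrite -[leRHS]mulr1 ler_wpM2l ?(ltW c20) //; lra.
have [b9|b9] := leP b (9 / 10).
  rewrite ger0_norm; last by lra.
  split; first by rewrite subr_ge0; apply: (profile_mono rhoP); lra.
  move=> x98; apply: le_trans m1 _.
  have -> : b - a = (x - a) - (x - b) by ring.
  by apply: h1; lra.
have xb : `|x - b| <= 1 / 10 by rewrite ler_norml; lra.
have xb0 := normr_ge0 (x - b).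
have := h2 `|x - b| (x - a) xb0; move: m2.
have -> : `|x - b| + 2 / 100 <= x - a by lra.
have -> : x - a <= 1 by lra.
move=> m2 /(_ isT isT) h3; split; lra.
Qed.

Lemma sum_dev_split (N : nat) (e : graph N) (A : pred 'I_N) (v : 'I_N) :
  \sum_(u | A u) (adj e u v)%:R =
  \sum_(u | A u) dev rho e u v + \sum_(u | A u) wgt rho u v.
Proof. by rewrite -big_split; apply: eq_bigr => u _; rewrite /dev /= subrK. Qed.

Lemma psiE (N : nat) (e : graph N) (T X : {set 'I_N}) (v : 'I_N) :
  psi R e T X v = (\sum_(u in X) (adj e u v)%:R) / #|T|%:R.
Proof.
rewrite /psi; congr (_ / _); rewrite -sum1_card natr_sum.
rewrite big_mkcond [RHS]big_mkcond; apply: eq_bigr => u _; rewrite inE.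
by case: (u \in X); case: adj.
Qed.

Lemma sum_sym_diff_le (N : nat) (X Y Z : {set 'I_N}) (h : 'I_N -> R) :
  (forall u, 0 <= h u <= 1) -> (forall u, u \notin Z -> (u \in X) = (u \in Y)) ->
  `|\sum_(u in X) h u - \sum_(u in Y) h u| <= #|Z|%:R.
Proof.
move=> h01 XY; rewrite [X in `|X - _|]big_mkcond [X in `|_ - X|]big_mkcond -sumrB.
apply: le_trans (ler_norm_sum _ _ _) _.
rewrite -sum1_card natr_sum [leRHS]big_mkcond /=; apply: ler_sum => u _.
have /andP[h0 h1] := h01 u.
have := XY u; case: (u \in Z) => /= [_|->//]; last by rewrite subrr normr0.
by case: (u \in X); case: (u \in Y); rewrite ler_norml; lra.
Qed.

Lemma top_increasing : exists2 K, 0 < K &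
  forall (N : nat) (e : graph N) (T S X : {set 'I_N}) (posT posS : 'I_N -> nat)
    (xi : 'I_N -> R) (t D : R),
  [disjoint T & S] -> is_ordering T posT ->
  #|S|%:R <= 2 * #|T|%:R :> R -> 200 <= #|T|%:R :> R ->
  0 <= t -> t <= #|T|%:R / 100 -> t <= #|S|%:R / 100 -> 0 <= D ->
  (forall u, 0 <= xi u <= 1) ->
  (forall u v, `|xi u - xi v| = `|u%:R - v%:R| / N%:R) ->
  {in T, forall u, `|(posT u)%:R - #|T|%:R * xi u| <= t} ->
  {in S, forall u, `|(posS u)%:R - #|S|%:R * xi u| <= t} ->
  X \subset T ->
  {in T, forall u, 95 / 100 * #|T|%:R + D <= (posT u)%:R -> u \in X} ->
  {in X, forall u, 95 / 100 * #|T|%:R - D <= (posT u)%:R} ->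
  (forall v, `|\sum_(u in T | 95 / 100 * #|T|%:R <= (posT u)%:R :> R) dev rho e u v| <= t) ->
  incr_on S posS (K * (t + D + 1)) (psi R e T X).
Proof.
have [c c0 hc] := top_gap.
have [B B0 BE] : exists2 B : R, 0 < B & forall x, B * x = 1000 * x.
  by exists 1000; [lra|].
have Bc0 : 0 < B / c by rewrite divr_gt0.
exists (2 + B / c); first by lra.
move=> N e T S X posT posS xi t D TS posTO sizes m200 t0 tT tS D0 xi01 xi_dist
  posT_xi posS_xi XT X_big X_small top_dev v v' vS v'S v_le vv'.
set m : R := #|T|%:R in sizes m200 tT posT_xi X_big X_small top_dev *.
set m' : R := #|S|%:R in sizes tS posS_xi v_le *.
have m0 : 0 < m by clear - m200; lra.
pose X0 := [set u in T | 95 / 100 * m <= (posT u)%:R].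
pose Z := [set u in T | (95 / 100 * m - D <= (posT u)%:R) && ((posT u)%:R <= 95 / 100 * m + D)].
have Z_le : #|Z|%:R <= 2 * D + 2 :> R.
  have := @card_pos_between_le R N T posT posTO (95 / 100 * m - D) (95 / 100 * m + D).
  rewrite -/Z; have -> : 0 <= 95 / 100 * m + D by clear - m0 D0; lra.
  have -> : 95 / 100 * m - D <= 95 / 100 * m + D by clear - D0; lra.
  by move=> /(_ isT isT); clear; lra.
have XX0 u : u \notin Z -> (u \in X) = (u \in X0).
  rewrite !inE; have [uT|uT] := boolP (u \in T); last first.
    by move=> _; apply: contraNF uT; apply: (fintype.subsetP XT).
  rewrite /= negb_and -!ltNge => uZ; apply/idP/idP => [uX|uX0].
    by have := X_small u uX; case/orP: uZ; clear - D0; lra.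
  by apply: X_big => //; case/orP: uZ; clear - D0 uX0; lra.
have adj01 (w u : 'I_N) : 0 <= ((adj e u w)%:R : R) <= 1.
  by case: adj; rewrite ?lexx ?ler01.
have w01 u w : u \in T -> w \in S -> wgt rho u w = rho `|xi u - xi w|.
  move=> uT wS; rewrite /wgt xi_dist; case: eqVneq => // uw.
  by move: (disjointFr TS uT); rewrite uw wS.
have X0E w : \sum_(u in X0) (adj e u w)%:R =
    \sum_(u in T | 95 / 100 * m <= (posT u)%:R) dev rho e u w +
    \sum_(u in X0) wgt rho u w.
  rewrite sum_dev_split; congr (_ + _); apply: eq_bigl => u; by rewrite inE.
have [xv0 xv1] := andP (xi01 v); have [xv'0 xv'1] := andP (xi01 v').
have pv := posS_xi v vS; have pv' := posS_xi v' v'S.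
have m'0 : 0 <= m' by [].
have vT_n0 : 0 < m'.
  rewrite ltr0n; apply/card_gt0P; by exists v.
have step : (B / c) * (t + D + 1) <= m' * (xi v' - xi v).
  by move: pv pv' vv'; rewrite !ler_norml; clear - t0 D0; lra.
have xvv' : xi v <= xi v'.
  rewrite -subr_ge0 -(pmulr_rge0 _ vT_n0); apply: le_trans step.
  by rewrite mulr_ge0 ?(ltW Bc0) //; clear - t0 D0; lra.
have xv81 : xi v <= 81 / 100.
  by rewrite -(ler_pM2l vT_n0); move: pv v_le; rewrite ler_norml; clear - tS; lra.
have xi94 u : u \in X0 -> 94 / 100 <= xi u.
  rewrite inE => /andP[uT hu]; rewrite -(ler_pM2l m0).
  by have := posT_xi u uT; rewrite ler_norml; clear - hu tT; lra.
have gap u : u \in X0 -> 0 <= wgt rho u v' - wgt rho u v /\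
    (xi u <= 98 / 100 -> c * (xi v' - xi v) <= wgt rho u v' - wgt rho u v).
  move=> uX0; have uT : u \in T by move: uX0; rewrite inE => /andP[].
  rewrite !w01 //; apply: hc => //; [exact: xi94|by case/andP: (xi01 u)].
pose X1 := [set u in T | (95 / 100 * m <= (posT u)%:R) && ((posT u)%:R <= 97 / 100 * m)].
have X1_ge : m / 100 <= #|X1|%:R.
  have := @card_pos_between_ge R N T posT posTO (95 / 100 * m) (97 / 100 * m).
  rewrite -/X1 -/m; have -> : 0 <= 95 / 100 * m by clear - m0; lra.
  have -> : 95 / 100 * m <= 97 / 100 * m by clear - m0; lra.
  have -> : 97 / 100 * m <= m by clear - m0; lra.
  by move=> /(_ isT isT isT); clear - m200; lra.
have X10 : X1 \subset X0.
  by apply/fintype.subsetP => u; rewrite !inE => /and3P[-> ->].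
have main : m / 100 * (c * (xi v' - xi v)) <= \sum_(u in X0) (wgt rho u v' - wgt rho u v).
  apply: le_trans (_ : \sum_(u in X1) (wgt rho u v' - wgt rho u v) <= _).
    apply: le_trans (_ : #|X1|%:R * (c * (xi v' - xi v)) <= _).
      by rewrite ler_wpM2r // mulr_ge0 ?subr_ge0 // ltW.
    rewrite mulr_natl -sumr_const; apply: ler_sum => u uX1.
    have [_] := gap u (fintype.subsetP X10 _ uX1); apply.
    move: uX1; rewrite inE => /and3P[uT _ hu]; rewrite -(ler_pM2l m0).
    by have := posT_xi u uT; rewrite ler_norml; clear - hu tT; lra.
  rewrite [leRHS](finset.big_setID X1) /= (finset.setIidPr X10) lerDl; apply: sumr_ge0 => u.
  by rewrite inE => /andP[_ /gap[]].
have lower : 5 * (t + D + 1) <= m / 100 * (c * (xi v' - xi v)).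
  have h : B * (t + D + 1) <= m' * (xi v' - xi v) * c.
    by rewrite -ler_pdivrMr // mulrAC.
  have xc : 0 <= (xi v' - xi v) * c by rewrite mulr_ge0 ?subr_ge0 // ltW.
  have : m' * ((xi v' - xi v) * c) <= 2 * m * ((xi v' - xi v) * c) by rewrite ler_wpM2r.
  by move: h; rewrite BE; clear; lra.
rewrite !psiE ltr_pM2r ?invr_gt0 // -subr_gt0.
have d1 := sum_sym_diff_le (adj01 v) XX0.
have d2 := sum_sym_diff_le (adj01 v') XX0.
rewrite X0E in d1; rewrite X0E in d2.
have := top_dev v; have := top_dev v'; move: main d1 d2 lower.
by rewrite sumrB !ler_norml; clear - Z_le t0 D0; lra.
Qed.

End TopSet.

Section Threshold.
Variables (R : realType) (N : nat) (S : {set 'I_N}) (pos : 'I_N -> nat) (D : R)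
  (p : 'I_N -> R).
Hypotheses (posO : is_ordering S pos) (p_ge0 : forall u, 0 <= p u)
  (p_inc : incr_on S pos D p) (D_ge0 : 0 <= D).

Let M : R := #|S|%:R.
Let beta : R := 31 / 100.
Let cset : set R := [set c : R | 0 <= c /\
  (1 - beta) * #|S|%:R <= (#|[set v in S | p v <= c]|)%:R]%classic.

Let threshE : thresh S beta p = inf cset. Proof. by []. Qed.

Lemma le_thresh u : u \in S -> (pos u)%:R + D + 2 <= 69 / 100 * M ->
  p u < thresh S beta p.
Proof.
move=> uS pu; rewrite threshE.
have M0 : 0 < M by rewrite ltr0n; apply/card_gt0P; exists u.
have cset0 : (cset !=set0)%classic.
  exists (\sum_(v in S) p v); split; first exact: sumr_ge0.
  have -> : [set v in S | p v <= \sum_(v in S) p v] = S.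
    apply/setP => v; rewrite inE; case: (boolP (v \in S)) => //= vS.
    by rewrite (bigD1 v) //= lerDl sumr_ge0.
  by rewrite -/M /beta; lra.
pose V := [set v in S | 69 / 100 * M - 2 <= (pos v)%:R].
have V_of c : cset c -> exists2 v, v \in V & p v <= c.
  move=> [c0 hc]; have [/existsP[v /andP[vV vc]]|h] := boolP [exists v, (v \in V) && (p v <= c)].
    by exists v.
  exfalso.
  have pos_lt v : v \in [set v in S | p v <= c] -> (pos v)%:R + 2 < 69 / 100 * M :> R.
    rewrite inE => /andP[vS vc].
    move: h; rewrite negb_exists => /forallP /(_ v); rewrite inE vS vc andbT /= -ltNge.
    by lra.
  set A := [set v in S | p v <= c] in hc pos_lt.
  have cnt : (#|A| <= Num.truncn (69 / 100 * M - 1))%N.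
    apply: (@card_inj_nat_le _ _ pos) => [v w|v vA].
      by rewrite !inE => /andP[vS _] /andP[wS _]; apply: (proj1 posO).
    have := pos_lt v vA; rewrite truncn_gt_nat -natr1; lra.
  have [y0|y0] := leP 0 (69 / 100 * M - 1).
    have /andP[h1 _] := truncn_itv y0.
    move: cnt hc; rewrite -(ler_nat R) -/M /beta; lra.
  have y1 : Num.truncn (69 / 100 * M - 1) = 0%N by apply/truncn0Pn; rewrite -ltNge; lra.
  by move: cnt hc; rewrite y1 -(ler_nat R) -/M /beta; lra.
have [v0 v0V _] : exists2 v, v \in V & p v <= \sum_(v in S) p v.
  by case: cset0 => c /V_of [v vV _]; exists v => //; move: vV; rewrite inE => /andP[vS _];
     rewrite (bigD1 v) //= lerDl sumr_ge0.
have [w wV wmin] : exists2 w, w \in V & forall v, v \in V -> p w <= p v.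
  by case: (arg_minP p v0V) => w wV wmin; exists w.
apply: lt_le_trans (_ : p w <= _).
  move: wV; rewrite inE => /andP[wS pw]; apply: p_inc => //; rewrite -/M.
    by move: pu D_ge0; lra.
  by move: pu pw; lra.
apply: lb_le_inf => // c /V_of [v vV vc]; exact: le_trans (wmin v vV) vc.
Qed.

Lemma thresh_le u : u \in S -> 69 / 100 * M + D <= (pos u)%:R ->
  thresh S beta p <= p u.
Proof.
move=> uS pu; rewrite threshE.
have M0 : 0 < M by rewrite ltr0n; apply/card_gt0P; exists u.
apply: ge_inf; first by exists 0 => c [].
split=> //; have y0 : 0 <= 69 / 100 * M by lra.
have /andP[h1 h2] := truncn_itv y0.
have kS : ((Num.truncn (69 / 100 * M)).+1 <= #|S|)%N.
  rewrite -(ltr_nat R); apply: le_lt_trans h1 _; rewrite -/M; lra.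
have sub : [set v in S | (pos v < (Num.truncn (69 / 100 * M)).+1)%N] \subset [set v in S | p v <= p u].
  apply/fintype.subsetP => v; rewrite !inE ltnS => /andP[vS hv]; rewrite vS /= ltW //.
  have hv' : (pos v)%:R <= 69 / 100 * M by apply: le_trans h1; rewrite ler_nat.
  apply: p_inc => //; rewrite -/M; first by lra.
  by lra.
have := subset_leq_card sub; rewrite (card_below posO kS) -(ler_nat R).
rewrite -/M /beta; lra.
Qed.

End Threshold.

Section Fhat.
Variables (R : realType) (N : nat) (S : {set 'I_N}).

Lemma Fhat_anti (pR pL : 'I_N -> R) (cR cL : R) u v :
  Fhat pR pL cR cL u v = - Fhat pR pL cR cL v u.
Proof. by rewrite /Fhat; case: ltngtP => _; rewrite ?opprK ?oppr0. Qed.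

Lemma Fhat_le1 (pR pL : 'I_N -> R) (cR cL : R) u v : Fhat pR pL cR cL u v <= 1.
Proof.
by rewrite /Fhat /Fup; case: ltngtP => _; repeat case: ifP => _ //; rewrite ?opprK; lra.
Qed.

Lemma fhat_close (F : 'I_N -> 'I_N -> R) (pos sigma : 'I_N -> nat) (D : nat) :
  is_ordering S pos -> (forall u v, F u v = - F v u) -> (forall u v, F u v <= 1) ->
  {in S &, forall u v, (pos u + D <= pos v)%N -> F u v = 1} ->
  ordered_by (fun v => \sum_(u in S) F u v) S sigma ->
  {in S, forall u, (pos u <= sigma u + 2 * D)%N && (sigma u <= pos u + 2 * D)%N}.
Proof.
move=> posO anti F1 Fpos [sO ssort].
apply: (ordering_close sO posO) => v w vS wS vw; apply: ssort => //.
have cnt x : \sum_(u in S) (pos u < x)%N%:R = (#|[set u in S | (pos u < x)%N]|)%:R :> R.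
  by rewrite -natr_sum -big_mkcondr sum1_card cardsE.
have upper : \sum_(u in S) F u v <= 2 * (pos v + D)%:R - #|S|%:R.
  apply: le_trans (_ : \sum_(u in S) (2 * (pos u < pos v + D)%N%:R - 1) <= _).
    apply: ler_sum => u uS; case: ltnP => h /=; first by have := F1 u v; lra.
    by rewrite anti Fpos //; lra.
  rewrite sumrB sumr_const lerD2r -mulr_sumr ler_pM2l //.
  rewrite cnt ler_nat.
  apply: (@card_inj_nat_le _ _ pos) => [x y|x]; rewrite !inE => /andP[xS] //.
  by move=> _ /andP[yS _]; apply: (proj1 posO).
have lower : 2 * (pos w - D + 1)%:R - #|S|%:R <= \sum_(u in S) F u w.
  apply: le_trans (_ : \sum_(u in S) (2 * (pos u < pos w - D + 1)%N%:R - 1) <= _); last first.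
    apply: ler_sum => u uS; case: ltnP => h /=.
      have -> : F u w = 1 by apply: Fpos => //; move: h vw; clear; lia.
      lra.
    by have := F1 w u; rewrite anti; lra.
  rewrite sumrB sumr_const lerD2r -mulr_sumr ler_pM2l //.
  rewrite cnt ler_nat (card_below posO) //.
  by have := proj2 posO w wS; move: vw; clear; lia.
have : (pos v + D < pos w - D + 1)%N by move: vw; clear; lia.
rewrite -(ltr_nat R); lra.
Qed.

Variables (pos : 'I_N -> nat) (D : R) (pR pL : 'I_N -> R).
Hypotheses (posO : is_ordering S pos) (pR0 : forall u, 0 <= pR u)
  (pL0 : forall u, 0 <= pL u) (D0 : 0 <= D) (D_le : D + 3 <= #|S|%:R / 100).

Let cR := thresh S (31 / 100 : R) pR.
Let cL := thresh S (31 / 100 : R) pL.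
Let F := Fhat pR pL cR cL.

Lemma Fhat_forward : incr_on S pos D pR -> incr_on S (revo S pos) D pL ->
  {in S &, forall u v : 'I_N, (u < v)%N -> (pos u)%:R + (2 * D + 2) <= (pos v)%:R -> F u v = 1}.
Proof.
move=> incR incL u v uS vS uv huv; have hD := D_le; have hD0 := D0; rewrite /F /Fhat uv /Fup.
have rE x : x \in S -> (revo S pos x)%:R = #|S|%:R - 1 - (pos x)%:R :> R.
  by move=> xS; rewrite /revo natrB ?(proj2 posO) // -natr1; ring.
have revO := revo_ordering posO.
case: ifP => [/andP[uR vR]|nR].
  rewrite ltNge ltW ?incR //.
    rewrite leNgt; apply/negP => h.
    have : cR <= pR u by apply: (thresh_le posO pR0 incR) => //; lra.
    by rewrite leNgt uR.
  by lra.
case: ifP => [/andP[uL vL]|nL].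
  rewrite ltNge ltW ?incL // !rE //.
    rewrite leNgt; apply/negP => h.
    have : cL <= pL v by apply: (thresh_le revO pL0 incL) => //; rewrite rE //; lra.
    by rewrite leNgt vL.
  by lra.
case: ifP => // uR; exfalso.
have posu : 69 / 100 * #|S|%:R - D - 2 < (pos u)%:R.
  rewrite ltNge; apply/negP => h; move: uR.
  by rewrite /cR (le_thresh posO pR0 incR D0) //; lra.
move: nL; rewrite /cL !(le_thresh revO pL0 incL D0) // rE //; lra.
Qed.

Lemma Fhat_backward : incr_on S (revo S pos) D pR -> incr_on S pos D pL ->
  {in S &, forall u v : 'I_N, (u < v)%N -> (pos u)%:R + (2 * D + 2) <= (pos v)%:R -> F u v = -1}.
Proof.
move=> incR incL u v uS vS uv huv; have hD := D_le; have hD0 := D0; rewrite /F /Fhat uv /Fup.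
have rE x : x \in S -> (revo S pos x)%:R = #|S|%:R - 1 - (pos x)%:R :> R.
  by move=> xS; rewrite /revo natrB ?(proj2 posO) // -natr1; ring.
have revO := revo_ordering posO.
case: ifP => [/andP[uR vR]|nR].
  rewrite incR // !rE //.
    rewrite leNgt; apply/negP => h.
    have : cR <= pR v by apply: (thresh_le revO pR0 incR) => //; rewrite rE //; lra.
    by rewrite leNgt vR.
  by lra.
case: ifP => [/andP[uL vL]|nL].
  rewrite incL //.
    rewrite leNgt; apply/negP => h.
    have : cL <= pL u by apply: (thresh_le posO pL0 incL) => //; lra.
    by rewrite leNgt uL.
  by lra.
case: ifP => // uR; exfalso; move: nR; rewrite uR /=.
have posu : #|S|%:R - 1 - (pos u)%:R < 69 / 100 * #|S|%:R + D.
  rewrite -rE // ltNge; apply/negP => h.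
  have : cR <= pR u by apply: (thresh_le revO pR0 incR).
  by rewrite leNgt uR.
by rewrite /cR (le_thresh revO pR0 incR D0) // rE //; lra.
Qed.

End Fhat.

Record top_ok (R : realType) (rho : R -> R) (N : nat) (e : graph N) (T : {set 'I_N})
    (t : R) : Prop := TopOk {
  top_ok_right : forall v : 'I_N,
    `|\sum_(u in T | 95 / 100 * #|T|%:R <= (rk T u)%:R :> R) dev rho e u v| <= t;
  top_ok_left : forall v : 'I_N,
    `|\sum_(u in T | 95 / 100 * #|T|%:R <= (revo T (rk T) u)%:R :> R) dev rho e u v| <= t }.

Lemma revo_rk_real (R : realType) (N : nat) (S : {set 'I_N}) (s : 'I_N -> nat) u :
  is_ordering S s -> u \in S -> (revo S s u)%:R = #|S|%:R - 1 - (s u)%:R :> R.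
Proof. by move=> sO uS; rewrite /revo natrB ?(proj2 sO) // -natr1; ring. Qed.

Theorem subroutine_close (R : realType) (rho : R -> R) (Lam c : R) :
  profile rho Lam -> 0 < Lam -> 0 < c <= 1 ->
  exists tau K, [/\ 0 < tau, 0 < K &
  forall (N : nat) (e : graph N) (T S : {set 'I_N}) (t mu : R) (f : 'rV[R]_#|T|)
    (sigma : 'I_N -> nat),
  [disjoint T & S] -> #|S|%:R <= 2 * #|T|%:R :> R -> 200 <= #|T|%:R :> R ->
  fiedler_data c (profile_grid rho #|T|) mu f ->
  1 <= t -> t <= tau * #|T|%:R -> t <= tau * #|S|%:R ->
  equidistributed T t -> equidistributed S t -> sample_ok rho e f t -> top_ok rho e T t ->
  subroutine e T S (5 / 100 : R) (31 / 100 : R) sigma ->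
  is_ordering S sigma /\
  ({in S, forall v, `|(sigma v)%:R - (rk S v)%:R| <= K * t} \/
   {in S, forall v, `|(revo S sigma v)%:R - (rk S v)%:R| <= K * t})].
Proof.
move=> rhoP Lam_gt0 c01.
have [K0 K00 top] := top_increasing rhoP.
have [c0 c1] := andP c01.
pose k1 := 36 * (2 * Lam + 2) / c ^+ 3.
have k10 : 0 < k1.
  by rewrite /k1 divr_gt0 ?exprn_gt0 // mulr_gt0 //; lra.
pose k2 := K0 * (k1 + 4).
have k20 : 0 < k2 by rewrite mulr_gt0 //; lra.
pose tau0 := c ^+ 2 / (512 * (2 * Lam + 2)).
have tau00 : 0 < tau0.
  have L512 : 0 < 512 * (2 * Lam + 2) by lra.
  exact: divr_gt0 (exprn_gt0 _ c0) L512.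
have k23 : 0 < 100 * (k2 + 4) by lra.
pose tau1 := (100 * (k2 + 4))^-1.
have tau10 : 0 < tau1 by rewrite invr_gt0.
exists (Num.min tau0 tau1), (4 * k2 + 6); split; [by rewrite lt_min tau00|lra|].
move=> N e T S t mu f sigma TS sizes m200 fd t1 tT tS eqT eqS ok topok.
case=> sigT [spec]; set Rs := [set u in T | _]; set Ls := [set u in T | _].
move=> /= ord.
set m : R := #|T|%:R in sizes m200 tT.
set m' : R := #|S|%:R in sizes tS.
have m'0 : 0 <= m' by [].
have tT0 : t <= tau0 * m.
  by apply: le_trans tT _; rewrite ler_wpM2r // ge_min lexx.
have tT1 : t * (100 * (k2 + 4)) <= m.
  rewrite -ler_pdivlMr // mulrC; apply: le_trans tT _.
  by rewrite ler_wpM2r // ge_min lexx orbT.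
have tS1 : t * (100 * (k2 + 4)) <= m'.
  rewrite -ler_pdivlMr // mulrC; apply: le_trans tS _.
  by rewrite ler_wpM2r // ge_min lexx orbT.
have kt : 0 <= k2 * t by rewrite mulr_ge0 ?(ltW k20) //; clear - t1; lra.
have k1t : 0 <= k1 * t by rewrite mulr_ge0 ?(ltW k10) //; clear - t1; lra.
have close := spec_ser_close rhoP Lam_gt0 c01 fd t1 tT0 eqT ok spec.
have DE : 36 * ((2 * Lam + 2) * t) / c ^+ 3 = k1 * t by rewrite /k1; ring.
rewrite DE in close.
pose D1 := K0 * (2 * t + (k1 * t + 1) + 1).
have D1_le : D1 <= k2 * t.
  have -> : k2 * t = K0 * ((k1 + 4) * t) by rewrite /k2; ring.
  by rewrite ler_wpM2l ?(ltW K00) //; clear - t1; lra.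
have D1_ge0 : 0 <= D1 by rewrite mulr_ge0 ?(ltW K00) //; clear - t1 k1t; lra.
have pT0 : {in T, forall u, `|(rk T u)%:R - m * (u%:R / N%:R)| <= 2 * t}.
  by move=> u _; apply: le_trans (eqT u) _; clear - t1; lra.
have pS0 : {in S, forall u, `|(rk S u)%:R - m' * (u%:R / N%:R)| <= 2 * t}.
  by move=> u _; apply: le_trans (eqS u) _; clear - t1; lra.
have rkT := rk_ordering T. have rkS := rk_ordering S.
have pT1 : {in T, forall u, `|(revo T (rk T) u)%:R - m * (1 - u%:R / N%:R)| <= 2 * t}.
  move=> u uT; rewrite revo_rk_real // -/m.
  by have := eqT u; rewrite -/m !ler_norml; clear - t1; lra.
have pS1 : {in S, forall u, `|(revo S (rk S) u)%:R - m' * (1 - u%:R / N%:R)| <= 2 * t}.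
  move=> u uS; rewrite revo_rk_real // -/m'.
  by have := eqS u; rewrite -/m' !ler_norml; clear - t1; lra.
have xi0 (u : 'I_N) : 0 <= (u%:R / N%:R : R) <= 1.
  rewrite divr_ge0 //= ler_pdivrMr ?ltr0n ?(leq_ltn_trans _ (ltn_ord u)) //.
  by rewrite mul1r ler_nat ltnW.
have xi1 (u : 'I_N) : 0 <= (1 - u%:R / N%:R : R) <= 1.
  by have := xi0 u; clear; lra.
have dist0 (u v : 'I_N) : `|u%:R / N%:R - v%:R / N%:R| = `|u%:R - v%:R| / N%:R :> R.
  by rewrite -mulrBl normrM [`|N%:R^-1|]ger0_norm ?invr_ge0.
have dist1 (u v : 'I_N) : `|(1 - u%:R / N%:R) - (1 - v%:R / N%:R)| = `|u%:R - v%:R| / N%:R :> R.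
  by rewrite -dist0 distrC; congr `|_|; ring.
have t20 : 0 <= 2 * t by clear - t1; lra.
have t2T : 2 * t <= m / 100 by clear - tT1 t1 kt; lra.
have t2S : 2 * t <= m' / 100 by clear - tS1 t1 kt; lra.
have Dp0 : 0 <= k1 * t + 1 by clear - k1t; lra.
have dev0 v : `|\sum_(u in T | 95 / 100 * m <= (rk T u)%:R) dev rho e u v| <= 2 * t.
  by apply: le_trans (top_ok_right topok v) _; clear - t1; lra.
have dev1 v : `|\sum_(u in T | 95 / 100 * m <= (revo T (rk T) u)%:R) dev rho e u v| <= 2 * t.
  by apply: le_trans (top_ok_left topok v) _; clear - t1; lra.
have inc0 X := top N e T S X (rk T) (rk S) (fun u => u%:R / N%:R) (2 * t) (k1 * t + 1)
  TS rkT sizes m200 t20 t2T t2S Dp0 xi0 dist0 pT0 pS0.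
have inc1 X := top N e T S X (revo T (rk T)) (revo S (rk S)) (fun u => 1 - u%:R / N%:R)
  (2 * t) (k1 * t + 1) TS (revo_ordering rkT) sizes m200 t20 t2T t2S Dp0 xi1 dist1 pT1 pS1.
rewrite -/D1 -/m in inc0 inc1.
have [_ [_ [_ _ _ sigO _]]] := spec.
have RsT : Rs \subset T by apply/fintype.subsetP => u; rewrite inE => /andP[].
have LsT : Ls \subset T by apply/fintype.subsetP => u; rewrite inE => /andP[].
have Rs_top p : {in T, forall u, `|(sigT u)%:R - (p u)%:R| <= k1 * t} ->
    {in T, forall u, 95 / 100 * m + (k1 * t + 1) <= (p u)%:R -> u \in Rs} /\
    {in Rs, forall u, 95 / 100 * m - (k1 * t + 1) <= (p u)%:R}.
  move=> sp; split=> u.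
    move=> uT hu; rewrite inE uT /= -/m -natr1.
    by have := sp u uT; rewrite ler_norml; clear - hu; lra.
  rewrite inE => /andP[uT]; rewrite -/m -natr1 => hu.
  by have := sp u uT; rewrite ler_norml; clear - hu; lra.
have Ls_top p : is_ordering T p -> {in T, forall u, `|(sigT u)%:R - (p u)%:R| <= k1 * t} ->
    {in T, forall u, 95 / 100 * m + (k1 * t + 1) <= (revo T p u)%:R -> u \in Ls} /\
    {in Ls, forall u, 95 / 100 * m - (k1 * t + 1) <= (revo T p u)%:R}.
  move=> pO sp; split=> u.
    move=> uT; rewrite revo_rk_real // => hu; rewrite inE uT /= -/m -natr1.
    by have := sp u uT; rewrite ler_norml; move: hu; rewrite -/m; clear; lra.
  rewrite inE => /andP[uT]; rewrite revo_rk_real // -/m -natr1 => hu.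
  by have := sp u uT; rewrite ler_norml; clear - hu; lra.
have D1S : D1 + 3 <= m' / 100 by clear - D1_le tS1 t1; lra.
have psi0 X u : 0 <= psi R e T X u by rewrite /psi divr_ge0.
split; first by case: ord.
pose D2 := (Num.truncn (2 * D1 + 2)).+1.
have D20 : 0 <= 2 * D1 + 2 by clear - D1_ge0; lra.
have /andP[D2_le D2_gt] := truncn_itv D20.
have D2_big (a b : nat) : (a + D2 <= b)%N -> a%:R + (2 * D1 + 2) <= b%:R.
  rewrite -(ler_nat R) natrD => h; apply: le_trans h; rewrite lerD2l ltW //.
have near p u : (p u <= sigma u + 2 * D2)%N && (sigma u <= p u + 2 * D2)%N ->
    `|(sigma u)%:R - (p u)%:R| <= (4 * k2 + 6) * t.
  rewrite -!(ler_nat R) !natrD natrM /D2 -[(Num.truncn _).+1%:R]natr1 => /andP[h1 h2].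
  rewrite ler_norml; move: h1 h2 D2_le; clear - D1_le t1; lra.
case: close => close; [left|right].
- have [Rs1 Rs2] := Rs_top (rk T) close.
  have [Ls1 Ls2] := Ls_top (rk T) rkT close.
  have fw := Fhat_forward rkS (psi0 Rs) (psi0 Ls) D1_ge0 D1S
    (inc0 Rs RsT Rs1 Rs2 dev0) (inc1 Ls LsT Ls1 Ls2 dev1).
  move=> v vS; apply: near.
  apply: (fhat_close rkS _ _ _ ord) => //.
  + by move=> x y; apply: Fhat_anti.
  + by move=> x y; apply: Fhat_le1.
  move=> x y xS yS xy; apply: fw => //; last exact: D2_big.
  by apply: (@lt_of_rk_lt _ S); move: xy; rewrite /D2; clear; lia.
have close' : {in T, forall u, `|(sigT u)%:R - (revo T (rk T) u)%:R| <= k1 * t}.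
  move=> u uT; have := close u uT; rewrite !revo_rk_real // !ler_norml; clear; lra.
have [Rs1 Rs2] := Rs_top _ close'.
have [Ls1 Ls2] := Ls_top _ (revo_ordering rkT) close'.
have {}Ls1 : {in T, forall u, 95 / 100 * m + (k1 * t + 1) <= (rk T u)%:R -> u \in Ls}.
  by move=> u uT; rewrite -{1}(revoK rkT uT); apply: Ls1.
have {}Ls2 : {in Ls, forall u, 95 / 100 * m - (k1 * t + 1) <= (rk T u)%:R}.
  by move=> u uL; rewrite -(revoK rkT (fintype.subsetP LsT _ uL)); apply: Ls2.
have bw := Fhat_backward rkS (psi0 Rs) (psi0 Ls) D1_ge0 D1S
  (inc1 Rs RsT Rs1 Rs2 dev1) (inc0 Ls LsT Ls1 Ls2 dev0).
have revS := revo_ordering rkS.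
move=> v vS; have : `|(sigma v)%:R - (revo S (rk S) v)%:R| <= (4 * k2 + 6) * t.
  apply: near; apply: (fhat_close revS _ _ _ ord) => //.
  + by move=> x y; apply: Fhat_anti.
  + by move=> x y; apply: Fhat_le1.
  move=> x y xS yS xy; rewrite Fhat_anti.
  have yx : (rk S y + D2 <= rk S x)%N.
    move: xy; rewrite /revo; have := proj2 rkS x xS; have := proj2 rkS y yS; clear; lia.
  rewrite bw ?opprK //; last exact: D2_big.
  by apply: (@lt_of_rk_lt _ S); move: yx; rewrite /D2; clear; lia.
rewrite !revo_rk_real //; last by case: ord.
by rewrite !ler_norml; clear; lra.
Qed.

(** * Aligning and merging *)

Definition oriented (R : realType) (b : bool) (x : R) : R := if b then x else 1 - x.

Lemma bigmax_le (R : realType) (I : finType) (A : {set I}) (h : I -> R) (b : R) :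
  0 <= b -> (forall i, i \in A -> h i <= b) -> \big[Num.max/0]_(i in A) h i <= b.
Proof. by move=> b0 hb; apply/bigmax_leP. Qed.

Lemma le_bigmax_in (R : realType) (I : finType) (A : {set I}) (h : I -> R) (i : I) :
  i \in A -> h i <= \big[Num.max/0]_(i in A) h i.
Proof. by move=> iA; apply: le_bigmax_cond. Qed.

Lemma alignedE (R : realType) (N : nat) (A B : {set 'I_N}) (s1 s2 : 'I_N -> nat)
    (oA oB : bool) (d : R) (i0 : 'I_N) :
  is_ordering A s1 -> d <= 1 / 16 -> #|A|%:R^-1 <= d ->
  {in A, forall i, `|((s1 i).+1)%:R / #|A|%:R - oriented oA (i%:R / N%:R)| <= d} ->
  {in B, forall i, `|((s2 i).+1)%:R / #|B|%:R - oriented oB (i%:R / N%:R)| <= d} ->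
  i0 \in A -> i0 \in B -> i0%:R / N%:R <= 1 / 4 :> R ->
  aligned R A B s1 s2 = (oA == oB).
Proof.
move=> s1O d16 dA hA hB i0A i0B x0.
have A0 : 0 < #|A|%:R :> R by rewrite ltr0n; apply/card_gt0P; exists i0.
have d0 : 0 <= d by apply: le_trans dA; rewrite invr_ge0.
have i0AB : i0 \in A :&: B by rewrite inE i0A.
have revE i : i \in A -> (#|A| - s1 i)%N%:R / #|A|%:R =
    1 - ((s1 i).+1)%:R / #|A|%:R + #|A|%:R^-1 :> R.
  move=> iA; rewrite natrB; last by apply: ltnW; apply: (proj2 s1O).
  by rewrite -natr1; field; rewrite gt_eqF.
have n0 : 0 <= #|A|%:R^-1 :> R by rewrite invr_ge0.
rewrite /aligned; case: eqP => [oE|/eqP oE].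
  apply: (@le_trans _ _ (2 * d)).
    apply: bigmax_le => [|i]; first by clear - d0; lra.
    rewrite inE => /andP[iA iB]; have := hA i iA; have := hB i iB; rewrite oE.
    by rewrite !ler_norml; clear; lra.
  apply: le_trans (le_bigmax_in _ i0AB); rewrite revE //.
  have := hA i0 i0A; have := hB i0 i0B; rewrite oE !ler_norml.
  rewrite ler_normr /oriented; case: oB {oE hB} => h1 h2.
    by apply/orP; left; move: h1 h2; clear - x0 d16 n0; lra.
  by apply/orP; right; move: h1 h2; clear - x0 d16 dA; lra.
apply/negbTE; rewrite -ltNge; apply: (@le_lt_trans _ _ (3 * d)).
  apply: bigmax_le => [|i]; first by clear - d0; lra.
  rewrite inE => /andP[iA iB]; have := hA i iA; have := hB i iB; rewrite revE //.
  rewrite !ler_norml /oriented; case: oA oB oE {hA hB} => [] [] // _.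
    by clear - n0 dA; lra.
  by clear - n0 dA; lra.
apply: lt_le_trans (le_bigmax_in _ i0AB).
have := hA i0 i0A; have := hB i0 i0B; rewrite !ler_norml.
rewrite ltr_normr /oriented; case: oA oB oE {hA hB} => [] [] // _ h1 h2.
  by apply/orP; right; move: h1 h2; clear - x0 d16; lra.
by apply/orP; left; move: h1 h2; clear - x0 d16; lra.
Qed.

(* [o = true] for the ordering by position, [o = false] for its reversal. *)
Definition close_to_rk (R : realType) (N : nat) (S : {set 'I_N}) (s : 'I_N -> nat)
    (o : bool) (D : R) : Prop :=
  {in S, forall v, `|((if o then s else revo S s) v)%:R - (rk S v)%:R| <= D}.

Lemma close_to_rk_oriented (R : realType) (N : nat) (S : {set 'I_N}) (s : 'I_N -> nat)
    (o : bool) (D t : R) : is_ordering S s -> equidistributed S t ->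
  close_to_rk S s o D ->
  {in S, forall i, `|((s i).+1)%:R / #|S|%:R - oriented o (i%:R / N%:R)| <=
     (D + t + 1) / #|S|%:R}.
Proof.
move=> sO eqS cl i iS.
have S0 : 0 < #|S|%:R :> R by rewrite ltr0n; apply/card_gt0P; exists i.
rewrite ler_pdivlMr // -{2}[#|S|%:R]ger0_norm ?(ltW S0) // -normrM mulrBl divfK ?gt_eqF //.
have := cl i iS; have := eqS i; rewrite -natr1.
rewrite /oriented; case: o cl => cl; rewrite ?revo_rk_real // !ler_norml; clear; lra.
Qed.

Lemma fix_orientation (R : realType) (N : nat) (A B : {set 'I_N}) (s1 s2 : 'I_N -> nat)
    (oA oB : bool) (D t : R) (i0 : 'I_N) :
  is_ordering A s1 -> is_ordering B s2 -> equidistributed A t -> equidistributed B t ->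
  0 <= D -> 0 <= t -> 16 * (D + t + 1) <= #|A|%:R -> 16 * (D + t + 1) <= #|B|%:R ->
  close_to_rk A s1 oA D -> close_to_rk B s2 oB D ->
  i0 \in A -> i0 \in B -> i0%:R / N%:R <= 1 / 4 :> R ->
  close_to_rk A (if aligned R A B s1 s2 then s1 else revo A s1) oB D.
Proof.
move=> s1O s2O eqA eqB D0 t0 sA sB cA cB i0A i0B x0.
have posd (n : R) : 16 * (D + t + 1) <= n -> (D + t + 1) / n <= 1 / 16.
  move=> hn; have n0 : 0 < n by apply: lt_le_trans hn; clear - D0 t0; lra.
  by rewrite ler_pdivrMr //; clear - hn; lra.
have -> : aligned R A B s1 s2 = (oA == oB).
  pose d : R := 1 / 16.
  apply: (@alignedE _ _ _ _ _ _ _ _ d i0) => //.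
  - have A0 : 0 < #|A|%:R :> R by apply: lt_le_trans sA; clear - D0 t0; lra.
    by rewrite -[_^-1]mul1r ler_pdivrMr // /d; clear - sA D0 t0; lra.
  - move=> i iA; apply: le_trans (close_to_rk_oriented s1O eqA cA iA) _; exact: posd.
  - move=> i iB; apply: le_trans (close_to_rk_oriented s2O eqB cB iB) _; exact: posd.
move=> v vA; have := cA v vA; case: oA oB {cA cB} => [] [] //=.
by rewrite revoK.
Qed.

Lemma distinf_le (R : realType) (N : nat) (sigma : 'I_N -> nat) (o : bool) (D : R) :
  0 <= D -> (forall u : 'I_N, `|(sigma u)%:R - (if o then u%:R else N%:R - 1 - u%:R)| <= D) ->
  (distinf sigma)%:R <= D.
Proof.
move=> D0 h.
pose Q := Num.truncn D.
have /andP[Q_le _] := truncn_itv D0.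
apply: le_trans Q_le; rewrite ler_nat /distinf geq_min; apply/orP.
case: o h => h; [left|right]; apply/bigmax_leqP => i _; rewrite truncn_ge_nat // adistE //.
have hi := h i; have [lt|ge] := leqP (sigma i).+1 N.
  by move: hi; rewrite natrB // -[(sigma i).+1%:R]natr1 !ler_norml; clear; lra.
have -> : (N - (sigma i).+1 = 0)%N by apply/eqP; rewrite subn_eq0 ltnW.
rewrite sub0r normrN ger0_norm //; move: hi; rewrite ler_norml => /andP[_ hi]; apply: le_trans hi.
by move: ge; rewrite ltnS -(ler_nat R) => ge; clear - ge; lra.
Qed.
Lemma good_sizes (N : nat) (P : part3 N) : good P ->
  forall S, S \in [:: P.1.1; P.1.2; P.2] -> (N <= 3 * #|S| + 2)%N /\ (3 * #|S| <= N + 3)%N.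
Proof.
move=> /and5P[_ _ _ _ /and4P[h3 h32 h21 h1]] S.
rewrite !inE => /or3P[] /eqP ->; move: h3 h32 h21 h1; clear; lia.
Qed.

Lemma good_mem (N : nat) (P : part3 N) (u : 'I_N) : good P ->
  [|| u \in P.1.1, u \in P.1.2 | u \in P.2].
Proof.
by move=> /and5P[/eqP h _ _ _ _]; have /finset.setP /(_ u) := h; rewrite !inE -orbA => ->.
Qed.

Lemma merge_close (R : realType) (N : nat) (S : {set 'I_N}) (s : 'I_N -> nat) (o : bool)
    (D t : R) (j : nat) (u : 'I_N) :
  (N <= 3 * #|S| + 2)%N -> (3 * #|S| <= N + 3)%N -> (j <= 2)%N ->
  is_ordering S s -> equidistributed S t -> close_to_rk S s o D -> u \in S ->
  `|(3 * s u + j)%N%:R - (if o then u%:R else N%:R - 1 - u%:R)| <= 3 * (D + t) + 10.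
Proof.
move=> sz1 sz2 j2 sO eqS cl uS.
have N0 : 0 < N%:R :> R by rewrite ltr0n; apply: leq_ltn_trans (ltn_ord u).
have x0 : 0 <= (u%:R / N%:R : R) <= 1.
  by rewrite divr_ge0 //= ler_pdivrMr // mul1r ler_nat ltnW.
have xE : u%:R = N%:R * (u%:R / N%:R) :> R by rewrite mulrC divfK // gt_eqF.
set x : R := u%:R / N%:R in x0 xE.
have sz1' : N%:R <= 3 * #|S|%:R + 2 :> R by rewrite -natrM -natrD ler_nat.
have sz2' : 3 * #|S|%:R <= N%:R + 3 :> R by rewrite -natrM -natrD ler_nat.
have err : `|3 * #|S|%:R * x - N%:R * x| <= 3.
  have /andP[x00 x01] := x0.
  rewrite -mulrBl normrM (ger0_norm x00) -[leRHS]mulr1; apply: ler_pM => //.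
  by rewrite ler_norml; clear - sz1' sz2'; lra.
have j2' : j%:R <= 2 :> R by rewrite ler_nat.
have j0 : 0 <= j%:R :> R by [].
have := cl u uS; have := eqS u; rewrite -/x natrD natrM xE.
move: err; rewrite !ler_norml => /andP[e1 e2] /andP[h1 h2].
case: o cl => cl; rewrite ?revo_rk_real // => /andP[h3 h4].
  by clear - e1 e2 h1 h2 h3 h4 j2' j0; lra.
by clear - e1 e2 h1 h2 h3 h4 j2' j0 sz1' sz2'; lra.
Qed.

Definition graph_ok (R : realType) (rho : R -> R) (c : R) (N : nat) (e : graph N)
    (T : {set 'I_N}) (t : R) : Prop :=
  exists (mu : R) (f : 'rV[R]_#|T|),
    [/\ fiedler_data c (profile_grid rho #|T|) mu f, sample_ok rho e f t & top_ok rho e T t].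

Definition overlap (R : realType) (N : nat) (A B : {set 'I_N}) : Prop :=
  exists i : 'I_N, [/\ i \in A, i \in B & i%:R / N%:R <= 1 / 4 :> R].

Lemma close_orP (R : realType) (N : nat) (S : {set 'I_N}) (s : 'I_N -> nat) (D : R) :
  {in S, forall v, `|(s v)%:R - (rk S v)%:R| <= D} \/
  {in S, forall v, `|(revo S s v)%:R - (rk S v)%:R| <= D} ->
  exists o, close_to_rk S s o D.
Proof. by case=> h; [exists true|exists false]. Qed.

Theorem postproc_close (R : realType) (rho : R -> R) (Lam c : R) :
  profile rho Lam -> 0 < Lam -> 0 < c <= 1 ->
  exists tau K, [/\ 0 < tau, 0 < K &
  forall (N : nat) (e : graph N) (P P' : part3 N) (t : R) (sigma : 'I_N -> nat),
  good P -> good P' -> (800 <= N)%N -> 1 <= t -> t <= tau * N%:R ->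
  (forall T, T \in [:: P.1.1; P.1.2; P.2; P'.1.1] -> graph_ok rho c e T t) ->
  (forall S, S \in [:: P.1.1; P.1.2; P.2; P'.1.1; P'.1.2] -> equidistributed S t) ->
  (forall S, S \in [:: P.1.1; P.1.2; P.2] -> overlap R S P'.1.2) ->
  postproc e P P' (5 / 100 : R) (31 / 100 : R) sigma ->
  (distinf sigma)%:R <= K * t].
Proof.
move=> rhoP Lam0 c01.
have [tau0 [K [tau00 K0 sub]]] := subroutine_close rhoP Lam0 c01.
have K64 : 0 < 64 * (K + 2) by lra.
pose tau1 := (64 * (K + 2))^-1.
have tau10 : 0 < tau1 by rewrite invr_gt0.
exists (Num.min (tau0 / 4) tau1), (3 * (K + 1) + 10); split.
- by rewrite lt_min divr_gt0.
- by clear - K0; lra.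
move=> N e P P' t sigma gP gP' N800 t1 tN gok eqd ov.
have N8 : 800 <= N%:R :> R by rewrite ler_nat.
have tN0 : t <= tau0 / 4 * N%:R by apply: le_trans tN _; rewrite ler_wpM2r // ge_min lexx.
have tN1 : t * (64 * (K + 2)) <= N%:R.
  rewrite -ler_pdivlMr // mulrC; apply: le_trans tN _.
  by rewrite ler_wpM2r // ge_min lexx orbT.
have szP := good_sizes gP. have szP' := good_sizes gP'.
have real_sz (S : {set 'I_N}) : (N <= 3 * #|S| + 2)%N /\ (3 * #|S| <= N + 3)%N ->
    N%:R / 4 <= #|S|%:R :> R /\ 3 * #|S|%:R <= N%:R + 3 :> R.
  move=> [h1 h2]; rewrite -(ler_nat R) natrD natrM in h1; rewrite -(ler_nat R) natrD natrM in h2.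
  by split=> //; clear - h1 N8; lra.
have run (T S : {set 'I_N}) s : graph_ok rho c e T t -> [disjoint T & S] ->
    (N <= 3 * #|T| + 2)%N /\ (3 * #|T| <= N + 3)%N ->
    (N <= 3 * #|S| + 2)%N /\ (3 * #|S| <= N + 3)%N ->
    equidistributed T t -> equidistributed S t ->
    subroutine e T S (5 / 100 : R) (31 / 100 : R) s ->
    is_ordering S s /\ exists o, close_to_rk S s o (K * t).
  move=> [mu [f [fd sok tok]]] TS /real_sz [T1 T2] /real_sz [S1 S2] eT eS sb.
  have [||||sO cl] := sub N e T S t mu f s TS _ _ fd t1 _ _ eT eS sok tok sb.
  - by clear - T1 S2 N8; lra.
  - by clear - T1 N8; lra.
  - apply: le_trans tN0 _; rewrite mulrAC -mulrA ler_wpM2l ?(ltW tau00) //.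
  - apply: le_trans tN0 _; rewrite mulrAC -mulrA ler_wpM2l ?(ltW tau00) //.
  by split=> //; apply: close_orP.
have [_ d12 d13 d23 _] := and5P gP.
have [_ d12' _ _ _] := and5P gP'.
case=> s1 [s2 [s3 [sref [r1 r2 r3 rref fin]]]].
have iS1 : P.1.1 \in [:: P.1.1; P.1.2; P.2] by rewrite !inE eqxx.
have iS2 : P.1.2 \in [:: P.1.1; P.1.2; P.2] by rewrite !inE eqxx orbT.
have iS3 : P.2 \in [:: P.1.1; P.1.2; P.2] by rewrite !inE eqxx !orbT.
have iS1' : P'.1.1 \in [:: P'.1.1; P'.1.2; P'.2] by rewrite !inE eqxx.
have iS2' : P'.1.2 \in [:: P'.1.1; P'.1.2; P'.2] by rewrite !inE eqxx orbT.
have e1 : equidistributed P.1.1 t by apply: eqd; rewrite !inE eqxx.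
have e2 : equidistributed P.1.2 t by apply: eqd; rewrite !inE eqxx ?orbT.
have e3 : equidistributed P.2 t by apply: eqd; rewrite !inE eqxx ?orbT.
have e1' : equidistributed P'.1.1 t by apply: eqd; rewrite !inE eqxx ?orbT.
have e2' : equidistributed P'.1.2 t by apply: eqd; rewrite !inE eqxx ?orbT.
have [so1 [w1 c1]] : is_ordering P.1.1 s1 /\ exists o, close_to_rk P.1.1 s1 o (K * t).
  apply: (run P.2 P.1.1) => //; [|by rewrite disjoint_sym|exact: szP|exact: szP].
  by apply: gok; rewrite !inE eqxx ?orbT.
have [so2 [w2 c2]] : is_ordering P.1.2 s2 /\ exists o, close_to_rk P.1.2 s2 o (K * t).
  apply: (run P.1.1 P.1.2) => //; [|exact: szP|exact: szP].
  by apply: gok; rewrite !inE eqxx ?orbT.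
have [so3 [w3 c3]] : is_ordering P.2 s3 /\ exists o, close_to_rk P.2 s3 o (K * t).
  apply: (run P.1.2 P.2) => //; [|exact: szP|exact: szP].
  by apply: gok; rewrite !inE eqxx ?orbT.
have [soref [w cref]] : is_ordering P'.1.2 sref /\ exists o, close_to_rk P'.1.2 sref o (K * t).
  apply: (run P'.1.1 P'.1.2) => //; [|exact: szP'|exact: szP'].
  by apply: gok; rewrite !inE eqxx ?orbT.
have Kt0 : 0 <= K * t by rewrite mulr_ge0 ?(ltW K0) //; clear - t1; lra.
have t0 : 0 <= t by clear - t1; lra.
have big (S : {set 'I_N}) : (N <= 3 * #|S| + 2)%N /\ (3 * #|S| <= N + 3)%N ->
    16 * (K * t + t + 1) <= #|S|%:R.
  by move=> /real_sz [S1 _]; clear - S1 tN1 t1 Kt0; lra.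
have fixed S s os : S \in [:: P.1.1; P.1.2; P.2] -> is_ordering S s ->
    equidistributed S t -> close_to_rk S s os (K * t) ->
    close_to_rk S (if aligned R S P'.1.2 s sref then s else revo S s) w (K * t).
  move=> iS sO eS cS; have [i [iA iB ix]] := ov S iS.
  apply: (fix_orientation sO soref eS e2' Kt0 t0 _ _ cS cref iA iB ix).
    by apply: big; apply: szP.
  by apply: big; apply: szP'.
have fixO S s : is_ordering S s ->
    is_ordering S (if aligned R S P'.1.2 s sref then s else revo S s).
  by move=> sO; case: ifP => // _; apply: revo_ordering.
have Kt10 : 3 * (K * t + t) + 10 <= (3 * (K + 1) + 10) * t by clear - t1; lra.
apply: (@distinf_le _ _ _ w).
  by rewrite mulr_ge0 //; clear - K0; lra.
move=> u; apply: le_trans Kt10; rewrite fin /merged.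
case: ifP => u1.
  have [z1 z2] := szP _ iS1.
  rewrite -[(3 * _)%N]addn0.
  exact: (merge_close z1 z2 _ (fixO _ _ so1) e1 (fixed _ _ _ iS1 so1 e1 c1) u1).
case: ifP => u2.
  have [z1 z2] := szP _ iS2.
  exact: (merge_close z1 z2 _ (fixO _ _ so2) e2 (fixed _ _ _ iS2 so2 e2 c2) u2).
have [z1 z2] := szP _ iS3.
have u3 : u \in P.2 by have := good_mem u gP; rewrite u1 u2.
exact: (merge_close z1 z2 _ (fixO _ _ so3) e3 (fixed _ _ _ iS3 so3 e3 c3) u3).
Qed.

(** * Concentration *)

Lemma expR_quadratic (R : realType) (x : R) : x <= 2^-1 -> expR x <= 1 + x + 2 * x ^+ 2.
Proof.
move=> x2; have h0 : 0 < 1 - x by lra.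
have h1 : 1 - x <= expR (- x) by exact: expR_ge1Dx.
rewrite -[x in expR x]opprK expRN -[leLHS]mul1r ler_pdivrMr ?expR_gt0 //.
have h2 : 0 <= 1 + x + 2 * x ^+ 2 by have := sqr_ge0 (x + 1); rewrite !expr2; nra.
apply: le_trans (ler_wpM2l h2 h1).
have := sqr_ge0 x; rewrite expr2; nra.
Qed.

Section ProductMeasure.
Variables (R : realType) (I K : finType) (q : I -> K -> R).
Hypotheses (q_ge0 : forall i b, 0 <= q i b) (q_sum : forall i, \sum_b q i b = 1).

Definition weight (e : {ffun I -> K}) : R := \prod_i q i (e i).

Lemma weight_ge0 e : 0 <= weight e.
Proof. by apply: prodr_ge0 => i _; apply: q_ge0. Qed.

Lemma expect_prod (h : I -> K -> R) :
  \sum_e weight e * \prod_i h i (e i) = \prod_i \sum_b q i b * h i b.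
Proof.
rewrite bigA_distr_bigA; apply: eq_bigr => e _.
by rewrite -big_split.
Qed.

Lemma weight_total : \sum_e weight e = 1.
Proof.
transitivity (\sum_e weight e * \prod_(i : I) 1).
  by apply: eq_bigr => e _; rewrite big1_eq mulr1.
rewrite (expect_prod (fun _ _ => 1)); apply: big1 => i _.
by rewrite -[RHS](q_sum i); apply: eq_bigr => b _; rewrite mulr1.
Qed.

Definition mix (B : {set I}) (e e' : {ffun I -> K}) : {ffun I -> K} :=
  [ffun i => if i \in B then e' i else e i].

(* Resampling the coordinates in [B] leaves the law unchanged: the swap
   [(e, e') -> (mix B e e', mix B e' e)] is an involution preserving the product weight. *)
Lemma resample (B : {set I}) (F : {ffun I -> K} -> R) :
  \sum_e weight e * F e = \sum_e \sum_e' weight e * weight e' * F (mix B e e').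
Proof.
pose swap (p : {ffun I -> K} * {ffun I -> K}) := (mix B p.1 p.2, mix B p.2 p.1).
have swapK : involutive swap.
  by case=> e e'; rewrite /swap /=; congr pair; apply/ffunP => i; rewrite !ffunE; case: (i \in B).
transitivity (\sum_(p : {ffun I -> K} * {ffun I -> K}) weight p.1 * weight p.2 * F p.1).
  rewrite -(pair_bigA _ (fun e e' => weight e * weight e' * F e)) /=.
  apply: eq_bigr => e _; rewrite -mulr_suml -mulr_sumr weight_total mulr1 //.
rewrite (pair_bigA _ (fun e e' => weight e * weight e' * F (mix B e e'))) /=.
rewrite (reindex_inj (inv_inj swapK)) /=; apply: eq_bigr => -[e e'] _ /=.
congr (_ * _); rewrite /weight -!big_split /=; apply: eq_bigr => i _.
by rewrite !ffunE; case: ifP => // _; rewrite mulrC.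
Qed.

Definition prob (A : {ffun I -> K} -> bool) : R := \sum_(e | A e) weight e.

Lemma prob_le (A A' : {ffun I -> K} -> bool) : (forall e, A e -> A' e) -> prob A <= prob A'.
Proof.
move=> AA'; rewrite /prob [leLHS]big_mkcond [leRHS]big_mkcond; apply: ler_sum => e _.
by case: ifP => [/AA' ->|_] //; case: ifP => // _; apply: weight_ge0.
Qed.

Lemma prob_or (A A' : {ffun I -> K} -> bool) :
  prob (fun e => A e || A' e) <= prob A + prob A'.
Proof.
rewrite /prob [leLHS]big_mkcond [X in _ <= X + _]big_mkcond [X in _ <= _ + X]big_mkcond.
rewrite -big_split; apply: ler_sum => e _ /=; have w0 := weight_ge0 e.
by case: (A e); case: (A' e); rewrite /= ?addr0 ?add0r // lerDl.
Qed.

Lemma prob_exists (J : finType) (A : J -> {ffun I -> K} -> bool) (b : R) :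
  (forall j, prob (A j) <= b) -> prob (fun e => [exists j, A j e]) <= #|J|%:R * b.
Proof.
move=> hA; rewrite mulr_natl -sumr_const; apply: le_trans (ler_sum _ (fun j _ => hA j)).
rewrite [leRHS](eq_bigr (fun j => \sum_e if A j e then weight e else 0)); last first.
  by move=> j _; rewrite /prob big_mkcond.
rewrite exchange_big /prob [leLHS]big_mkcond; apply: ler_sum => e _ /=; have w0 := weight_ge0 e.
case: existsP => [[j Aj]|_]; last by apply: sumr_ge0 => j _; case: ifP.
by rewrite (bigD1 j) //= Aj lerDl; apply: sumr_ge0 => k _; case: ifP.
Qed.

Lemma prob_compl (A : {ffun I -> K} -> bool) : prob A = 1 - prob (fun e => ~~ A e).
Proof. by rewrite -weight_total (bigID A) /= addrK. Qed.

Lemma mgf_centered (i : I) (X : K -> R) (y : R) : (forall b, `|X b| <= 1) ->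
  \sum_b q i b * X b = 0 -> `|y| <= 2^-1 ->
  \sum_b q i b * expR (y * X b) <= expR (2 * y ^+ 2).
Proof.
move=> X1 X0 y2; apply: le_trans (expR_ge1Dx _).
apply: le_trans (_ : \sum_b (q i b + y * (q i b * X b) + q i b * (2 * y ^+ 2)) <= _); last first.
  by rewrite !big_split /= -mulr_sumr X0 mulr0 addr0 -mulr_suml q_sum mul1r.
apply: ler_sum => b _.
have yX : `|y * X b| <= 2^-1 by rewrite normrM -[leRHS]mulr1 ler_pM.
have /expR_quadratic h : y * X b <= 2^-1 by apply: le_trans (ler_norm _) yX.
apply: le_trans (ler_wpM2l (q_ge0 i b) h) _.
have : (y * X b) ^+ 2 <= y ^+ 2.
  rewrite exprMn -[leRHS]mulr1 ler_wpM2l ?sqr_ge0 //.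
  by rewrite -(real_normK (num_real (X b))) expr_le1.
move=> h2; have := ler_wpM2l (q_ge0 i b) h2; lra.
Qed.

Variables (B : {set I}) (n : nat) (c : I -> {ffun I -> K} -> R) (X : I -> K -> R).
Hypotheses (B_le : (#|B| <= n)%N) (n_gt0 : (0 < n)%N)
  (c1 : forall i e, `|c i e| <= 1)
  (c_inv : forall i (e e' : {ffun I -> K}), i \in B -> (forall j, j \notin B -> e j = e' j) -> c i e = c i e')
  (X1 : forall i b, `|X i b| <= 1)
  (X0 : forall i, i \in B -> \sum_b q i b * X i b = 0).

Let S e := \sum_(i in B) c i e * X i (e i).

Lemma mgf_sum (s : R) : `|s| <= 2^-1 ->
  \sum_e weight e * expR (s * S e) <= expR (2 * s ^+ 2 * n%:R).
Proof.
move=> s2; rewrite (resample B).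
have inner e : \sum_e' weight e * weight e' * expR (s * S (mix B e e')) <=
    weight e * expR (2 * s ^+ 2 * n%:R).
  under eq_bigr do rewrite -mulrA.
  rewrite -mulr_sumr ler_wpM2l ?weight_ge0 //.
  pose h i b := if i \in B then expR (s * c i e * X i b) else 1.
  have E e' : expR (s * S (mix B e e')) = \prod_i h i (e' i).
    rewrite /S mulr_sumr expR_sum big_mkcond /=; apply: eq_bigr => i _; rewrite /h.
    have [iB|//] := boolP (i \in B); rewrite ffunE iB mulrA (c_inv (e' := e) iB) // => j.
    by move=> /negbTE jB; rewrite ffunE jB.
  under eq_bigr do rewrite E.
  rewrite expect_prod.
  apply: le_trans (_ : \prod_(i in B) expR (2 * s ^+ 2) <= _); last first.
    rewrite prodr_const -expRM_natl ler_expR [leLHS]mulrC.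
    have Bn : #|B|%:R <= n%:R :> R by rewrite ler_nat.
    by apply: ler_wpM2l => //; rewrite mulr_ge0 ?sqr_ge0.
  rewrite [leRHS]big_mkcond /=; apply: ler_prod => i _; apply/andP; split.
    by apply: sumr_ge0 => b _; rewrite mulr_ge0 // /h; case: ifP => // _; apply: expR_ge0.
  rewrite /h; case: ifP => iB; last by under eq_bigr do rewrite mulr1; rewrite q_sum.
  apply: le_trans (mgf_centered (X1 i) (X0 iB) _) _.
    by rewrite normrM -[leRHS]mulr1 ler_pM.
  rewrite ler_expR ler_pM2l // exprMn -[leRHS]mulr1 ler_wpM2l ?sqr_ge0 //.
  by rewrite -(real_normK (num_real (c i e))) expr_le1.
apply: le_trans (ler_sum _ (fun e _ => inner e)) _.
by rewrite -mulr_suml weight_total mul1r.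
Qed.

Lemma tail_bound (t : R) : 0 <= t -> t <= 2 * n%:R ->
  prob (fun e => t < `|S e|) <= 2 * expR (- (t ^+ 2 / (8 * n%:R))).
Proof.
move=> t0 t2n; have n0 : 0 < n%:R :> R by rewrite ltr0n.
pose s := t / (4 * n%:R).
have s0 : 0 <= s by rewrite divr_ge0 // mulr_ge0 // ltW.
have s2 : s <= 2^-1 by rewrite /s ler_pdivrMr ?mulr_gt0 //; lra.
have ns : `|s| <= 2^-1 by rewrite ger0_norm.
have ns' : `|- s| <= 2^-1 by rewrite normrN.
have markov (r : R) : `|r| <= 2^-1 -> r ^+ 2 = s ^+ 2 ->
    prob (fun e => s * t <= r * S e) <= expR (- (t ^+ 2 / (8 * n%:R))).
  move=> nr r2; apply: le_trans (_ : expR (- (s * t)) * \sum_e weight e * expR (r * S e) <= _).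
    rewrite mulr_sumr /prob big_mkcond; apply: ler_sum => e _.
    rewrite mulrCA -expRD; case: ifP => [h|_]; last by rewrite mulr_ge0 ?weight_ge0 ?expR_ge0.
    rewrite -[leLHS]mulr1 ler_wpM2l ?weight_ge0 // -[leLHS]expR0 ler_expR.
    by lra.
  apply: le_trans (ler_wpM2l (expR_ge0 _) (mgf_sum nr)) _.
  rewrite -expRD ler_expR r2 /s; apply: le_of_eq; field.
  by rewrite gt_eqF.
apply: le_trans (prob_le (A' := fun e => (s * t <= s * S e) || (s * t <= - s * S e)) _) _.
  move=> e /ltW; rewrite ler_normr => /orP [h|h]; apply/orP; [left|right].
    by rewrite ler_wpM2l.
  by rewrite mulNr -mulrN ler_wpM2l.
apply: le_trans (prob_or _ _) _.
have := markov s ns erefl; have := markov (- s) ns' (sqrrN s).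
move: (expR _) => E; lra.
Qed.

End ProductMeasure.

Section EdgeMeasure.
Variables (R : realType) (rho : R -> R) (Lam : R) (N : nat).
Hypothesis rhoP : profile rho Lam.

Let I := ('I_N * 'I_N)%type.

Definition edge_weight (p : 'I_N * 'I_N) (b : bool) : R :=
  if (p.1 < p.2)%N then
    (if b then wfun rho (vpos R p.1) (vpos R p.2) else 1 - wfun rho (vpos R p.1) (vpos R p.2))
  else (if b then 0 else 1).

Lemma wfun_wgt (u v : 'I_N) : u != v -> wfun rho (vpos R u) (vpos R v) = wgt rho u v.
Proof.
move=> uv; rewrite /wfun /vpos /wgt (negbTE uv) -mulrBl -!natr1 normrM.
by rewrite [`|N%:R^-1|]ger0_norm ?invr_ge0 // opprD addrACA subrr addr0.
Qed.

Lemma edge_weight_ge0 p b : 0 <= edge_weight p b.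
Proof.
rewrite /edge_weight; case: ltnP => [h|_]; last by case: b; rewrite ?ler01.
rewrite wfun_wgt; last by apply: contraTneq h => ->; rewrite ltnn.
by have /andP[h1 h2] := wgt01 rhoP p.1 p.2; case: b; rewrite ?subr_ge0.
Qed.

Lemma edge_weight_sum p : \sum_b edge_weight p b = 1.
Proof.
rewrite big_bool /edge_weight /=; case: ifP => _; last by rewrite add0r.
by rewrite addrC subrK.
Qed.

Definition edge_pair (u v : 'I_N) : 'I_N * 'I_N := if (u < v)%N then (u, v) else (v, u).

Definition edge_dev (p : 'I_N * 'I_N) (b : bool) : R :=
  b%:R - (if (p.1 < p.2)%N then wgt rho p.1 p.2 else 0).

Lemma dev_edge_pair (e : graph N) (u v : 'I_N) : u != v ->
  dev rho e u v = edge_dev (edge_pair u v) (e (edge_pair u v)).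
Proof.
move=> uv; rewrite /dev /edge_dev /edge_pair /adj; case: (ltngtP u v) => h /=.
- by rewrite h.
- by rewrite h wgtC.
by move/ord_inj: h uv => ->; rewrite eqxx.
Qed.

Lemma edge_dev_le1 p b : `|edge_dev p b| <= 1.
Proof.
rewrite /edge_dev; case: ifP => _; last by rewrite subr0; case: b; rewrite ?normr1 ?normr0 ?ler01.
by have /andP[h1 h2] := wgt01 rhoP p.1 p.2; rewrite ler_norml; case: b => /=; lra.
Qed.

Lemma edge_dev_mean p : \sum_b edge_weight p b * edge_dev p b = 0.
Proof.
rewrite big_bool /edge_weight /edge_dev /=; case: ifP => [h|_]; last by rewrite /=; ring.
rewrite wfun_wgt; last by apply: contraTneq h => ->; rewrite ltnn.
by rewrite /=; ring.
Qed.

Lemma dev_diag (e : graph N) (u : 'I_N) : dev rho e u u = 0.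
Proof. by rewrite /dev adj_refl /wgt eqxx subrr. Qed.

Lemma edge_pair_meet (u v w x : 'I_N) :
  edge_pair v w = edge_pair u x -> (u == v) || (u == w).
Proof.
rewrite /edge_pair; case: ltnP => _; case: ltnP => _ [] E1 E2; rewrite -?E1 -?E2 ?E1 ?E2 ?eqxx ?orbT //.
Qed.

Definition edge_other (u : 'I_N) (p : 'I_N * 'I_N) : 'I_N := if p.1 == u then p.2 else p.1.

Lemma edge_otherK (u v : 'I_N) : edge_other u (edge_pair u v) = v.
Proof.
rewrite /edge_other /edge_pair; case: ltnP => uv /=; first by rewrite eqxx.
by case: eqP => // ->.
Qed.

Lemma edge_pair_inj (u : 'I_N) : injective (edge_pair u).
Proof. exact: can_inj (@edge_otherK u). Qed.

Lemma linear_tail (u : 'I_N) (A : {set 'I_N}) (h : 'I_N -> graph N -> R) (t : R) :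
  (0 < N)%N -> 0 <= t -> t <= 2 * N%:R ->
  (forall v e, `|h v e| <= 1) ->
  (forall v (e e' : graph N), v != u ->
     (forall p, (forall w, p != edge_pair u w) -> e p = e' p) -> h v e = h v e') ->
  prob edge_weight (fun e => t < `|\sum_(v in A) h v e * dev rho e u v|) <=
  2 * expR (- (t ^+ 2 / (8 * N%:R))).
Proof.
move=> N0 t0 t2 h1 hinv.
pose B := [set edge_pair u v | v in A :\ u].
have E e : \sum_(v in A) h v e * dev rho e u v =
    \sum_(p in B) h (edge_other u p) e * edge_dev p (e p).
  rewrite big_imset /=; last by move=> v w _ _; apply: edge_pair_inj.
  rewrite (bigID (pred1 u)) /= big1 ?add0r => [|v /andP[_ /eqP ->]]; last first.
    by rewrite dev_diag mulr0.
  apply: eq_big => [v|v /andP[_ vu]]; first by rewrite !inE andbC.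
  by rewrite edge_otherK dev_edge_pair // eq_sym.
have EP e : (t < `|\sum_(v in A) h v e * dev rho e u v|) =
  (t < `|\sum_(p in B) h (edge_other u p) e * edge_dev p (e p)|) by rewrite E.
rewrite (_ : (fun e => _) = (fun e : graph N =>
  t < `|\sum_(p in B) h (edge_other u p) e * edge_dev p (e p)|)); last exact/funext.
apply: (@tail_bound R I bool edge_weight edge_weight_ge0 edge_weight_sum B N
   (fun p e => h (edge_other u p) e) edge_dev) => //.
- apply: leq_trans (leq_imset_card _ _) _.
  by apply: leq_trans (max_card _) _; rewrite card_ord.
- move=> p e e' /imsetP[v]; rewrite !inE => /andP[vu _] -> ee'.
  rewrite edge_otherK; apply: hinv => // p' hp'; apply: ee'.
  by apply/imsetP => -[w _ E']; move: (hp' w); rewrite E' eqxx.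
- exact: edge_dev_le1.
- by move=> p _; exact: edge_dev_mean.
Qed.

Theorem graph_ok_prob (c t mu : R) (T : {set 'I_N}) (f : 'rV[R]_#|T|) :
  (0 < N)%N -> 0 <= t -> t <= 2 * N%:R ->
  fiedler_data c (profile_grid rho #|T|) mu f ->
  prob edge_weight (fun e => ~~ `[< graph_ok rho c e T t >]) <=
  10 * N%:R ^+ 2 * expR (- (t ^+ 2 / (8 * N%:R))).
Proof.
move=> N0 t0 t2 fd.
have fin (x y : R) : x <= y -> x + (x + (x + (x + y))) <= 5 * y by lra.
set b : R := 2 * expR (- (t ^+ 2 / (8 * N%:R))).
pose fT (v : 'I_N) : R := if [pick j : 'I_#|T| | enum_val j == v] is Some j then f 0 j else 0.
have fT_val j : fT (enum_val j) = f 0 j.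
  rewrite /fT; case: pickP => [k /eqP /enum_val_inj -> //|/(_ j)]; by rewrite eqxx.
have fT1 v : `|fT v| <= 1.
  rewrite /fT; case: pickP => [k _|_]; first exact: (fiedler_le1 fd).
  by rewrite normr0 ler01.
pose top1 := [set u in T | 95 / 100 * #|T|%:R <= (rk T u)%:R :> R].
pose top2 := [set u in T | 95 / 100 * #|T|%:R <= (revo T (rk T) u)%:R :> R].
pose lin (A : {set 'I_N}) (h : 'I_N -> R) u (e : graph N) :=
  t < `|\sum_(v in A) h v * dev rho e u v|.
pose bad1 e := [exists u, lin T (fun=> 1) u e].
pose bad2 e := [exists u, lin T fT u e].
pose bad3 e := [exists u, lin top1 (fun=> 1) u e].
pose bad4 e := [exists u, lin top2 (fun=> 1) u e].
pose sq (p : 'I_N * 'I_N) (e : graph N) := (p.1 != p.2) &&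
  (t < `|\sum_(v in T) dev rho e v p.2 * dev rho e p.1 v|).
pose bad5 e := [exists p, sq p e].
have lin_b A h u : (forall v, `|h v| <= 1) -> prob edge_weight (lin A h u) <= b.
  by move=> h1; apply: (@linear_tail u A (fun v _ => h v)).
have exb A h : (forall v, `|h v| <= 1) ->
    prob edge_weight (fun e => [exists u, lin A h u e]) <= N%:R * b.
  move=> h1; rewrite -[N in N%:R](card_ord N).
  by apply: (prob_exists edge_weight_ge0) => u; apply: lin_b.
have one1 (v : 'I_N) : `|1| <= 1 :> R by rewrite normr1.
have b0 : 0 <= b by rewrite mulr_ge0 // expR_ge0.
have sq_b p : prob edge_weight (sq p) <= b.
  rewrite /sq; have [E|p12] /= := eqVneq p.1 p.2.
    by rewrite /prob big_pred0.
  apply: (@linear_tail p.1 T (fun v e => dev rho e v p.2)) => //.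
    by move=> v e; exact: (dev_le1 rhoP).
  move=> v e e' vp ee'; have [->|vp2] := eqVneq v p.2; first by rewrite !dev_diag.
  rewrite !dev_edge_pair // ee' // => w; apply/eqP => /edge_pair_meet.
  by rewrite eq_sym (negbTE vp) (negbTE p12).
have bad5_b : prob edge_weight bad5 <= N%:R ^+ 2 * b.
  have -> : N%:R ^+ 2 = #|{: 'I_N * 'I_N}|%:R :> R by rewrite card_prod card_ord natrM expr2.
  exact: (prob_exists edge_weight_ge0).
have sum_enum (G : 'I_N -> R) : \sum_(j < #|T|) G (enum_val j) = \sum_(v in T) G v.
  by rewrite [RHS]big_enum_val.
apply: le_trans (prob_le edge_weight_ge0 (A' := fun e => bad1 e || (bad2 e || (bad3 e || (bad4 e || bad5 e)))) _) _.
  move=> e; apply: contraNT; rewrite !negb_or => /and5P[n1 n2 n3 n4 n5].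
  have use A h : ~~ [exists u, lin A h u e] -> forall u, `|\sum_(v in A) h v * dev rho e u v| <= t.
    by rewrite negb_exists => /forallP H u; have := H u; rewrite /lin -leNgt.
  apply/asboolP; exists mu, f; split => //; split.
  - move=> u; rewrite (sum_enum (fun v => dev rho e u v)).
    have := use _ _ n1 u; rewrite (eq_bigr (fun v => dev rho e u v)) => [//|v _].
    by rewrite mul1r.
  - move=> u; under eq_bigr do rewrite -fT_val mulrC.
    by rewrite (sum_enum (fun v => fT v * dev rho e u v)); apply: use.
  - move=> u v uv; rewrite (sum_enum (fun w => dev rho e u w * dev rho e w v)).
    move: n5; rewrite negb_exists => /forallP /(_ (u, v)); rewrite /sq /= uv /= -leNgt.
    rewrite (eq_bigr (fun w => dev rho e u w * dev rho e w v)) => [//|w _].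
    by rewrite mulrC.
  - move=> v; have := use _ _ n3 v.
    rewrite (eq_big (fun u => (u \in T) && (95 / 100 * #|T|%:R <= (rk T u)%:R :> R))
      (fun u => dev rho e u v)) => [//|u|u _]; first by rewrite inE.
    by rewrite mul1r devC.
  - move=> v; have := use _ _ n4 v.
    rewrite (eq_big (fun u => (u \in T) && (95 / 100 * #|T|%:R <= (revo T (rk T) u)%:R :> R))
      (fun u => dev rho e u v)) => [//|u|u _]; first by rewrite inE.
    by rewrite mul1r devC.
have h1 := exb T (fun=> 1) one1; have h2 := exb T fT fT1.
have h3 := exb top1 (fun=> 1) one1; have h4 := exb top2 (fun=> 1) one1.
apply: le_trans (_ : N%:R * b + (N%:R * b + (N%:R * b + (N%:R * b + N%:R ^+ 2 * b))) <= _).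
  by do 4 (apply: le_trans (prob_or edge_weight_ge0 _ _) _; apply: lerD => //).
have N1 : 1 <= N%:R :> R by rewrite ler1n.
apply: le_trans (fin _ _ _) _; first by rewrite ler_wpM2r // expr2 ler_peMl.
by apply: le_of_eq; rewrite /b; ring.
Qed.

End EdgeMeasure.

(** * Random good partitions *)

Lemma fact_pow_le (n x : nat) : (n`! * n.+1 ^ x <= x`! * n.+1 ^ n)%N.
Proof.
have up k : (n`! * n.+1 ^ (n + k) <= (n + k)`! * n.+1 ^ n)%N.
  elim: k => [|k IH]; first by rewrite addn0.
  rewrite addnS factS expnS mulnCA -mulnA leq_mul //.
  by rewrite ltnS leq_addr.
have down k : (k <= n)%N -> (n`! * n.+1 ^ (n - k) <= (n - k)`! * n.+1 ^ n)%N.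
  elim: k => [|k IH] kn; first by rewrite subn0.
  have := IH (ltnW kn); have -> : (n - k = (n - k.+1).+1)%N by move: kn; clear; lia.
  set y := (n - k.+1)%N; rewrite factS expnS mulnCA => h.
  rewrite -(leq_pmul2l (ltn0Sn n)); apply: leq_trans h _.
  by rewrite -mulnA leq_mul // ltnS /y leq_subr.
case: (leqP n x) => nx; first by rewrite -(subnKC nx).
by rewrite -(subKn (ltnW nx)); apply: down; rewrite leq_subr.
Qed.

Section Partitions.
Variable N : nat.

Definition disjoint_pairs (a b : nat) : {set {set 'I_N} * {set 'I_N}} :=
  [set p : {set 'I_N} * {set 'I_N} | [&& #|p.1| == a, p.2 \subset ~: p.1 & #|p.2| == b]].

Lemma card_disjoint_pairs a b : #|disjoint_pairs a b| = ('C(N, a) * 'C(N - a, b))%N.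
Proof.
rewrite -sum1_card.
rewrite (eq_bigl (fun p : {set 'I_N} * {set 'I_N} => (#|p.1| == a) &&
  ((p.2 \subset ~: p.1) && (#|p.2| == b)))); last by move=> p; rewrite inE.
rewrite -(pair_big_dep (fun A : {set 'I_N} => #|A| == a)
  (fun A B : {set 'I_N} => (B \subset ~: A) && (#|B| == b)) (fun _ _ => 1%N)) /=.
rewrite (eq_bigr (fun=> 'C(N - a, b))) => [|A /eqP Aa].
  by rewrite sum_nat_const -cardsE card_draws card_ord.
rewrite sum1_card -cardsE (cards_draws (~: A) b); congr 'C(_, _).
by rewrite cardsCs finset.setCK card_ord Aa.
Qed.

Lemma card_disjoint_pairs_fact a b : (a + b <= N)%N ->
  (#|disjoint_pairs a b| * (a`! * b`! * (N - a - b)`!) = N`!)%N.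
Proof.
move=> abN; rewrite card_disjoint_pairs -(@bin_fact N a); last by move: abN; clear; lia.
rewrite -(@bin_fact (N - a) b); last by move: abN; clear; lia.
clear; ring.
Qed.

Lemma card_disjoint_pairs_le_ngood a b : (#|disjoint_pairs a b| <= ngood N)%N.
Proof.
have [abN|abN] := leqP (a + b) N; last first.
  rewrite card_disjoint_pairs; have [aN|aN] := leqP a N; last by rewrite bin_small.
  by rewrite [X in (_ * X)%N]bin_small ?muln0 //; move: abN aN; clear; lia.
pose n := (N %/ 3)%N.
pose n1 := if (N %% 3 == 0)%N then n else n.+1.
pose n2 := if (N %% 3 == 2)%N then n.+1 else n.
have nE : (N = 3 * n + N %% 3)%N by rewrite /n mulnC -divn_eq.
have r3 : (N %% 3 < 3)%N by rewrite ltn_mod.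
have bal : (n1`! * n2`! * (N - n1 - n2)`! = n`! ^ 3 * n.+1 ^ (N %% 3))%N.
  rewrite /n1 /n2; case E : (N %% 3)%N nE r3 => [|[|[|//]]] nE _ /=.
  - have -> : (N - n - n = n)%N by move: nE; clear; lia.
    by rewrite expn0; ring.
  - have -> : (N - n.+1 - n = n)%N by move: nE; clear; lia.
    by rewrite factS expn1; ring.
  - have -> : (N - n.+1 - n.+1 = n)%N by move: nE; clear; lia.
    by rewrite factS; ring.
have n12 : (n1 + n2 <= N)%N.
  by rewrite /n1 /n2; move: nE r3; case: (N %% 3)%N => [|[|[|//]]] /=; clear; lia.
have min_fact : (n1`! * n2`! * (N - n1 - n2)`! <= a`! * b`! * (N - a - b)`!)%N.
  rewrite bal -(@leq_pmul2r (n.+1 ^ (3 * n))) ?expn_gt0 //.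
  have -> : (n`! ^ 3 * n.+1 ^ (N %% 3) * n.+1 ^ (3 * n) =
      (n`! * n.+1 ^ a) * (n`! * n.+1 ^ b) * (n`! * n.+1 ^ (N - a - b)))%N.
    rewrite -mulnA -expnD [(_ + 3 * n)%N]addnC -nE.
    have -> : N = (a + b + (N - a - b))%N by move: abN; clear; lia.
    rewrite !expnD.
    have -> : (a + b + (N - a - b) - a - b = N - a - b)%N by clear; lia.
    ring.
  have -> : (a`! * b`! * (N - a - b)`! * n.+1 ^ (3 * n) =
      (a`! * n.+1 ^ n) * (b`! * n.+1 ^ n) * ((N - a - b)`! * n.+1 ^ n))%N.
    rewrite [(3 * n)%N]mulnC expnM; ring.
  by apply: leq_mul; [apply: leq_mul|]; apply: fact_pow_le.
have : (#|disjoint_pairs a b| <= #|disjoint_pairs n1 n2|)%N.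
  rewrite -(@leq_pmul2r (n1`! * n2`! * (N - n1 - n2)`!)) ?muln_gt0 ?fact_gt0 //.
  rewrite card_disjoint_pairs_fact // -(card_disjoint_pairs_fact abN).
  by rewrite leq_mul2l min_fact orbT.
move/leq_trans; apply.
pose g (p : {set 'I_N} * {set 'I_N}) : part3 N := (p.1, p.2, ~: (p.1 :|: p.2)).
rewrite /ngood -(card_imset _ (_ : injective g)); last by case=> A B [A' B'] [-> ->].
apply: subset_leq_card; apply/fintype.subsetP => P /imsetP[[A B]].
rewrite !inE /= => /and3P[/eqP Aa BA /eqP Bb] ->.
have cardC : #|~: (A :|: B)| = (N - n1 - n2)%N.
  rewrite cardsCs finset.setCK card_ord cardsU disjoint_setI0 ?cards0; last by rewrite disjoint_sym finset.disjoints_subset.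
  by rewrite Aa Bb; clear; lia.
have dAB : [disjoint A & B] by rewrite disjoint_sym finset.disjoints_subset.
apply/and5P; split => //=.
- by rewrite finset.setUCr.
- by rewrite finset.disjoints_subset finset.setCK finset.subsetUl.
- by rewrite finset.disjoints_subset finset.setCK finset.subsetUr.
rewrite cardC Aa Bb -/n /n1 /n2; move: nE r3.
by case: (N %% 3)%N => [|[|[|//]]] /=; clear; lia.
Qed.

Lemma pow3_le_ngood : (3 ^ N <= N.+1 ^ 2 * ngood N)%N.
Proof.
pose pr (c : {ffun 'I_N -> 'I_3}) := ([set v | c v == 0], [set v | c v == 1]).
have pr_inj : injective pr.
  move=> c c' [] /finset.setP h0 /finset.setP h1; apply/ffunP => v.
  move: (h0 v) (h1 v); rewrite !inE.
  case: (c v) => [[|[|[|//]]] lt]; case: (c' v) => [[|[|[|//]]] lt'] //= _ _; exact: val_inj.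
have -> : (3 ^ N)%N = #|{ffun 'I_N -> 'I_3}| by rewrite card_ffun !card_ord.
rewrite -(card_codom pr_inj).
apply: (@leq_trans (\sum_(q : 'I_N.+1 * 'I_N.+1) #|disjoint_pairs q.1 q.2|)).
  apply: leq_trans (_ : #|\bigcup_(q : 'I_N.+1 * 'I_N.+1) disjoint_pairs q.1 q.2| <= _)%N.
    apply: subset_leq_card; apply/fintype.subsetP => p /codomP[c ->].
    have lt (A : {set 'I_N}) : (#|A| < N.+1)%N by rewrite ltnS -[leqRHS]card_ord max_card.
    apply/bigcupP; exists (Ordinal (lt (pr c).1), Ordinal (lt (pr c).2)) => //.
    rewrite inE /= !eqxx andbT /=; apply/fintype.subsetP => v; rewrite !inE => /eqP ->.
    by [].
  elim/big_ind2: _ => [|x A y B hA hB|//]; first by rewrite cards0.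
  by apply: leq_trans (leq_card_setU _ _) _; apply: leq_add.
rewrite -[X in (X ^ 2)%N]card_ord -mulnn -card_prod -sum_nat_const.
by apply: leq_sum => q _; apply: card_disjoint_pairs_le_ngood.
Qed.

End Partitions.

Section Sampling.
Variables (R : realType) (N : nat).

Definition cls (P : part3 N) (j : 'I_3) : {set 'I_N} :=
  if j == 0 then P.1.1 else if j == 1 then P.1.2 else P.2.

Definition lab (P : part3 N) : {ffun 'I_N -> 'I_3} :=
  [ffun v => if v \in P.1.1 then 0 else if v \in P.1.2 then 1 else ord_max].

Lemma cls_lab (P : part3 N) j v : good P -> (v \in cls P j) = (lab P v == j).
Proof.
move=> gP; have := good_mem v gP; case/and5P: gP => _ d12 d13 d23 _.
have := disjointFr d12 (x := v); have := disjointFr d13 (x := v).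
have := disjointFr d23 (x := v); rewrite ffunE /cls.
case: j => [[|[|[|//]]] lt] /=; case: (v \in P.1.1); case: (v \in P.1.2); case: (v \in P.2);
  move=> h1 h2 h3 //= _; by [move: (h1 isT)|move: (h2 isT)|move: (h3 isT)].
Qed.

Lemma lab_inj : {in [set P | good P] &, injective lab}.
Proof.
move=> P Q; rewrite !inE => gP gQ E.
have clsE j : cls P j = cls Q j by apply/finset.setP => v; rewrite !cls_lab // E.
have := clsE 0; have := clsE 1; have := clsE ord_max; rewrite /cls /=.
by case: P {gP E clsE} => [[P1 P2] P3]; case: Q {gQ} => [[Q1 Q2] Q3] /= -> -> ->.
Qed.

Let unif (v : 'I_N) (b : 'I_3) : R := 3^-1.

Let unif_ge0 v b : 0 <= unif v b. Proof. by rewrite /unif invr_ge0. Qed.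

Let unif_sum v : \sum_b unif v b = 1.
Proof. by rewrite /unif sumr_const card_ord -(mulr_natl 3^-1 3) mulfV // pnatr_eq0. Qed.

Lemma good_transfer (A : {ffun 'I_N -> 'I_3} -> bool) :
  (#|[set P | good P && A (lab P)]|)%:R <= (N.+1%:R ^+ 2 * (ngood N)%:R) * prob unif A.
Proof.
have -> : prob unif A = (#|[set c | A c]|)%:R / (3 ^ N)%N%:R.
  rewrite /prob -sum1_card natr_sum mulr_suml.
  rewrite [RHS](eq_bigl A) => [|c]; last by rewrite inE.
  apply: eq_bigr => c _; rewrite /weight prodr_const card_ord mul1r natrX.
  by rewrite exprVn.
rewrite mulrA ler_pdivlMr //.
have h1 : (#|[set P | good P && A (lab P)]| <= #|[set c | A c]|)%N.
  rewrite -(@card_in_imset _ _ lab); last first.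
    move=> P Q; rewrite !inE => /andP[gP _] /andP[gQ _]; apply: lab_inj; by rewrite inE.
  apply: subset_leq_card; apply/fintype.subsetP => c /imsetP[P].
  by rewrite inE => /andP[_ AP] ->; rewrite inE.
rewrite [leLHS]mulrC; apply: ler_pM => //; last by rewrite ler_nat.
by rewrite -natrX -natrM ler_nat pow3_le_ngood.
Qed.

Lemma good_sampling (j : 'I_3) (X : {set 'I_N}) (t : R) :
  (0 < N)%N -> 0 <= t -> t <= 2 * N%:R ->
  (#|[set P | good P && (t < `|(#|cls P j :&: X|)%:R - #|X|%:R / 3|)]|)%:R <=
  8 * N%:R ^+ 2 * expR (- (t ^+ 2 / (8 * N%:R))) * (ngood N)%:R.
Proof.
move=> N0 t0 t2.
pose Y (v : 'I_N) (b : 'I_3) : R := (b == j)%:R - 3^-1.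
pose A (c : {ffun 'I_N -> 'I_3}) := t < `|\sum_(v in X) 1 * Y v (c v)|.
have -> : [set P | good P && (t < `|(#|cls P j :&: X|)%:R - #|X|%:R / 3|)] =
    [set P | good P && A (lab P)].
  apply/finset.setP => P; rewrite !inE; case: (boolP (good P)) => //= gP.
  rewrite /A; under eq_bigr do rewrite mul1r /Y -cls_lab //.
  rewrite sumrB sumr_const -[_ *+ #|X|]mulr_natl -natr_sum -big_mkcondr sum1_card.
  congr (_ < `|_%:R - _|); rewrite -cardsE; congr #|pred_of_set _|.
  by apply/finset.setP => v; rewrite !inE andbC.
apply: le_trans (good_transfer A) _.
have tail : prob unif A <= 2 * expR (- (t ^+ 2 / (8 * N%:R))).
  apply: (@tail_bound R 'I_N 'I_3 unif unif_ge0 unif_sum X N (fun _ _ => 1) Y) => //.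
  - by apply: leq_trans (max_card _) _; rewrite card_ord.
  - by move=> _ _; rewrite normr1.
  - by move=> v b; rewrite /Y ler_norml; case: eqP => _ /=; lra.
  move=> v _; rewrite /unif -mulr_sumr /Y sumrB (bigD1 j) //= eqxx big1 => [|b /negbTE -> //].
  by rewrite sumr_const card_ord -(mulr_natl 3^-1 3) mulfV ?pnatr_eq0 // addr0 subrr mulr0.
have N1 : 1 <= N%:R :> R by rewrite ler1n.
have Ng : 0 <= (ngood N)%:R :> R by [].
have E0 := expR_ge0 (- (t ^+ 2 / (8 * N%:R))).
apply: le_trans (ler_wpM2l _ tail) _; first by rewrite mulr_ge0 ?sqr_ge0.
have h : N.+1%:R ^+ 2 <= 4 * N%:R ^+ 2 :> R by rewrite -natr1 !expr2; nra.
have := ler_wpM2r (mulr_ge0 Ng E0) h; lra.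
Qed.

End Sampling.

Section PartitionEvents.
Variables (R : realType) (N : nat).
Implicit Types (P : part3 N) (s : R).

Definition below (u : 'I_N) : {set 'I_N} := [set v : 'I_N | (v < u)%N].

Lemma card_below_ord (u : 'I_N) : #|below u| = u.
Proof.
have -> : below u = [set v in [set: 'I_N] | (v < u)%N] by apply/finset.setP => v; rewrite !inE.
have cN : #|[set: 'I_N]| = N by rewrite cardsT card_ord.
apply: (@card_below N [set: 'I_N] (@nat_of_ord N)); last by rewrite cN ltnW.
by split=> [v w _ _ /val_inj|v _]; rewrite ?cN.
Qed.

Definition uneven s (j : 'I_3) (X : {set 'I_N}) P : bool :=
  s < `|(#|cls P j :&: X|)%:R - #|X|%:R / 3|.

Definition uneven_part s P : bool := [exists p : 'I_3 * 'I_N, uneven s p.1 (below p.2) P].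

Lemma equidistributed_of_even s (j : 'I_3) P : good P -> ~~ uneven_part s P ->
  equidistributed (cls P j) (s + 1).
Proof.
move=> gP; rewrite negb_exists => /forallP h u.
have := h (j, u); rewrite /uneven /= -leNgt card_below_ord.
have -> : cls P j :&: below u = [set v in cls P j | (v < u)%N].
  by apply/finset.setP => v; rewrite !inE.
rewrite -/(rk _ _) => hu.
have [z1 z2] : (N <= 3 * #|cls P j| + 2)%N /\ (3 * #|cls P j| <= N + 3)%N.
  by apply: (good_sizes gP); rewrite /cls; case: ifP => _; [|case: ifP => _]; rewrite !inE eqxx ?orbT.
have N0 : 0 < N%:R :> R by rewrite ltr0n; apply: leq_ltn_trans (ltn_ord u).
have x0 : 0 <= (u%:R / N%:R : R) by rewrite divr_ge0.
have x1 : (u%:R / N%:R : R) <= 1 by rewrite ler_pdivrMr // mul1r ler_nat ltnW.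
have xE : u%:R = N%:R * (u%:R / N%:R) :> R by rewrite mulrC divfK // gt_eqF.
set x : R := u%:R / N%:R in x0 x1 xE *.
have z1' : N%:R <= 3 * #|cls P j|%:R + 2 :> R by rewrite -natrM -natrD ler_nat.
have z2' : 3 * #|cls P j|%:R <= N%:R + 3 :> R by rewrite -natrM -natrD ler_nat.
have err : `|(N%:R - 3 * #|cls P j|%:R) * x| <= 3.
  rewrite normrM (ger0_norm x0) -[leRHS]mulr1; apply: ler_pM => //.
  by rewrite ler_norml; clear - z1' z2'; lra.
by move: hu err; rewrite xE !ler_norml; clear; lra.
Qed.

Definition left_part (A : {set 'I_N}) : {set 'I_N} := [set v in A | (4 * v <= N)%N].

Lemma overlap_of_even s (A : {set 'I_N}) P : equidistributed A (s + 1) ->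
  (N <= 3 * #|A| + 2)%N -> (800 <= N)%N -> 0 <= s -> 200 * (s + 1) <= N%:R ->
  ~~ uneven s 1 (left_part A) P -> overlap R A P.1.2.
Proof.
move=> eqA szA N800 s0 sN; rewrite /uneven -leNgt => hu.
have N8 : 800 <= N%:R :> R by rewrite ler_nat.
have uN : (N %/ 4 < N)%N by move: N800; clear; lia.
pose u := Ordinal uN.
have szA' : N%:R <= 3 * #|A|%:R + 2 :> R by rewrite -natrM -natrD ler_nat.
have rk_le_left : (rk A u <= #|left_part A|)%N.
  apply: subset_leq_card; apply/fintype.subsetP => v; rewrite !inE /= => /andP[-> vu] /=.
  by move: vu; clear; lia.
have N0 : 0 < N%:R :> R by clear - N8; lra.
have u_ge : 1 / 5 <= u%:R / N%:R :> R.
  rewrite ler_pdivlMr //.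
  have : (N <= 4 * u + 3)%N by rewrite /u /=; clear; lia.
  by rewrite -(ler_nat R) natrD natrM; clear - N8; lra.
have left_ge : N%:R / 20 - (s + 1) <= #|left_part A|%:R.
  have := eqA u; rewrite ler_norml => /andP[h1 _].
  have h2 : #|A|%:R * (1 / 5) <= #|A|%:R * (u%:R / N%:R) :> R by rewrite ler_wpM2l.
  have h3 : (rk A u)%:R <= #|left_part A|%:R :> R by rewrite ler_nat.
  by clear - h1 h2 h3 szA' N8; lra.
have : 0 < (#|cls P 1 :&: left_part A|)%:R :> R.
  by move: hu; rewrite ler_norml; clear - left_ge sN s0; lra.
rewrite ltr0n => /card_gt0P[i]; rewrite !inE /cls /= => /andP[iP /andP[iA i4]].
exists i; split => //; rewrite ler_pdivrMr //.
by move: i4; rewrite -(ler_nat R) natrM; clear; lra.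
Qed.

Definition uneven_pair s (P P' : part3 N) : bool :=
  [|| uneven_part s P, uneven_part s P' |
      [exists j : 'I_3, uneven s 1 (left_part (cls P j)) P']].

Lemma card_good_exists (J : finType) (B : J -> part3 N -> bool) (b : R) :
  (forall j, (#|[set P | good P && B j P]|)%:R <= b) ->
  (#|[set P | good P && [exists j, B j P]]|)%:R <= #|J|%:R * b.
Proof.
move=> hB; have -> : #|J|%:R * b = \sum_(j : J) b by rewrite mulr_natl sumr_const.
apply: le_trans (_ : \sum_(j : J) (#|[set P | good P && B j P]|)%:R <= _); last first.
  by apply: ler_sum => j _; apply: hB.
rewrite -natr_sum ler_nat.
apply: leq_trans (_ : #|\bigcup_j [set P | good P && B j P]| <= _)%N.
  apply: subset_leq_card; apply/fintype.subsetP => P.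
  rewrite inE => /andP[gP /existsP[j Bj]]; apply/bigcupP; exists j => //.
  by rewrite inE gP.
elim/big_ind2: _ => [|x A y C hA hC|//]; first by rewrite cards0.
by apply: leq_trans (leq_card_setU _ _) _; apply: leq_add.
Qed.

(* [ngood] counts a set of [classical_sets], not a [finset]. *)
Lemma sum_good_const (x : R) : \sum_(P : part3 N | good P) x = (ngood N)%:R * x.
Proof.
rewrite (eq_bigl (mem [set P : part3 N | good P])) => [|P]; last by rewrite /= inE.
rewrite sumr_const mulr_natl /ngood; congr (_ *+ _).
by apply: eq_card => P; rewrite inE; apply/idP/idP; rewrite classical_sets.in_setE.
Qed.

Lemma uneven_pair_count s : (0 < N)%N -> 0 <= s -> s <= 2 * N%:R ->
  \sum_(P : part3 N | good P) \sum_(P' : part3 N | good P') (uneven_pair s P P')%:R <=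
  72 * N%:R ^+ 3 * expR (- (s ^+ 2 / (8 * N%:R))) * (ngood N)%:R ^+ 2.
Proof.
move=> N0 s0 s2.
set E := expR _; set G : R := (ngood N)%:R.
have E0 : 0 <= E by exact: expR_ge0.
have G0 : 0 <= G by [].
pose b := 8 * N%:R ^+ 2 * E * G.
have part_b : (#|[set P | good P && uneven_part s P]|)%:R <= 3 * N%:R * b.
  have -> : 3 * N%:R = #|{: 'I_3 * 'I_N}|%:R :> R by rewrite card_prod !card_ord natrM.
  by apply: card_good_exists => p; apply: good_sampling.
have ov_b P : (#|[set P' | good P' &&
    [exists j : 'I_3, uneven s 1 (left_part (cls P j)) P']]|)%:R <= 3 * b.
  have -> : 3 = #|'I_3|%:R :> R by rewrite card_ord.
  by apply: card_good_exists => j; apply: good_sampling.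
have cnt (A : part3 N -> bool) : \sum_(P | good P) (A P)%:R = (#|[set P | good P && A P]|)%:R :> R.
  rewrite -natr_sum -sum1_card; congr _%:R; rewrite [LHS]big_mkcond [RHS]big_mkcond.
  by apply: eq_bigr => P _; rewrite inE; case: (good P); case: (A P).
have Gsum := sum_good_const.
apply: le_trans (_ : \sum_(P : part3 N | good P) (G * (uneven_part s P)%:R +
    (3 * N%:R * b + 3 * b)) <= _).
  apply: ler_sum => P _; rewrite -Gsum.
  apply: le_trans (_ : \sum_(P' : part3 N | good P') ((uneven_part s P)%:R +
     ((uneven_part s P')%:R + ([exists j : 'I_3, uneven s 1 (left_part (cls P j)) P'])%:R)) <= _).
    apply: ler_sum => P' _; rewrite /uneven_pair.
    by case: uneven_part; case: uneven_part; case: existsP => _ /=; lra.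
  by rewrite big_split /= big_split /= !cnt lerD2l lerD.
rewrite big_split /= -mulr_sumr cnt Gsum.
have h1 := ler_wpM2l G0 part_b.
have N1 : 1 <= N%:R :> R by rewrite ler1n.
have h2 : G * (3 * b) <= N%:R * (G * (3 * b)) by rewrite ler_peMl // !mulr_ge0.
apply: le_trans (_ : 9 * (N%:R * (G * b)) <= _); first by clear - h1 h2; lra.
by apply: le_of_eq; rewrite /b; ring.
Qed.

End PartitionEvents.

Section Events.
Variables (R : realType) (rho : R -> R) (Lam : R).

Lemma postproc_fixed_prob (c tau K : R) (N : nat) (s b : R) (P P' : part3 N)
    (sel : graph N -> 'I_N -> nat) :
  profile rho Lam -> good P -> good P' -> (800 <= N)%N -> 0 <= s -> s + 1 <= 2 * N%:R ->
  200 * (s + 1) <= N%:R ->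
  (forall T : {set 'I_N}, (N <= 3 * #|T| + 2)%N ->
    exists mu f, fiedler_data c (profile_grid rho #|T|) mu f) ->
  (forall e,
    (forall T, T \in [:: P.1.1; P.1.2; P.2; P'.1.1] -> graph_ok rho c e T (s + 1)) ->
    (forall S, S \in [:: P.1.1; P.1.2; P.2; P'.1.1; P'.1.2] -> equidistributed S (s + 1)) ->
    (forall S, S \in [:: P.1.1; P.1.2; P.2] -> overlap R S P'.1.2) ->
    (distinf (sel e))%:R <= b) ->
  1 - (uneven_pair s P P')%:R - 40 * N%:R ^+ 2 * expR (- (s ^+ 2 / (8 * N%:R))) <=
  \sum_(e : graph N) (if (distinf (sel e))%:R <= b then edge_prob (wfun rho) e else 0).
Proof.
move=> rhoP gP gP' N800 s0 s2 s200 fd det.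
set E := expR _.
have E0 : 0 <= E by exact: expR_ge0.
have N0 : (0 < N)%N by apply: leq_trans N800.
have NE0 : 0 <= 10 * N%:R ^+ 2 * E by rewrite !mulr_ge0 // exprn_ge0.
rewrite -big_mkcond.
have ew0 := edge_weight_ge0 rhoP (N := N).
have [bad|] := boolP (uneven_pair s P P').
  apply: le_trans (_ : 0 <= _); first by rewrite subrr; move: NE0; clear; lra.
  by apply: sumr_ge0 => e _; exact: (weight_ge0 ew0).
rewrite !negb_or => /and3P[evP evP' ovP].
have eqd : forall S, S \in [:: P.1.1; P.1.2; P.2; P'.1.1; P'.1.2] -> equidistributed S (s + 1).
  have := equidistributed_of_even ord_max gP evP; have := equidistributed_of_even 1 gP evP.
  have := equidistributed_of_even 0 gP evP; have := equidistributed_of_even 1 gP' evP'.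
  have := equidistributed_of_even 0 gP' evP'; rewrite /cls /= => e1 e2 e3 e4 e5 S.
  by rewrite !inE => /or4P[/eqP->|/eqP->|/eqP->|/orP[/eqP->|/eqP->]].
have szP := good_sizes gP. have szP' := good_sizes gP'.
have ov : forall S, S \in [:: P.1.1; P.1.2; P.2] -> overlap R S P'.1.2.
  have clsov j : cls P j \in [:: P.1.1; P.1.2; P.2] -> overlap R (cls P j) P'.1.2.
    move=> hj; apply: (@overlap_of_even R N s) => //.
    - by apply: eqd; move: hj; rewrite !inE => /or3P[] ->; rewrite ?orbT.
    - by have [] := szP _ hj.
    - by move: ovP; rewrite negb_exists => /forallP /(_ j).
  have := clsov 0; have := clsov 1; have := clsov ord_max; rewrite /cls /= => c1 c2 c3 S.
  rewrite !inE => /or3P[/eqP->|/eqP->|/eqP->]; [apply: c3|apply: c2|apply: c1];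
    by rewrite !inE eqxx ?orbT.
pose Ts := [:: P.1.1; P.1.2; P.2; P'.1.1].
pose T_ (j : 'I_4) := nth finset.set0 Ts j.
have szT (j : 'I_4) : (N <= 3 * #|T_ j| + 2)%N.
  rewrite /T_ /Ts; case: j => [[|[|[|[|//]]]] lt] /=.
  - by have [] := szP P.1.1; rewrite ?inE ?eqxx.
  - by have [] := szP P.1.2; rewrite ?inE ?eqxx ?orbT.
  - by have [] := szP P.2; rewrite ?inE ?eqxx ?orbT.
  - by have [] := szP' P'.1.1; rewrite ?inE ?eqxx ?orbT.
pose bad (j : 'I_4) (e : graph N) := ~~ `[< graph_ok rho c e (T_ j) (s + 1) >].
have badj j : prob (edge_weight rho (N := N)) (bad j) <= 10 * N%:R ^+ 2 * E.
  have [mu [f fdj]] := fd _ (szT j).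
  have s10 : 0 <= s + 1 by clear - s0; lra.
  apply: le_trans (graph_ok_prob rhoP N0 s10 s2 fdj) _.
  apply: ler_wpM2l; first by rewrite mulr_ge0 // exprn_ge0.
  rewrite ler_expR lerN2; apply: ler_wpM2r; first by rewrite invr_ge0 mulr_ge0.
  by rewrite ler_pXn2r ?nnegrE // lerDl.
have allbad := prob_exists ew0 badj; rewrite card_ord in allbad.
have tot := prob_compl (edge_weight_sum rho (N := N)).
apply: le_trans (_ : 1 - prob (edge_weight rho (N := N)) (fun e => [exists j, bad j e]) <= _).
  by move: allbad; clear; rewrite subr0; lra.
rewrite -[leRHS]/(prob (edge_weight rho (N := N)) (fun e => (distinf (sel e))%:R <= b)).
rewrite [leRHS]tot lerD2l lerN2; apply: (prob_le ew0) => e.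
apply: contraR => nbad; apply: det => // T TTs.
have iT : (index T Ts < 4)%N by rewrite index_mem.
have TE : T_ (Ordinal iT) = T by rewrite /T_ nth_index.
move: nbad; rewrite negb_exists => /forallP /(_ (Ordinal iT)).
by rewrite /bad negbK TE => /asboolP.
Qed.

Theorem postproc_prob : 0 < Lam -> profile rho Lam ->
  exists tau K, [/\ 0 < tau, 0 < K & exists N1 : nat, forall (N : nat) (s b : R)
    (sel : graph N -> part3 N -> part3 N -> ('I_N -> nat)),
  (N1 <= N)%N -> 0 <= s -> s + 1 <= tau * N%:R -> K * (s + 1) <= b ->
  (forall e P P', good P -> good P' -> postproc e P P' (5 / 100 : R) (31 / 100 : R) (sel e P P')) ->
  1 - 112 * N%:R ^+ 3 * expR (- (s ^+ 2 / (8 * N%:R))) <=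
  \sum_(e : graph N) \sum_(P : part3 N | good P) \sum_(P' : part3 N | good P')
    (if (distinf (sel e P P'))%:R <= b then edge_prob (wfun rho) e / ((ngood N)%:R ^+ 2) else 0)].
Proof.
move=> Lam0 rhoP.
have [c c01 [m0 fd]] := grid_fiedler_data Lam0 rhoP.
have [tau [K [tau0 K0 close]]] := postproc_close rhoP Lam0 c01.
have i200 : 0 < 200^-1 :> R by rewrite invr_gt0 ltr0n.
exists (Num.min tau 200^-1), K; split=> //.
  by rewrite lt_min tau0 i200.
exists (maxn 800 (3 * m0 + 2)) => N s b sel; rewrite geq_max => /andP[N800 Nm0] s0 sN Kb out.
have N8 : 800 <= N%:R :> R by rewrite ler_nat.
have N0 : (0 < N)%N by apply: leq_trans N800.
have sN1 : s + 1 <= tau * N%:R by apply: le_trans sN _; rewrite ler_wpM2r // ge_min lexx.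
have sN2 : 200 * (s + 1) <= N%:R.
  rewrite mulrC -ler_pdivlMr // mulrC; apply: le_trans sN _.
  by rewrite ler_wpM2r // ge_min lexx orbT.
have s2 : s + 1 <= 2 * N%:R by clear - s0 sN2 N8; lra.
set E := expR _; set G : R := (ngood N)%:R.
have E0 : 0 <= E by exact: expR_ge0.
have G0 : 0 < G.
  rewrite ltr0n lt0n; apply/eqP => z.
  by have := pow3_le_ngood N; rewrite z muln0 leqn0 expn_eq0.
rewrite exchange_big /=.
under eq_bigr => P _ do rewrite exchange_big /=.
have fixed P P' : good P -> good P' ->
    (1 - (uneven_pair s P P')%:R - 40 * N%:R ^+ 2 * E) / G ^+ 2 <=
    \sum_(e : graph N) (if (distinf (sel e P P'))%:R <= b
      then edge_prob (wfun rho) e / G ^+ 2 else 0).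
  move=> gP gP'.
  rewrite (eq_bigr (fun e => (if (distinf (sel e P P'))%:R <= b
    then edge_prob (wfun rho) e else 0) / G ^+ 2)) => [|e _]; last by case: ifP; rewrite ?mul0r.
  rewrite -mulr_suml; apply: ler_wpM2r; first by rewrite invr_ge0 exprn_ge0 // ltW.
  apply: (@postproc_fixed_prob c tau K) => //.
    move=> T T3; apply: fd; move: Nm0 T3; clear; lia.
  move=> e gok eqd ov; apply: le_trans Kb; apply: (close N e P P') => //.
    by rewrite lerDr.
  exact: out.
have sums : \sum_(P : part3 N | good P) \sum_(P' : part3 N | good P')
    (1 - (uneven_pair s P P')%:R - 40 * N%:R ^+ 2 * E) / G ^+ 2 <=
    \sum_(P : part3 N | good P) \sum_(P' : part3 N | good P')
    \sum_(e : graph N) (if (distinf (sel e P P'))%:R <= b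
      then edge_prob (wfun rho) e / G ^+ 2 else 0).
  by apply: ler_sum => P gP; apply: ler_sum => P' gP'; apply: fixed.
apply: le_trans sums.
have Gsum := @sum_good_const R N.
pose U : R := \sum_(P : part3 N | good P) \sum_(P' : part3 N | good P') (uneven_pair s P P')%:R.
have -> : \sum_(P : part3 N | good P) \sum_(P' : part3 N | good P')
    (1 - (uneven_pair s P P')%:R - 40 * N%:R ^+ 2 * E) / G ^+ 2 =
    1 - 40 * N%:R ^+ 2 * E - U / G ^+ 2.
  under eq_bigr => P _ do rewrite -mulr_suml sumrB sumrB !Gsum.
  rewrite -mulr_suml !sumrB !Gsum -/U; field; exact: lt0r_neq0.
have UG : U / G ^+ 2 <= 72 * N%:R ^+ 3 * E.
  rewrite ler_pdivrMr ?exprn_gt0 //; apply: uneven_pair_count => //.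
  by clear - s2; lra.
have N23 : N%:R ^+ 2 * E <= N%:R ^+ 3 * E.
  by rewrite ler_wpM2r // exprS ler_peMl ?exprn_ge0 // ler1n.
by clear - UG N23; rewrite -!mulrA in UG *; lra.
Qed.

Theorem spectral_prob : 0 < Lam -> profile rho Lam ->
  exists tau K, [/\ 0 < tau, 0 < K & exists N1 : nat, forall (N : nat) (t b : R)
    (sel : graph N -> ('I_N -> nat)),
  (N1 <= N)%N -> 1 <= t -> t <= tau * N%:R -> N%:R * (K * t) <= b ->
  (forall e, spec_ser R e [set: 'I_N] (sel e)) ->
  1 - 10 * N%:R ^+ 2 * expR (- (t ^+ 2 / (8 * N%:R))) <=
  \sum_(e : graph N | (dist1 (sel e))%:R <= b) edge_prob (wfun rho) e].
Proof.
move=> Lam0 rhoP.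
have [c c01 [m0 fd]] := grid_fiedler_data Lam0 rhoP.
have /andP[c0 c1] := c01.
have den0 : 0 < 512 * (2 * Lam + 2) by clear - Lam0; lra.
have num0 : 0 < 36 * (2 * Lam + 2) by clear - Lam0; lra.
exists (Num.min 2 (c ^+ 2 / (512 * (2 * Lam + 2)))), (36 * (2 * Lam + 2) / c ^+ 3); split.
- by rewrite lt_min ltr0n divr_gt0 // exprn_gt0.
- by rewrite divr_gt0 // exprn_gt0.
exists m0.+1 => N t b sel Nm0 t1 tN Nb ser.
have N0 : (0 < N)%N by apply: leq_trans Nm0.
have t0 : 0 <= t by apply: le_trans t1.
have tN2 : t <= 2 * N%:R by apply: le_trans tN _; rewrite ler_wpM2r // ge_min lexx.
have tNc : t <= c ^+ 2 / (512 * (2 * Lam + 2)) * N%:R.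
  by apply: le_trans tN _; rewrite ler_wpM2r // ge_min lexx orbT.
set T := [set: 'I_N].
have cT : #|T| = N by rewrite cardsT card_ord.
have rkT u : rk T u = u.
  rewrite -[RHS]card_below_ord; apply: eq_card => v; by rewrite !inE.
have [mu [f fdT]] : exists mu f, fiedler_data c (profile_grid rho #|T|) mu f.
  by apply: fd; rewrite cT ltnW.
have eqd : equidistributed T t.
  move=> u; rewrite rkT cT [_ * (_ / _)]mulrC divfK ?subrr ?normr0 // pnatr_eq0.
  by rewrite -lt0n.
have ew0 := edge_weight_ge0 rhoP (N := N).
have tot := prob_compl (edge_weight_sum rho (N := N)).
rewrite -[leRHS]/(prob (edge_weight rho (N := N)) (fun e => (dist1 (sel e))%:R <= b)).
rewrite [leRHS]tot lerD2l lerN2.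
apply: le_trans (graph_ok_prob rhoP N0 t0 tN2 fdT).
apply: (prob_le ew0) => e; apply: contraNN => /asboolP [mu' [f' [fd' sok _]]].
have := spec_ser_close rhoP Lam0 c01 fd' t1 _ eqd sok (ser e); rewrite cT => /(_ tNc) h.
set D := _ / c ^+ 3 in h.
have DE : D = 36 * (2 * Lam + 2) / c ^+ 3 * t by rewrite /D mulrA mulrAC.
apply: le_trans Nb; rewrite -DE -[N in N%:R * D]card_ord mulr_natl -sumr_const.
rewrite /dist1; case: h => h.
  apply: le_trans (_ : (\sum_(i : 'I_N) adist (sel e i) i)%:R <= _); first by rewrite ler_nat geq_minl.
  rewrite natr_sum; apply: ler_sum => i _.
  by have := h i; rewrite inE rkT adistE; apply.
apply: le_trans (_ : (\sum_(i : 'I_N) adist (N - (sel e i).+1) i)%:R <= _); first by rewrite ler_nat geq_minr.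
rewrite natr_sum; apply: ler_sum => i _.
by have := h i; rewrite inE rkT adistE /revo cT; apply.
Qed.

End Events.

(** * Asymptotics *)

Section Asymptotics.
Variable R : realType.
Implicit Types (x y g d q tau kap : R).

Lemma ln_nat_unbounded q : exists N0, forall N : nat, (N0 <= N)%N -> (0 < N)%N /\ q <= ln (N%:R : R).
Proof.
exists (Num.truncn (expR q)).+1 => N hN; have N0 : (0 < N)%N by apply: leq_trans hN.
split=> //; rewrite -[leLHS]expRK ler_ln ?posrE ?expR_gt0 ?ltr0n //.
by apply: le_trans (ltW (truncnS_gt _)) _; rewrite ler_nat.
Qed.

Lemma powR_unbounded d q : 0 < d -> exists M, forall y, M <= y -> q <= y `^ d.
Proof.
move=> d0; exists (`|q| `^ d^-1) => y hy.
apply: le_trans (ler_norm q) _.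
have -> : `|q| = (`|q| `^ d^-1) `^ d by rewrite -powRrM mulVf ?gt_eqF // powRr1.
have h0 : 0 <= `|q| `^ d^-1 by exact: powR_ge0.
by apply: ge0_ler_powR; rewrite ?nnegrE ?(ltW d0) // (le_trans h0).
Qed.

Lemma ln_powR_small g d : 0 < d ->
  exists M, forall x, 0 < x -> M <= ln x -> ln x `^ g <= d * x.
Proof.
move=> d0; pose n := (Num.truncn g).+1.
pose F : R := (n.+1)`!%:R.
have F0 : 0 < F by rewrite ltr0n fact_gt0.
exists (Num.max 1 (F / d)) => x x0; rewrite ge_max => /andP[y1 yF].
set y := ln x in y1 yF *.
have y0 : 0 < y by apply: lt_le_trans y1.
have yn : y `^ g <= y ^+ n.
  by rewrite -powR_mulrn ?(ltW y0) // ler_powR // ltW // truncnS_gt.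
apply: le_trans yn _.
have := expR_ge1Dxn n (ltW y0); rewrite lnK ?posrE // -/F => h.
have {}h : y ^+ n * y <= x * F.
  by rewrite -exprSr -ler_pdivrMr //; apply: le_trans h; rewrite lerDr.
have Fy : F <= d * y by rewrite mulrC -ler_pdivrMr.
rewrite -(ler_pM2r y0); apply: le_trans h _.
by rewrite mulrAC mulrC; apply: ler_wpM2r; rewrite // ltW.
Qed.

Lemma tail_scale g kap tau q : 1 < g -> 0 < kap -> 0 < tau ->
  exists M, forall x, 0 < x -> M <= ln x ->
  let r := Num.sqrt (x * ln x `^ g) in
  [/\ q <= r, kap * r + 1 <= tau * x &
      112 * x ^+ 3 * expR (- ((kap * r) ^+ 2 / (8 * x))) < expR (- ln x `^ g) `^ (kap ^+ 2 / 16)].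
Proof.
move=> g1 kap0 tau0.
pose d := (tau / (2 * kap)) ^+ 2.
have k20 : 0 < tau / (2 * kap) by rewrite divr_gt0 // mulr_gt0.
have d0 : 0 < d by rewrite exprn_gt0.
have [M1 hM1] := ln_powR_small g d0.
pose del := kap ^+ 2 / 16.
have del0 : 0 < del by rewrite divr_gt0 // exprn_gt0.
have g10 : 0 < g - 1 by rewrite subr_gt0.
have [M2 hM2] := powR_unbounded (116 / del) g10.
pose M3 : R := Num.max (q ^+ 2) (2 / tau).
exists (Num.max (Num.max 1 M1) (Num.max M2 M3)) => x x0.
rewrite !ge_max => /andP[/andP[y1 yM1] /andP[yM2 /andP[yq ytau]]].
set y := ln x in y1 yM1 yM2 yq ytau *.
have y0 : 0 < y by apply: lt_le_trans y1.
have yx : y <= x.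
  have := expR_ge1Dx y; rewrite lnK ?posrE // => h.
  by apply: le_trans h; rewrite lerDr.
have Lg : y `^ g = y * y `^ (g - 1).
  have -> : y `^ g = y `^ (1 + (g - 1)) by congr (_ `^ _); ring.
  rewrite [LHS]powRD; last by rewrite (gt_eqF y0) implybT.
  by rewrite powRr1 // ltW.
have L1 : 1 <= y `^ g by rewrite -(powRr0 y) ler_powR // ltW // (lt_trans _ g1).
have L0 : 0 < y `^ g by apply: lt_le_trans L1.
have hd := hM1 x x0 yM1; rewrite -/y in hd.
have h2 := hM2 y yM2.
set L := y `^ g in Lg L1 L0 hd *.
have xL0 : 0 <= x * L by rewrite mulr_ge0 // ltW.
move=> r; rewrite /r; split.
- apply: le_trans (ler_norm q) _; rewrite -sqrtr_sqr ler_sqrt //.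
  apply: le_trans yq _; apply: le_trans yx _.
  by rewrite ler_peMr // ltW.
- have rx : Num.sqrt (x * L) <= tau / (2 * kap) * x.
    have kx0 : 0 <= tau / (2 * kap) * x by rewrite mulr_ge0 ?(ltW x0) ?(ltW k20).
    have -> : tau / (2 * kap) * x = Num.sqrt ((tau / (2 * kap) * x) ^+ 2).
      by rewrite sqrtr_sqr ger0_norm.
    rewrite ler_sqrt ?sqr_ge0 //.
    by rewrite exprMn -/d expr2 mulrCA ler_wpM2l // ltW.
  have := ler_wpM2l (ltW kap0) rx.
  have -> : kap * (tau / (2 * kap) * x) = tau * x / 2 by field; rewrite gt_eqF.
  have : 2 <= tau * x by rewrite mulrC -ler_pdivrMr //; apply: le_trans ytau yx.
  by clear; lra.
rewrite exprMn sqr_sqrtr // -expRM.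
have -> : - L * (kap ^+ 2 / 16) = - (del * L) by rewrite /del; ring.
have -> : kap ^+ 2 * (x * L) / (8 * x) = del * L + del * L.
  by rewrite /del; field; rewrite gt_eqF.
rewrite opprD expRD mulrA gtr_pMl ?expR_gt0 //.
rewrite expRN ltr_pdivrMr ?expR_gt0 // mul1r.
have -> : x ^+ 3 = expR (3 * y) by rewrite -[x in LHS]lnK ?posrE // -expRM_natl.
have a112 : 112 <= expR (112 : R) by apply: le_trans (expR_ge1Dx _); rewrite lerDr ler01.
apply: le_lt_trans (ler_wpM2r (expR_ge0 _) a112) _.
rewrite -expRD ltr_expR Lg mulrCA.
have h3 : 116 <= del * y `^ (g - 1) by rewrite mulrC -ler_pdivrMr.
have := ler_wpM2l (ltW y0) h3.
by move: y1; clear; lra.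
Qed.

Lemma cube_root_scale eps eta tau K : 0 < eps -> eta < 1 / 3 -> 0 < tau ->
  exists M, forall N, 0 < N -> M <= ln N -> exists t : R,
  [/\ 1 <= t, t <= tau * N, N * (K * t) <= N `^ (2 - eta) &
      10 * N ^+ 2 * expR (- (t ^+ 2 / (8 * N))) < eps].
Proof.
move=> eps0 eta3 tau0.
have e0 : 0 < 1 - 3 * eta by lra.
have [M1 hM1] := powR_unbounded K e0.
have [F F0 expF] : exists2 F : R, 0 < F & forall x, 0 <= x -> x ^+ 7 / F < expR (x / 8).
  have f0 : 0 < (7`!)%:R :> R by rewrite ltr0n fact_gt0.
  have h x : 0 <= x -> 1 + x ^+ 7 / (7`!)%:R <= expR x by move=> x0; exact: expR_ge1Dxn.
  move: (7`!)%:R f0 h => f f0 h.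
  exists (8 ^+ 7 * f) => [|x x0]; first by rewrite mulr_gt0 ?exprn_gt0.
  have x80 : 0 <= x / 8 by rewrite divr_ge0.
  apply: lt_le_trans (h _ x80).
  by rewrite exprMn exprVn invfM mulrA ltrDr ltr01.
pose M0 := Num.max (Num.max 1 M1) (Num.max tau^-1 (10 * F / eps)).
exists (3 * ln M0) => N N0 hN.
pose x := expR (ln N / 3).
have x0 : 0 < x by exact: expR_gt0.
have M00 : 0 < M0 by rewrite !lt_max ltr01.
have xM : M0 <= x.
  by rewrite -[M0]lnK ?posrE // ler_expR ler_pdivlMr // mulrC.
move: xM; rewrite !ge_max => /andP[/andP[x1 xM1] /andP[xtau xeps]].
have NE : N = x ^+ 3.
  rewrite /x -expRM_natl [_ * _]mulrC divfK ?lnK ?posrE // pnatr_eq0 //.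
exists (x ^+ 2); split.
- by rewrite exprn_ege1.
- rewrite NE [x ^+ 3]exprS mulrA ler_peMl ?exprn_ge0 ?(ltW x0) //.
  by rewrite mulrC -ler_pdivrMr // div1r.
- have -> : N `^ (2 - eta) = x ^+ 5 * x `^ (1 - 3 * eta).
    rewrite NE -(powR_mulrn _ (ltW x0)) -(powR_mulrn _ (ltW x0)) -powRrM -powRD.
      by congr (_ `^ _); ring.
    by rewrite (gt_eqF x0) implybT.
  rewrite NE mulrCA -exprD mulrC ler_wpM2l ?exprn_ge0 ?(ltW x0) //.
  exact: hM1.
have -> : (x ^+ 2) ^+ 2 / (8 * N) = x / 8 by rewrite NE; field; rewrite gt_eqF.
have hF := expF x (ltW x0).
rewrite expRN ltr_pdivrMr ?expR_gt0 //.
have h4 : 10 * F <= eps * x by rewrite [leRHS]mulrC -ler_pdivrMr.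
apply: le_lt_trans (_ : _ <= eps * (x ^+ 7 / F)) _; last by rewrite ltr_pM2l.
rewrite [leRHS]mulrA ler_pdivlMr // NE.
have := ler_wpM2r (exprn_ge0 6 (ltW x0)) h4.
have -> : 10 * F * x ^+ 6 = 10 * (x ^+ 3) ^+ 2 * F by ring.
by have -> : eps * x * x ^+ 6 = eps * x ^+ 7 by ring.
Qed.

End Asymptotics.

Theorem theorem1 (R : realType) (rho : R -> R) :
  (forall x : R, 0 <= x <= 1 -> 0 < rho x <= 1) ->
  C1_on01 rho ->
  (forall x : R, 0 < x < 1 -> derive1 rho x < 0) ->
  (exists C : R, 0 < C /\
     forall eps eta : R, 0 < eps < 1 -> 0 < eta < 1 / 3 ->
     exists N0 : nat, forall N : nat, (N0 <= N)%N ->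
     forall sel : graph N -> ('I_N -> nat),
       (forall e, spec_ser R e [set: 'I_N]%SET (sel e)) ->
       1 - eps < \sum_(e : graph N |
                        (dist1 (sel e))%:R <= C * (N%:R) `^ (2 - eta))
                   edge_prob (wfun rho) e)
  /\
  (forall gamma epsilon : R, 1 < gamma -> 0 < epsilon ->
     exists delta : R, 0 < delta /\
     exists N0 : nat, forall N : nat, (N0 <= N)%N ->
     forall sel : graph N -> part3 N -> part3 N -> ('I_N -> nat),
       (forall e P P', good P -> good P' ->
          postproc e P P' (5 / 100 : R) (31 / 100 : R) (sel e P P')) ->
       1 - (eps_gamma gamma N) `^ delta <
         \sum_(e : graph N) \sum_(P : part3 N | good P) \sum_(P' : part3 N | good P')
           (if (distinf (sel e P P'))%:R <= epsilon * Num.sqrt (N%:R * (ln (N%:R : R)) `^ gamma)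
            then edge_prob (wfun rho) e / ((ngood N)%:R ^+ 2) else 0)).
Proof.
move=> rho_pos rhoC1 rho_dec.
have [Lam Lam0 rhoP] := C1_profile rho_pos rhoC1 rho_dec.
split.
  have [tau [K [tau0 K0 [N1 spec]]]] := spectral_prob Lam0 rhoP.
  exists 1; split=> [|eps eta /andP[eps0 _] /andP[_ eta3]]; first exact: ltr01.
  have [M hM] := cube_root_scale K eps0 eta3 tau0.
  have [N2 hN2] := ln_nat_unbounded M.
  exists (maxn N1 N2) => N; rewrite geq_max => /andP[hN1 /hN2 [N0 lnN]] sel ser.
  have NR0 : 0 < N%:R :> R by rewrite ltr0n.
  have [t [t1 tN tb teps]] := hM _ NR0 lnN.
  have tb1 : N%:R * (K * t) <= 1 * N%:R `^ (2 - eta) by rewrite mul1r.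
  apply: lt_le_trans (spec N t _ sel hN1 t1 tN tb1 ser).
  by rewrite ltrD2l ltrN2.
move=> gamma epsilon gamma1 eps0.
have [tau [K [tau0 K0 [N1 post]]]] := postproc_prob Lam0 rhoP.
pose kap := epsilon / (2 * K).
have kap0 : 0 < kap by rewrite divr_gt0 // mulr_gt0.
exists (kap ^+ 2 / 16); split; first by rewrite divr_gt0 // exprn_gt0.
have [M hM] := tail_scale (2 * K / epsilon) gamma1 kap0 tau0.
have [N2 hN2] := ln_nat_unbounded M.
exists (maxn N1 N2) => N; rewrite geq_max => /andP[hN1 /hN2 [N0 lnN]] sel out.
have NR0 : 0 < N%:R :> R by rewrite ltr0n.
have := hM _ NR0 lnN; set r := Num.sqrt _ => -[r_big r_small tail].
have r0 : 0 <= r by exact: sqrtr_ge0.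
have s0 : 0 <= kap * r by rewrite mulr_ge0 // ltW.
have Kb : K * (kap * r + 1) <= epsilon * r.
  have e1 : K * (kap * r) = epsilon * r / 2 by rewrite /kap; field; rewrite gt_eqF.
  have e2 : 2 * K <= epsilon * r by rewrite [leRHS]mulrC -ler_pdivrMr.
  by rewrite mulrDr mulr1 e1; move: e2; clear; lra.
apply: lt_le_trans (post N (kap * r) _ sel hN1 s0 r_small Kb out).
by rewrite ltrD2l ltrN2.
Qed.
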